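(* Let $(A,\Delta)$ be a multiplier Banach-Hopf algebra over $\mathbb K$ possessing nonzero left- and right-invariant functionals, whose left-invariant functional $\varphi$ satisfies $\|\varphi\|\le 1$ and has the norm reproducing property. Let $(\widehat A,\widehat\Delta)$ be the dual object, and assume that the Banach algebra $\widehat A$ possesses a bounded approximate identity and that the norm reproducing property holds for $\widehat A$. Let $\widehat{\widehat A}$ be the dual object to $\widehat A$, with coproduct map $\widehat{\widehat\Delta}$. For $a\in A$ define $\Gamma(a):\widehat A\to\mathbb K$ by $\Gamma(a)(\omega)=\omega(a)$, $\omega\in\widehat A$. Then $\Gamma$ is an isomorphism of multiplier Banach-Hopf algebras from $A$ onto $\widehat{\widehat A}$; that is, $\Gamma$ (a continuous isomorphism of the Banach spaces $A$ and $\widehat{\widehat A}$) satisfies $$\Gamma(a_1 a_2)=\Gamma(a_1)\,\Gamma(a_2)\quad\text{for all }a_1,a_2\in A,$$ and $$\widehat{\widehat\Delta}(\Gamma(a))=(\Gamma\otimes\Gamma)(\Delta(a))\quad\text{for all }a\in A,$$ where on the right-hand side $\Gamma\otimes\Gamma$ denotes the canonical extension of $\Gamma\otimes\Gamma:A\widehat\otimes A\to \widehat{\widehat A}\widehat\otimes\widehat{\widehat A}$ to a multiplicative map $M(A\widehat\otimes A)\to M(\widehat{\widehat A}\widehat\otimes\widehat{\widehat A})$.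
   Context: **Banach algebras and multipliers.** $\mathbb K$ is a field with a nontrivial non-Archimedean absolute value; Banach spaces over $\mathbb K$ have ultrametric norms. A Banach space $E$ is polar if for each $y$ with $\|y\|>1$ there is a continuous linear $f:E\to\mathbb K$ with $|f(x)|\le1$ whenever $\|x\|\le 1$, and $|f(y)|>1$. $E\widehat\otimes F$ is the completion of $E\otimes F$ in the norm $\|g\|=\inf\max_i\|x_i\|\|y_i\|$ (infimum over representations $g=\sum_{i=1}^r x_i\otimes y_i$). A Banach algebra satisfies $\|xy\|\le\|x\|\|y\|$ (and its unit, if any, has norm 1); it is polar if its Banach space is. Its product is nondegenerate if ($ab=0\ \forall b$) implies $a=0$ and ($ab=0\ \forall a$) implies $b=0$. A bounded approximate identity is a norm-bounded net $(e_\lambda)$ with $e_\lambda x\to x$, $xe_\lambda\to x$ for all $x$. A multiplier on $A$ is a pair $c=(\rho_l,\rho_r)$ of continuous linear maps $A\to A$ with $\rho_l(ab)=\rho_l(a)b$, $\rho_r(ab)=a\rho_r(b)$, $\rho_r(a)b=a\rho_l(b)$; write $ca=\rho_l(a)$, $ac=\rho_r(a)$. The multipliers form a unital Banach algebra $M(A)$ with product $(\rho_l',\rho_r')(\rho_l'',\rho_r'')=(\rho_l'\rho_l'',\rho_r''\rho_r')$ and norm $\max(\|\rho_l\|,\|\rho_r\|)$; $A\subset M(A)$ and $A\widehat\otimes A\subset M(A)\widehat\otimes M(A)\subset M(A\widehat\otimes A)$. A continuous homomorphism $\Phi:A\to M(B)$ is nondegenerate if the spans of $\{\Phi(a)b\}$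 and of $\{b\Phi(a)\}$ are dense in $B$; if $A$ has a bounded approximate identity it then extends uniquely to a continuous homomorphism $M(A)\to M(B)$, denoted by the same symbol. **Multiplier Banach-Hopf algebras.** Let $A$ be a polar Banach algebra with nondegenerate product and a bounded approximate identity. A comultiplication is a nondegenerate continuous homomorphism $\Delta:A\to M(A\widehat\otimes A)$ such that (i) $T_1(a\otimes b)=\Delta(a)(1\otimes b)$, $T_2(a\otimes b)=(a\otimes1)\Delta(b)$, $T_3(a\otimes b)=(1\otimes b)\Delta(a)$, $T_4(a\otimes b)=\Delta(b)(a\otimes1)$ all lie in $A\widehat\otimes A$ for $a,b\in A$; (ii) $(\Delta\otimes\mathrm{id})\Delta=(\mathrm{id}\otimes\Delta)\Delta$ (extended homomorphisms, values in $M(A\widehat\otimes A\widehat\otimes A)$). $(A,\Delta)$ is a (regular) multiplier Banach-Hopf algebra if $T_1,\dots,T_4$ extend to bijective linear isometries of $A\widehat\otimes A$. With $m(a\otimes b)=ab$, the counit $\varepsilon:A\to\mathbb K$ is determined by $\varepsilon(a)b=m(T_1^{-1}(a\otimes b))$. **Invariant functionals.** For a continuous linear functional $\omega$ on $A$ and $a\in A$, $(\omega\otimes\mathrm{id})\Delta(a)\in M(A)$ has left part $b\mapsto(\omega\otimes\mathrm{id})(\Delta(a)(1\otimes b))$ and right part $b\mapsto(\omega\otimes\mathrm{id})((1\otimes b)\Delta(a))$; $(\mathrm{id}\otimes\omega)\Delta(a)\in M(A)$ has left part $b\mapsto(\mathrm{id}\otimes\omega)(\Delta(a)(b\otimes1))$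 and right part $b\mapsto(\mathrm{id}\otimes\omega)((b\otimes1)\Delta(a))$. A nonzero $\omega$ is left-invariant if $(\mathrm{id}\otimes\omega)\Delta(a)=\omega(a)1$ for all $a$, right-invariant if $(\omega\otimes\mathrm{id})\Delta(a)=\omega(a)1$ for all $a$. $\varphi$ denotes a left-invariant and $\psi$ a right-invariant functional; they are faithful and unique up to scalars. The norm reproducing property of $\varphi$: $\|a\|=\sup_{x\ne0}|\varphi(xa)|/\|x\|$ for all $a\in A$. **Dual object.** $\widehat A$ is the set of functionals $\varphi(\cdot\,a)$, $a\in A$ (equivalently of all $\varphi(b\,\cdot)$, or $\psi(\cdot\,c)$, or $\psi(d\,\cdot)$), with norm $\|\varphi(\cdot\,a)\|=\|a\|$ and product $(\omega_1\omega_2)(x)=(\omega_1\otimes\omega_2)\Delta(x):=(\varphi\otimes\varphi)(\Delta(x)(a_1\otimes a_2))$ for $\omega_i=\varphi(\cdot\,a_i)$. The elements of $\widehat A\widehat\otimes\widehat A$ are regarded as functionals on $A\widehat\otimes A$. The comultiplication $\widehat\Delta:\widehat A\to M(\widehat A\widehat\otimes\widehat A)$ is determined by $(\widehat\Delta(\omega_1)(1\otimes\omega_2))(x\otimes y)=(\omega_1\otimes\omega_2)((x\otimes1)\Delta(y))$ and $((\omega_1\otimes1)\widehat\Delta(\omega_2))(x\otimes y)=(\omega_1\otimes\omega_2)(\Delta(x)(1\otimes y))$. The functional $\widehat\psi(\omega)=\varepsilon(a)$ for $\omega=\varphi(\cdot\,a)$ is right-invariant and $\widehat\varphi(\omega)=\varepsilon(a)$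 for $\omega=\psi(a\,\cdot)$ is left-invariant on $\widehat A$. The norm reproducing property for $\widehat A$ means that the left-invariant functional on $\widehat A$ (suitably normalized) satisfies $\|\widehat\varphi\|\le1$ and $\|\omega\|=\sup_{\omega'\neq0}|\widehat\varphi(\omega'\omega)|/\|\omega'\|$ for all $\omega\in\widehat A$. The dual object $(\widehat{\widehat A},\widehat{\widehat\Delta})$ to $\widehat A$ is obtained by applying the same construction to $(\widehat A,\widehat\Delta)$ and $\widehat\varphi$. *)

(* Defs.v *)
From HB Require Import structures.
From mathcomp Require Import all_boot all_order all_algebra.
From mathcomp Require Import boolp classical_sets reals.
From mathcomp Require Import lra.

Set Implicit Arguments.
Unset Strict Implicit.
Unset Printing Implicit Defensive.

Import Order.TTheory GRing.Theory Num.Theory.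

Local Open Scope classical_set_scope.
Local Open Scope ring_scope.
Local Open Scope quotient_scope.

HB.mixin Record Field_isNAValued (R : realType) K of GRing.Field K := {
  absv : K -> R;
  absv_ge0 : forall x : K, 0 <= absv x;
  absv_eq0 : forall x : K, absv x = 0 <-> x = 0;
  absvM : forall x y : K, absv (x * y) = absv x * absv y;
  absvD : forall x y : K, absv (x + y) <= Num.max (absv x) (absv y);
  absv_nontrivial : exists x : K, x != 0 /\ absv x != 1
}.

#[short(type="naFieldType")]
HB.structure Definition NAField (R : realType) :=
  {K of GRing.Field K & Field_isNAValued R K}.

HB.mixin Record Lmodule_isNANormed (R : realType) (K : naFieldType R) V
    of GRing.Lmodule K V := {
  nrm : V -> R;
  nrm_eq0 : forall x : V, nrm x = 0 -> x = 0;
  nrmZ : forall (a : K) (x : V), nrm (a *: x) = absv a * nrm x;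
  nrmD : forall x y : V, nrm (x + y) <= Num.max (nrm x) (nrm y)
}.

#[short(type="naNormedType")]
HB.structure Definition NANormed (R : realType) (K : naFieldType R) :=
  {V of GRing.Lmodule K V & Lmodule_isNANormed R K V}.

Definition is_cauchy (R : realType) (K : naFieldType R) (V : naNormedType K)
    (u : nat -> V) :=
  forall e : R, 0 < e ->
    exists N, forall m n, (N <= m)%N -> (N <= n)%N -> nrm (u m - u n) < e.

Definition converges_to (R : realType) (K : naFieldType R) (V : naNormedType K)
    (u : nat -> V) (l : V) :=
  forall e : R, 0 < e -> exists N, forall n, (N <= n)%N -> nrm (u n - l) < e.

HB.mixin Record NANormed_isComplete (R : realType) (K : naFieldType R) V
    of NANormed R K V := {
  na_complete : forall u : nat -> V, is_cauchy u -> exists l, converges_to u l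
}.

#[short(type="naBanachType")]
HB.structure Definition NABanach (R : realType) (K : naFieldType R) :=
  {V of NANormed R K V & NANormed_isComplete R K V}.

(* Banach algebras are not assumed to be unital, so that the ring structures
   of the library do not apply; the norm of a unit is treated separately
   in [unit_normalized]. *)
HB.mixin Record NABanach_isAlgebra (R : realType) (K : naFieldType R) A
    of NABanach R K A := {
  bmul : A -> A -> A;
  bmulA : forall x y z : A, bmul x (bmul y z) = bmul (bmul x y) z;
  bmul_linl : forall (c : K) (x x' y : A),
    bmul (c *: x + x') y = c *: bmul x y + bmul x' y;
  bmul_linr : forall (c : K) (x y y' : A),
    bmul x (c *: y + y') = c *: bmul x y + bmul x y';
  nrm_bmul : forall x y : A, nrm (bmul x y) <= nrm x * nrm y
}.

#[short(type="naBanachAlgType")]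
HB.structure Definition NABanachAlg (R : realType) (K : naFieldType R) :=
  {A of NABanach R K A & NABanach_isAlgebra R K A}.

Notation "x ** y" := (bmul x y) (at level 40, left associativity).

Section AbsvTheory.
Context (R : realType) (K : naFieldType R).

Lemma absv0 : absv (0 : K) = 0 :> R.
Proof. exact/absv_eq0. Qed.

Lemma absv1 : absv (1 : K) = 1 :> R.
Proof.
have n0 : absv (1 : K) != 0 :> R.
  by apply/eqP => /absv_eq0 /eqP; rewrite oner_eq0.
by apply: (mulfI n0); rewrite mulr1 -absvM mulr1.
Qed.

Lemma absvN1 : absv (-1 : K) = 1 :> R.
Proof.
have : absv (-1 : K) ^+ 2 = 1 :> R by rewrite expr2 -absvM mulrNN mulr1 absv1.
by move/eqP; rewrite sqrf_eq1 => /orP[/eqP//|/eqP h]; have := absv_ge0 (-1 : K); rewrite h ler0N1.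
Qed.

Context (V : naNormedType K).

Lemma nrm0 : nrm (0 : V) = 0.
Proof. by rewrite -(scale0r (0 : V)) nrmZ absv0 mul0r. Qed.

Lemma nrmN (x : V) : nrm (- x) = nrm x.
Proof. by rewrite -scaleN1r nrmZ absvN1 mul1r. Qed.

Lemma nrm_ge0 (x : V) : 0 <= nrm x.
Proof. by have := nrmD x (- x); rewrite subrr nrm0 nrmN maxxx. Qed.

Lemma nrmB (x y : V) : nrm (x - y) <= Num.max (nrm x) (nrm y).
Proof. by rewrite -(nrmN y) nrmD. Qed.

Lemma nrm_distC (x y : V) : nrm (x - y) = nrm (y - x).
Proof. by rewrite -nrmN opprB. Qed.

Lemma nrm_sum (I : Type) (s : seq I) (f : I -> V) :
  nrm (\sum_(i <- s) f i) <= \big[Num.max/0]_(i <- s) nrm (f i).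
Proof.
elim: s => [|i s IH]; first by rewrite !big_nil nrm0.
rewrite !big_cons (le_trans (nrmD _ _))// ge_max le_max lexx/= le_max.
by rewrite IH orbT.
Qed.

Lemma nrm_small (x : V) : (forall e : R, 0 < e -> nrm x < e) -> x = 0.
Proof.
move=> h; apply: nrm_eq0; apply/eqP; rewrite eq_le nrm_ge0 andbT leNgt.
by apply/negP => /h; rewrite ltxx.
Qed.

Lemma converges_to_uniq (u : nat -> V) l l' :
  converges_to u l -> converges_to u l' -> l = l'.
Proof.
move=> h h'; apply/eqP; rewrite -subr_eq0; apply/eqP; apply: nrm_small => e e0.
have [N hN] := h e e0; have [N' hN'] := h' e e0.
set n := maxn N N'.
have -> : l - l' = (u n - l') - (u n - l) by rewrite opprB [RHS]addrC addrA subrK.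
rewrite (le_lt_trans (nrmB _ _))// gt_max hN ?hN'//; [exact: leq_maxr|exact: leq_maxl].
Qed.

Lemma converges_to_nrm_le (u : nat -> V) l (r : R) :
  converges_to u l -> (forall n, nrm (u n) <= r) -> nrm l <= r.
Proof.
move=> ul ur; apply/ler_addgt0Pr => e e0.
have [N hN] := ul e e0.
have -> : l = u N - (u N - l) by rewrite opprB [RHS]addrC subrK.
rewrite (le_trans (nrmB _ _))// ge_max; apply/andP; split.
  by apply: (le_trans (ur N)); rewrite lerDl ltW.
apply: (le_trans (ltW (hN _ (leqnn _)))); rewrite lerDr.
exact: le_trans (nrm_ge0 (u 0%N)) (ur 0%N).
Qed.

Lemma converges_cauchy (u : nat -> V) l : converges_to u l -> is_cauchy u.
Proof.
move=> h e e0; have [N hN] := h e e0; exists N => m n Nm Nn.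
have -> : u m - u n = (u m - l) - (u n - l) by rewrite opprB addrA subrK.
by rewrite (le_lt_trans (nrmB _ _))// gt_max !hN.
Qed.

End AbsvTheory.

(* the ground field as a one-dimensional normed space, the target of functionals *)
HB.instance Definition _ (R : realType) (K : naFieldType R) :=
  Lmodule_isNANormed.Build R K K^o
    (fun x : K^o => proj1 (absv_eq0 (x : K))) (fun a x : K^o => absvM (a : K) (x : K))
    (fun x y : K^o => absvD (x : K) (y : K)).

Section Maps.
Context (R : realType) (K : naFieldType R).

Definition is_linear (E F : lmodType K) (f : E -> F) :=
  forall (a : K) (x y : E), f (a *: x + y) = a *: f x + f y.

(* continuity of a linear map; see [bounded_linearP] for the topological form *)
Definition bounded_linear (E F : naNormedType K) (f : E -> F) :=
  is_linear f /\ exists C, forall x, nrm (f x) <= C * nrm x.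

(* the supremum is meaningful for bounded linear maps only *)
Definition opnorm (E F : naNormedType K) (f : E -> F) : R :=
  sup [set nrm (f x) / nrm x | x in [set x | x != 0]].

Definition isometric (E F : naNormedType K) (f : E -> F) :=
  forall x, nrm (f x) = nrm x.

Definition is_bilinear (E F G : lmodType K) (b : E -> F -> G) :=
  (forall y, is_linear (b^~ y)) /\ (forall x, is_linear (b x)).

Definition bounded_bilinear (E F G : naNormedType K) (b : E -> F -> G) :=
  is_bilinear b /\ exists C, forall x y, nrm (b x y) <= C * (nrm x * nrm y).

End Maps.

Section MapsTheory.
Context (R : realType) (K : naFieldType R).

Section Lin.
Context (E F : lmodType K) (f : E -> F) (lf : is_linear f).
Lemma is_linear0 : f 0 = 0.
Proof. by have := lf (-1) 0 0; rewrite !scaleN1r oppr0 addr0 addNr. Qed.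
Lemma is_linearD x y : f (x + y) = f x + f y.
Proof. by rewrite -{1}(scale1r x) lf scale1r. Qed.
Lemma is_linearZ a x : f (a *: x) = a *: f x.
Proof. by rewrite -{1}(addr0 (a *: x)) lf is_linear0 addr0. Qed.
Lemma is_linearN x : f (- x) = - f x.
Proof. by rewrite -scaleN1r is_linearZ scaleN1r. Qed.
Lemma is_linearB x y : f (x - y) = f x - f y.
Proof. by rewrite is_linearD is_linearN. Qed.
Lemma is_linear_sum (I : Type) (s : seq I) (g : I -> E) :
  f (\sum_(i <- s) g i) = \sum_(i <- s) f (g i).
Proof.
elim: s => [|i s IH]; first by rewrite !big_nil is_linear0.
by rewrite !big_cons is_linearD IH.
Qed.
End Lin.

Lemma bounded_pos (I : Type) (f g : I -> R) : (forall x, 0 <= g x) ->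
  (exists C, forall x, f x <= C * g x) ->
  exists C, 0 < C /\ forall x, f x <= C * g x.
Proof.
move=> g0 [C hC]; exists (Num.max C 1); split; first by rewrite lt_max ltr01 orbT.
by move=> x; apply: (le_trans (hC x)); rewrite ler_wpM2r// le_max lexx.
Qed.

Lemma bounded_linear_pos (E F : naNormedType K) (f : E -> F) : bounded_linear f ->
  exists C, 0 < C /\ forall x, nrm (f x) <= C * nrm x.
Proof. by case=> _; apply: (@bounded_pos _ (fun x => nrm (f x)) (fun x => nrm x)) => x; exact: nrm_ge0. Qed.

Lemma bounded_linear_id (E : naNormedType K) : bounded_linear (@id E).
Proof. by split=> //; exists 1 => x; rewrite mul1r. Qed.

Lemma bounded_linear_comp (E F G : naNormedType K) (g : F -> G) (f : E -> F) :
  bounded_linear g -> bounded_linear f -> bounded_linear (fun x => g (f x)).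
Proof.
move=> bg bf; have [C [C0 hC]] := bounded_linear_pos bg.
have [D [D0 hD]] := bounded_linear_pos bf; case: bg bf => lg _ [lf _].
split=> [a x y|]; first by rewrite lf lg.
by exists (C * D) => x; apply: (le_trans (hC _)); rewrite -mulrA ler_wpM2l// ltW.
Qed.

Lemma bounded_linear_comb (E F : naNormedType K) (c : K) (f g : E -> F) :
  bounded_linear f -> bounded_linear g -> bounded_linear (fun x => c *: f x + g x).
Proof.
move=> bf bg; have [C [C0 hC]] := bounded_linear_pos bf.
have [D [D0 hD]] := bounded_linear_pos bg; case: bg bf => lg _ [lf _].
split=> [a x y|].
  by rewrite lf lg !scalerDr !scalerA (mulrC c a) addrACA.
exists (absv c * C + D) => x.
have h1 : absv c * nrm (f x) <= absv c * C * nrm x by rewrite -mulrA ler_wpM2l ?absv_ge0.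
have h2 : 0 <= absv c * C * nrm x by rewrite !mulr_ge0 ?absv_ge0 ?nrm_ge0 ?ltW.
have h3 : 0 <= D * nrm x by rewrite mulr_ge0 ?nrm_ge0 ?ltW.
rewrite mulrDl (le_trans (nrmD _ _))// ge_max nrmZ; apply/andP; split.
  by rewrite (le_trans h1)// lerDl.
by rewrite (le_trans (hD x))// lerDr.
Qed.

Lemma bounded_linear_conv (E F : naNormedType K) (f : E -> F) u l :
  bounded_linear f -> converges_to u l -> converges_to (fun n => f (u n)) (f l).
Proof.
move=> bf ul e e0; have [C [C0 hC]] := bounded_linear_pos bf; case: bf => lf _.
have [N hN] := ul (e / C) (divr_gt0 e0 C0); exists N => n Nn.
rewrite -is_linearB// (le_lt_trans (hC _))// mulrC -ltr_pdivlMr//; exact: hN.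
Qed.

Lemma absv_gt0 (z : K) : z != 0 -> 0 < absv z :> R.
Proof.
by move=> z0; rewrite lt_neqAle absv_ge0 andbT eq_sym; apply/eqP => /absv_eq0 /eqP; rewrite (negbTE z0).
Qed.

Lemma absvV (z : K) : z != 0 -> absv z^-1 = (absv z)^-1 :> R.
Proof.
move=> z0; have zp := absv_gt0 z0.
by apply: (mulfI (lt0r_neq0 zp)); rewrite -absvM !divff ?absv1 ?lt0r_neq0.
Qed.

Lemma absvX (z : K) n : absv (z ^+ n) = absv z ^+ n :> R.
Proof. by elim: n => [|n IH]; rewrite ?expr0 ?absv1// !exprS absvM IH. Qed.

Lemma absv_large : exists c : K, c != 0 /\ 1 < absv c :> R.
Proof.
have [x [x0 x1]] : exists x : K, x != 0 /\ absv x != 1 :> R by exact: absv_nontrivial.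
have [x_lt|x_gt|h] := ltrgtP (absv x : R) 1; [|by exists x|by rewrite h eqxx in x1].
exists x^-1; split; first by rewrite invr_eq0.
by rewrite absvV// invf_gt1// absv_gt0.
Qed.

Lemma expr_unbounded (t r : R) : 1 < t -> exists n, r < t ^+ n.
Proof.
move=> t1; have t0 : 0 < t - 1 by rewrite subr_gt0.
have hy n : n%:R * (t - 1) <= t ^+ n.
  elim: n => [|n IH]; first by rewrite mul0r.
  have h1 : 1 <= t ^+ n by rewrite exprn_ege1// ltW.
  rewrite exprSr -natr1 mulrDl mul1r.
  have : (t - 1) <= t ^+ n * (t - 1) by rewrite ler_peMl// ltW.
  lra.
exists (Num.bound (`|r / (t - 1)|)); apply: lt_le_trans (hy _).
rewrite -ltr_pdivrMr//; apply: (@le_lt_trans _ _ `|r / (t - 1)|).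
  exact: ler_norm.
by have := archi_boundP (normr_ge0 `|r / (t - 1)|); rewrite normr_id.
Qed.

Lemma absv_approx : exists C : R, 0 < C /\
  forall t : R, 0 < t -> exists z : K, [/\ z != 0, t < absv z & absv z <= C * t].
Proof.
have [c [c0 c1]] := absv_large; have cp := absv_gt0 c0.
exists (absv c); split=> // t t0.
have [M hM] := expr_unbounded t^-1 c1.
have hex : exists k, t < absv (c ^+ k / c ^+ M).
  have [k hk] := expr_unbounded (t * absv c ^+ M) c1; exists k.
  by rewrite absvM absvV ?expf_neq0// !absvX ltr_pdivlMr// exprn_gt0.
case: (ex_minnP hex) => k hk kmin; exists (c ^+ k / c ^+ M); split=> //.
  by rewrite mulf_neq0 ?invr_eq0 ?expf_neq0.
case: k hk kmin => [|k] hk kmin.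
  move: hk; rewrite expr0 mul1r absvV ?expf_neq0// absvX => hk; exfalso.
  move: hM; rewrite -[ltLHS]mul1r ltr_pdivrMr// mulrC -ltr_pdivrMr ?exprn_gt0// mul1r.
  by move=> /(lt_trans hk); rewrite ltxx.
have -> : c ^+ k.+1 / c ^+ M = c * (c ^+ k / c ^+ M) by rewrite exprS mulrA.
rewrite absvM ler_pM2l// leNgt; apply/negP => /kmin; by rewrite ltnn.
Qed.

Lemma bounded_linearP (E F : naNormedType K) (f : E -> F) : is_linear f ->
  bounded_linear f <->
  forall (x : E) (e : R), 0 < e -> exists d : R, 0 < d /\
    forall y : E, nrm (y - x) < d -> nrm (f y - f x) < e.
Proof.
move=> lf; split=> [bf x e e0|h].
  have [C [C0 hC]] := bounded_linear_pos bf; exists (e / C); split.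
    exact: divr_gt0.
  by move=> y hy; rewrite -is_linearB// (le_lt_trans (hC _))// mulrC -ltr_pdivlMr.
have [d [d0 hd]] := h 0 1 ltr01.
have {}hd y : nrm y < d -> nrm (f y) < 1.
  by move=> yd; have := hd y; rewrite (is_linear0 lf) !subr0; exact.
have [C [C0 hC]] := absv_approx.
split=> //; exists (C / d) => x.
have [->|x0] := eqVneq x 0; first by rewrite (is_linear0 lf) !nrm0 mulr0.
have xp : 0 < nrm x.
  by rewrite lt_neqAle nrm_ge0 andbT eq_sym; apply/eqP => /nrm_eq0 /eqP; rewrite (negbTE x0).
have [z [z0 hz1 hz2]] := hC _ (divr_gt0 xp d0).
have zp := absv_gt0 z0.
have : nrm (z^-1 *: x) < d.
  by rewrite nrmZ absvV// ltr_pdivrMl// -ltr_pdivrMr.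
move/hd; rewrite is_linearZ// nrmZ absvV// ltr_pdivrMl// mulr1 => /ltW h1.
by apply: (le_trans h1); rewrite mulrAC -mulrA.
Qed.

End MapsTheory.

(* A formal sum  x_1 (x) y_1 + ... + x_r (x) y_r  is a list of pairs. *)
Section FormalTensors.
Context (R : realType) (K : naFieldType R) (E F : naNormedType K).
Implicit Types s t : seq (E * F).

Definition fsum (G : lmodType K) (b : E -> F -> G) s : G :=
  \sum_(p <- s) b p.1 p.2.

(* two formal sums have the same class in the algebraic tensor product iff they
   have the same image under every bilinear map *)
Definition same_tensor s t :=
  forall (G : lmodType K) (b : E -> F -> G), is_bilinear b -> fsum b s = fsum b t.

Definition rep_cost s : R := \big[Num.max/0]_(p <- s) (nrm p.1 * nrm p.2).

Definition tnorm s : R := inf [set rep_cost t | t in [set t | same_tensor s t]].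

Definition fscale (c : K) s : seq (E * F) := [seq (c *: p.1, p.2) | p <- s].
Definition fsub s t : seq (E * F) := s ++ fscale (-1) t.

Lemma fsum_cat (G : lmodType K) (b : E -> F -> G) s t :
  fsum b (s ++ t) = fsum b s + fsum b t.
Proof. by rewrite /fsum big_cat. Qed.

Lemma fsum_scale (G : lmodType K) (b : E -> F -> G) c s : is_bilinear b ->
  fsum b (fscale c s) = c *: fsum b s.
Proof.
move=> [bl _]; rewrite /fsum big_map scaler_sumr; apply: eq_bigr => p _.
exact: (is_linearZ (bl p.2)).
Qed.

Lemma fsum_sub (G : lmodType K) (b : E -> F -> G) s t : is_bilinear b ->
  fsum b (fsub s t) = fsum b s - fsum b t.
Proof. by move=> bb; rewrite fsum_cat fsum_scale// scaleN1r. Qed.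

Lemma same_refl s : same_tensor s s. Proof. by []. Qed.
Lemma same_sym s t : same_tensor s t -> same_tensor t s.
Proof. by move=> h G b bb; rewrite h. Qed.
Lemma same_trans s t u : same_tensor s t -> same_tensor t u -> same_tensor s u.
Proof. by move=> h k G b bb; rewrite h// k. Qed.
Lemma same_cat s s' t t' :
  same_tensor s s' -> same_tensor t t' -> same_tensor (s ++ t) (s' ++ t').
Proof. by move=> h k G b bb; rewrite !fsum_cat h// k. Qed.
Lemma same_scale c s t : same_tensor s t -> same_tensor (fscale c s) (fscale c t).
Proof. by move=> h G b bb; rewrite !fsum_scale// h. Qed.

Lemma rep_cost_ge0 s : 0 <= rep_cost s.
Proof.
rewrite /rep_cost; elim: s => [|p s IH]; first by rewrite big_nil.
by rewrite big_cons le_max IH orbT.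
Qed.

Lemma rep_cost_cat s t : rep_cost (s ++ t) = Num.max (rep_cost s) (rep_cost t).
Proof.
rewrite /rep_cost; elim: s => [|p s IH].
  by rewrite big_nil cat0s max_r// rep_cost_ge0.
by rewrite cat_cons !big_cons IH maxA.
Qed.

Lemma rep_cost_scale c s : rep_cost (fscale c s) = absv c * rep_cost s.
Proof.
rewrite /rep_cost; elim: s => [|p s IH]; first by rewrite !big_nil mulr0.
by rewrite /fscale/= !big_cons IH/= nrmZ -mulrA maxr_pMr ?absv_ge0.
Qed.

Lemma rep_cost_mem s p : p \in s -> nrm p.1 * nrm p.2 <= rep_cost s.
Proof.
rewrite /rep_cost; elim: s => [//|q s IH]; rewrite inE big_cons le_max.
by case/orP => [/eqP ->|/IH ->]; rewrite ?lexx// orbT.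
Qed.

Lemma fsum_nrm (G : naNormedType K) (b : E -> F -> G) C s :
  0 <= C -> (forall x y, nrm (b x y) <= C * (nrm x * nrm y)) ->
  nrm (fsum b s) <= C * rep_cost s.
Proof.
move=> C0 hC; rewrite /fsum /rep_cost; elim: s => [|p s IH].
  by rewrite !big_nil nrm0 mulr0.
rewrite !big_cons (le_trans (nrmD _ _))// maxr_pMr// ge_max !le_max hC/=.
by rewrite IH orbT.
Qed.

Let Tset s := [set rep_cost t | t in [set t | same_tensor s t]].

Lemma Tset_lb s : has_lbound (Tset s).
Proof. by exists 0 => _ [t _ <-]; exact: rep_cost_ge0. Qed.
Lemma Tset_neq0 s : Tset s !=set0.
Proof. by exists (rep_cost s); exists s => //; exact: same_refl. Qed.

Lemma tnorm_le s t : same_tensor s t -> tnorm s <= rep_cost t.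
Proof. by move=> h; apply: (ge_inf (Tset_lb s)); exists t. Qed.

Lemma tnorm_lt s r : tnorm s < r -> exists t, same_tensor s t /\ rep_cost t < r.
Proof. by case/(inf_lt (Tset_neq0 s)) => _ [t h <-] hr; exists t. Qed.

Lemma le_tnorm s r : (forall t, same_tensor s t -> r <= rep_cost t) -> r <= tnorm s.
Proof. by move=> h; apply: lb_le_inf (Tset_neq0 s) _ => _ [t ht <-]; exact: h. Qed.

Lemma tnorm_ge0 s : 0 <= tnorm s.
Proof. by apply: le_tnorm => t _; exact: rep_cost_ge0. Qed.

Lemma tnorm_same s t : same_tensor s t -> tnorm s = tnorm t.
Proof.
move=> h; apply/eqP; rewrite eq_le; apply/andP; split; apply: le_tnorm => u hu.
  by apply: tnorm_le; exact: same_trans h hu.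
by apply: tnorm_le; exact: same_trans (same_sym h) hu.
Qed.

Lemma tnorm_cat s t : tnorm (s ++ t) <= Num.max (tnorm s) (tnorm t).
Proof.
apply/ler_addgt0Pr => e e0.
have [s' [hs cs]] : exists s', same_tensor s s' /\ rep_cost s' < tnorm s + e.
  by apply: tnorm_lt; rewrite ltrDl.
have [t' [ht ct]] : exists t', same_tensor t t' /\ rep_cost t' < tnorm t + e.
  by apply: tnorm_lt; rewrite ltrDl.
apply: (le_trans (tnorm_le (same_cat hs ht))).
by rewrite rep_cost_cat addr_maxl ge_max !le_max (ltW cs) (ltW ct) orbT.
Qed.

Lemma tnorm_scale_le c s : tnorm (fscale c s) <= absv c * tnorm s.
Proof.
have [->|c0] := eqVneq c 0.
  rewrite absv0 mul0r.
  have h : same_tensor (fscale 0 s) [::].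
    by move=> G b bb; rewrite fsum_scale// scale0r /fsum big_nil.
  by rewrite (le_trans (tnorm_le h))// /rep_cost big_nil.
rewrite mulrC -ler_pdivrMr ?absv_gt0//; apply: le_tnorm => t ht.
rewrite ler_pdivrMr ?absv_gt0// mulrC -rep_cost_scale.
exact: tnorm_le (same_scale c ht).
Qed.

Lemma tnorm0 : tnorm [::] = 0.
Proof.
apply/eqP; rewrite eq_le tnorm_ge0 andbT (le_trans (tnorm_le (same_refl _)))//.
by rewrite /rep_cost big_nil.
Qed.

Lemma tnorm_fsubss s : tnorm (fsub s s) = 0.
Proof.
by rewrite -tnorm0; apply: tnorm_same => G b bb; rewrite fsum_sub// subrr /fsum big_nil.
Qed.

Lemma tnorm_fsubC s t : tnorm (fsub s t) = tnorm (fsub t s).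
Proof.
have H u v : tnorm (fsub u v) <= tnorm (fsub v u).
  have h : same_tensor (fsub u v) (fscale (-1) (fsub v u)).
    by move=> G b bb; rewrite fsum_scale// !fsum_sub// scaleN1r opprB.
  by rewrite (tnorm_same h) (le_trans (tnorm_scale_le _ _))// absvN1 mul1r.
by apply/eqP; rewrite eq_le !H.
Qed.

Lemma tnorm_fsub_trans t s u :
  tnorm (fsub s u) <= Num.max (tnorm (fsub s t)) (tnorm (fsub t u)).
Proof.
have h : same_tensor (fsub s u) (fsub s t ++ fsub t u).
  by move=> G b bb; rewrite fsum_cat !fsum_sub// addrA subrK.
by rewrite (tnorm_same h) tnorm_cat.
Qed.

Lemma fsum_tnorm (G : naNormedType K) (b : E -> F -> G) C s :
  is_bilinear b -> 0 <= C -> (forall x y, nrm (b x y) <= C * (nrm x * nrm y)) ->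
  nrm (fsum b s) <= C * tnorm s.
Proof.
move=> bb; rewrite le_eqVlt => /predU1P[<- hC|C0 hC].
  by have := fsum_nrm s (lexx 0) hC; rewrite !mul0r.
rewrite mulrC -ler_pdivrMr//; apply: le_tnorm => t ht.
by rewrite ler_pdivrMr// mulrC (ht _ _ bb) fsum_nrm// ltW.
Qed.

Definition tcauchy (u : nat -> seq (E * F)) := forall e : R, 0 < e ->
  exists N, forall m n, (N <= m)%N -> (N <= n)%N -> tnorm (fsub (u m) (u n)) < e.

Definition tseq := {u : nat -> seq (E * F) | `[< tcauchy u >]}.

Definition tequiv (u v : nat -> seq (E * F)) := forall e : R, 0 < e ->
  exists N, forall n, (N <= n)%N -> tnorm (fsub (u n) (v n)) < e.

Definition tequivb (u v : tseq) := `[< tequiv (val u) (val v) >].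

Lemma tequiv_refl u : tequiv u u.
Proof. by move=> e e0; exists 0%N => n _; rewrite tnorm_fsubss. Qed.
Lemma tequiv_sym u v : tequiv u v -> tequiv v u.
Proof.
by move=> h e /h [N hN]; exists N => n /hN; rewrite tnorm_fsubC.
Qed.
Lemma tequiv_trans v u w : tequiv u v -> tequiv v w -> tequiv u w.
Proof.
move=> h k e e0; have [N hN] := h e e0; have [M hM] := k e e0.
exists (maxn N M) => n; rewrite geq_max => /andP[Nn Mn].
by rewrite (le_lt_trans (tnorm_fsub_trans (v n) _ _))// gt_max hN ?hM.
Qed.

Lemma tequivb_refl : reflexive tequivb.
Proof. by move=> u; apply/asboolP; exact: tequiv_refl. Qed.
Lemma tequivb_sym : symmetric tequivb.
Proof. by move=> u v; apply/asboolP/asboolP; exact: tequiv_sym. Qed.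
Lemma tequivb_trans : transitive tequivb.
Proof.
move=> v u w /asboolP h /asboolP k; apply/asboolP; exact: tequiv_trans h k.
Qed.

Canonical tequiv_equiv := EquivRel tequivb tequivb_refl tequivb_sym tequivb_trans.

Definition ctensor := {eq_quot tequiv_equiv}.

HB.instance Definition _ := Choice.on ctensor.

End FormalTensors.

Section CTensorLmod.
Context (R : realType) (K : naFieldType R) (E F : naNormedType K).
Implicit Types (c : K).

Lemma tseqP (u : tseq E F) : tcauchy (val u).
Proof. by case: u => u /= /asboolP. Qed.

Definition mk_tseq (u : nat -> seq (E * F)) (h : tcauchy u) : tseq E F :=
  exist _ u (introT (asboolP _) h).

Definition cls (u : tseq E F) : ctensor E F := \pi_(ctensor E F) u.

Lemma clsP (u v : tseq E F) : cls u = cls v <-> tequiv (val u) (val v).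
Proof.
by split=> [/eqmodP/asboolP//|h]; apply/eqmodP/asboolP.
Qed.

Lemma cls_ind (P : ctensor E F -> Prop) : (forall u, P (cls u)) -> forall x, P x.
Proof. by move=> h x; rewrite -(reprK x); exact: h. Qed.

Lemma same_tequiv (u v : nat -> seq (E * F)) :
  (forall n, same_tensor (u n) (v n)) -> tequiv u v.
Proof.
move=> h e e0; exists 0%N => n _; have k : same_tensor (fsub (u n) (v n)) [::].
  by move=> G b bb; rewrite fsum_sub// (h n _ _ bb) subrr /fsum big_nil.
by rewrite (tnorm_same k) tnorm0.
Qed.

Lemma tcauchy_cst (s : seq (E * F)) : tcauchy (fun=> s).
Proof. by move=> e e0; exists 0%N => m n _ _; rewrite tnorm_fsubss. Qed.

Lemma same_sub_cat (s t s' t' : seq (E * F)) :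
  same_tensor (fsub (s ++ t) (s' ++ t')) (fsub s s' ++ fsub t t').
Proof.
by move=> G b bb; rewrite fsum_cat !fsum_sub// !fsum_cat opprD addrACA.
Qed.

Lemma same_sub_scale c (s s' : seq (E * F)) :
  same_tensor (fsub (fscale c s) (fscale c s')) (fscale c (fsub s s')).
Proof.
by move=> G b bb; rewrite fsum_scale// !fsum_sub// !fsum_scale// scalerBr.
Qed.

Lemma tcauchy_cat (u v : nat -> seq (E * F)) :
  tcauchy u -> tcauchy v -> tcauchy (fun n => u n ++ v n).
Proof.
move=> hu hv e e0; have [N hN] := hu e e0; have [M hM] := hv e e0.
exists (maxn N M) => m n; rewrite !geq_max => /andP[? ?] /andP[? ?].
rewrite (tnorm_same (same_sub_cat _ _ _ _)) (le_lt_trans (tnorm_cat _ _))//.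
by rewrite gt_max hN// hM.
Qed.

Lemma tequiv_cat (u v u' v' : nat -> seq (E * F)) : tequiv u u' -> tequiv v v' ->
  tequiv (fun n => u n ++ v n) (fun n => u' n ++ v' n).
Proof.
move=> hu hv e e0; have [N hN] := hu e e0; have [M hM] := hv e e0.
exists (maxn N M) => n; rewrite !geq_max => /andP[? ?].
rewrite (tnorm_same (same_sub_cat _ _ _ _)) (le_lt_trans (tnorm_cat _ _))//.
by rewrite gt_max hN// hM.
Qed.

Lemma scale_small c (e : R) : 0 < e -> exists d, 0 < d /\
  forall s : seq (E * F), tnorm s < d -> tnorm (fscale c s) < e.
Proof.
move=> e0; have c1 : 0 < absv c + 1 :> R by rewrite ltr_wpDl ?absv_ge0.
exists (e / (absv c + 1)); split=> [|s]; first exact: divr_gt0.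
rewrite ltr_pdivlMr// => hs; apply: le_lt_trans (tnorm_scale_le c s) _.
by apply: le_lt_trans hs; rewrite mulrDr mulr1 mulrC lerDl tnorm_ge0.
Qed.

Lemma tcauchy_scale c (u : nat -> seq (E * F)) :
  tcauchy u -> tcauchy (fun n => fscale c (u n)).
Proof.
move=> hu e e0; have [d [d0 hd]] := scale_small c e0; have [N hN] := hu d d0.
by exists N => m n Nm Nn; rewrite (tnorm_same (same_sub_scale _ _ _)) hd// hN.
Qed.

Lemma tequiv_scale c (u v : nat -> seq (E * F)) :
  tequiv u v -> tequiv (fun n => fscale c (u n)) (fun n => fscale c (v n)).
Proof.
move=> hu e e0; have [d [d0 hd]] := scale_small c e0; have [N hN] := hu d d0.
by exists N => n Nn; rewrite (tnorm_same (same_sub_scale _ _ _)) hd// hN.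
Qed.

Definition ct_fsum (s : seq (E * F)) : ctensor E F := cls (mk_tseq (tcauchy_cst s)).
Definition ct_zero : ctensor E F := ct_fsum [::].
Definition ct_add (x y : ctensor E F) : ctensor E F :=
  cls (mk_tseq (tcauchy_cat (tseqP (repr x)) (tseqP (repr y)))).
Definition ct_scale (c : K) (x : ctensor E F) : ctensor E F :=
  cls (mk_tseq (tcauchy_scale c (tseqP (repr x)))).
Definition ct_opp (x : ctensor E F) : ctensor E F := ct_scale (-1) x.

Lemma repr_cls (u : tseq E F) : tequiv (val (repr (cls u))) (val u).
Proof. by apply/clsP; rewrite /cls reprK. Qed.

Lemma ct_addE (u v : tseq E F) : ct_add (cls u) (cls v) =
  cls (mk_tseq (tcauchy_cat (tseqP u) (tseqP v))).
Proof. by apply/clsP => /=; apply: tequiv_cat; exact: repr_cls. Qed.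

Lemma ct_scaleE c (u : tseq E F) : ct_scale c (cls u) = cls (mk_tseq (tcauchy_scale c (tseqP u))).
Proof. by apply/clsP => /=; apply: tequiv_scale; exact: repr_cls. Qed.

Lemma ct_addA : associative ct_add.
Proof.
elim/cls_ind => u; elim/cls_ind => v; elim/cls_ind => w; rewrite !ct_addE.
by apply/clsP/same_tequiv => n G b bb /=; rewrite !fsum_cat addrA.
Qed.

Lemma ct_addC : commutative ct_add.
Proof.
elim/cls_ind => u; elim/cls_ind => v; rewrite !ct_addE.
by apply/clsP/same_tequiv => n G b bb /=; rewrite !fsum_cat addrC.
Qed.

Lemma ct_add0 : left_id ct_zero ct_add.
Proof.
elim/cls_ind => u; rewrite ct_addE.
by apply/clsP/same_tequiv => n G b bb /=.
Qed.

Lemma ct_addN : left_inverse ct_zero ct_opp ct_add.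
Proof.
elim/cls_ind => u; rewrite /ct_opp ct_scaleE ct_addE.
apply/clsP/same_tequiv => n G b bb /=.
by rewrite fsum_cat fsum_scale// scaleN1r addNr /fsum big_nil.
Qed.

HB.instance Definition _ := GRing.isZmodule.Build (ctensor E F)
  ct_addA ct_addC ct_add0 ct_addN.

Lemma ct_addrE (u v : tseq E F) : cls u + cls v =
  cls (mk_tseq (tcauchy_cat (tseqP u) (tseqP v))).
Proof. exact: ct_addE. Qed.

Lemma ct_scaleA a b x : ct_scale a (ct_scale b x) = ct_scale (a * b) x.
Proof.
elim/cls_ind: x => u; rewrite !ct_scaleE.
by apply/clsP/same_tequiv => n G f bf /=; rewrite !fsum_scale// scalerA.
Qed.

Lemma ct_scale1 : left_id 1 ct_scale.
Proof.
elim/cls_ind => u; rewrite !ct_scaleE.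
by apply/clsP/same_tequiv => n G f bf /=; rewrite !fsum_scale// scale1r.
Qed.

Lemma ct_scaleDr : right_distributive ct_scale +%R.
Proof.
move=> a; elim/cls_ind => u; elim/cls_ind => v.
rewrite ct_addrE !ct_scaleE ct_addrE.
apply/clsP/same_tequiv => n G f bf /=.
by rewrite !fsum_cat !fsum_scale// !fsum_cat scalerDr.
Qed.

Lemma ct_scaleDl x : {morph ct_scale^~ x : a b / a + b}.
Proof.
move=> a b; elim/cls_ind: x => u; rewrite !ct_scaleE ct_addrE.
apply/clsP/same_tequiv => n G f bf /=.
by rewrite !fsum_cat !fsum_scale// scalerDl.
Qed.

HB.instance Definition _ := GRing.Zmodule_isLmodule.Build K (ctensor E F)
  ct_scaleA ct_scale1 ct_scaleDr ct_scaleDl.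

Lemma ct_scalerE c (u : tseq E F) : c *: cls u = cls (mk_tseq (tcauchy_scale c (tseqP u))).
Proof. exact: ct_scaleE. Qed.

(* the limit of the convergent sequence  tnorm (u n),  written as a limsup *)
Definition ct_norm (x : ctensor E F) : R :=
  inf [set r | exists N, forall n, (N <= n)%N -> tnorm (val (repr x) n) <= r].

Let Nset (u : nat -> seq (E * F)) : set R :=
  [set r | exists N, forall n, (N <= n)%N -> tnorm (u n) <= r].

Lemma tnorm_ub_equiv (u v : nat -> seq (E * F)) (r e : R) : 0 < e -> 0 <= r ->
  tequiv u v -> (exists N, forall n, (N <= n)%N -> tnorm (v n) <= r) ->
  exists N, forall n, (N <= n)%N -> tnorm (u n) <= r + e.
Proof.
move=> e0 r0 h [N hN]; have [M hM] := h e e0; exists (maxn N M) => n.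
rewrite geq_max => /andP[/hN h1 /hM h2].
have k : same_tensor (u n) (fsub (u n) (v n) ++ v n).
  by move=> G b bb; rewrite fsum_cat fsum_sub// subrK.
rewrite (tnorm_same k) (le_trans (tnorm_cat _ _))// ge_max; apply/andP; split.
  by rewrite (le_trans (ltW h2))// lerDr.
by rewrite (le_trans h1)// lerDl ltW.
Qed.

Lemma Nset_lb (u : nat -> seq (E * F)) : has_lbound (Nset u).
Proof.
by exists 0 => r [N hN]; exact: le_trans (tnorm_ge0 _) (hN N (leqnn _)).
Qed.

Lemma Nset_neq0 (u : nat -> seq (E * F)) : tcauchy u -> Nset u !=set0.
Proof.
move=> h; have [N hN] := h 1 ltr01; exists (tnorm (u N) + 1); exists N => n Nn.
have k : same_tensor (u n) (u N ++ fsub (u n) (u N)).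
  by move=> G b bb; rewrite fsum_cat fsum_sub// addrC subrK.
rewrite (tnorm_same k) (le_trans (tnorm_cat _ _))// ge_max lerDl ler01/=.
rewrite (le_trans (ltW (hN _ _ Nn (leqnn _))))// lerDr tnorm_ge0 //.
Qed.

Lemma ct_norm_ge0 x : 0 <= ct_norm x.
Proof.
apply: lb_le_inf; first exact: (Nset_neq0 (tseqP (repr x))).
by move=> r [N hN]; exact: le_trans (tnorm_ge0 _) (hN N (leqnn _)).
Qed.

Lemma ct_norm_le (u : tseq E F) (r : R) : ct_norm (cls u) <= r <-> forall e, 0 < e ->
  exists N, forall n, (N <= n)%N -> tnorm (val u n) <= r + e.
Proof.
split=> [h e e0|h].
  have e2 : 0 < e / 2 by rewrite divr_gt0.
  have : ct_norm (cls u) < r + e / 2 by apply: le_lt_trans h _; rewrite ltrDl.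
  case/(inf_lt (Nset_neq0 (tseqP (repr (cls u))))) => r' hr' lt.
  have r0 : 0 <= r'.
    by case: hr' => N hN; exact: le_trans (tnorm_ge0 _) (hN N (leqnn _)).
  have [N hN] := tnorm_ub_equiv e2 r0 (tequiv_sym (repr_cls u)) hr'.
  by exists N => n /hN hn; apply: (le_trans hn); lra.
apply/ler_addgt0Pr => e e0; have e2 : 0 < e / 2 by rewrite divr_gt0.
have [N hN] := h _ e2.
have r0 : 0 <= r + e / 2 by exact: le_trans (tnorm_ge0 _) (hN N (leqnn _)).
apply: (ge_inf (Nset_lb _)).
have -> : r + e = (r + e / 2) + e / 2 by lra.
by apply: (tnorm_ub_equiv e2 r0 (repr_cls u)); exists N.
Qed.

Lemma ct_norm_eq0 x : ct_norm x = 0 -> x = 0.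
Proof.
elim/cls_ind: x => u h; apply/clsP => e e0 /=.
have e2 : 0 < e / 2 by rewrite divr_gt0.
have /ct_norm_le/(_ _ e2) [N hN] : ct_norm (cls u) <= 0 by rewrite h.
exists N => n /hN; rewrite /fsub /= cats0 add0r => hn; apply: (le_lt_trans hn); lra.
Qed.

Lemma ct_normZ_le a x : ct_norm (a *: x) <= absv a * ct_norm x.
Proof.
elim/cls_ind: x => u; rewrite ct_scalerE; apply/ct_norm_le => e e0 /=.
have a1 : 0 < absv a + 1 :> R by rewrite ltr_wpDl ?absv_ge0.
have e1 := divr_gt0 e0 a1.
have /ct_norm_le/(_ _ e1) [N hN] := lexx (ct_norm (cls u)).
exists N => n /hN hn; apply: le_trans (tnorm_scale_le _ _) _.
apply: (le_trans (ler_wpM2l (absv_ge0 a) hn)); rewrite mulrDr lerD2l.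
by rewrite mulrCA -[leRHS]mulr1 ler_pM2l// ler_pdivrMr// mul1r lerDl ler01.
Qed.

Lemma ct_normZ a x : ct_norm (a *: x) = absv a * ct_norm x.
Proof.
apply/eqP; rewrite eq_le ct_normZ_le/=; have [->|a0] := eqVneq a 0.
  by rewrite absv0 mul0r ct_norm_ge0.
have := ct_normZ_le a^-1 (a *: x); rewrite scalerA mulVf// scale1r absvV//.
by rewrite ler_pdivlMl// absv_gt0.
Qed.

Lemma ct_normD x y : ct_norm (x + y) <= Num.max (ct_norm x) (ct_norm y).
Proof.
elim/cls_ind: x => u; elim/cls_ind: y => v; rewrite ct_addrE; apply/ct_norm_le => e e0 /=.
have /ct_norm_le/(_ _ e0) [N hN] := lexx (ct_norm (cls u)).
have /ct_norm_le/(_ _ e0) [M hM] := lexx (ct_norm (cls v)).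
exists (maxn N M) => n; rewrite geq_max => /andP[/hN h1 /hM h2].
by rewrite (le_trans (tnorm_cat _ _))// addr_maxl ge_max !le_max h1 h2 orbT.
Qed.

HB.instance Definition _ := Lmodule_isNANormed.Build R K (ctensor E F)
  ct_norm_eq0 ct_normZ ct_normD.

Lemma ct_nrm_le (u : tseq E F) (r : R) : nrm (cls u) <= r <-> forall e, 0 < e ->
  exists N, forall n, (N <= n)%N -> tnorm (val u n) <= r + e.
Proof. exact: ct_norm_le. Qed.

Lemma ct_fsumB s t : ct_fsum s - ct_fsum t = ct_fsum (fsub s t).
Proof. by rewrite -scaleN1r ct_scalerE ct_addrE; apply/clsP/same_tequiv. Qed.

Lemma nrm_ct_fsum (s : seq (E * F)) : nrm (ct_fsum s) = tnorm s.
Proof.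
apply/eqP; rewrite eq_le; apply/andP; split.
  by apply/ct_nrm_le => e e0; exists 0%N => n _ /=; rewrite lerDl ltW.
apply/ler_addgt0Pr => e e0.
have /ct_nrm_le/(_ _ e0) [N hN] := lexx (nrm (ct_fsum s)).
exact: (hN N).
Qed.

Lemma ct_fsum_dense (x : ctensor E F) (e : R) : 0 < e ->
  exists s, nrm (x - ct_fsum s) < e.
Proof.
elim/cls_ind: x => u e0; have e2 : 0 < e / 4 by rewrite divr_gt0.
have [N hN] := tseqP u e2; exists (val u N).
rewrite -scaleN1r ct_scalerE ct_addrE; apply: (@le_lt_trans _ _ (e / 4)); last by lra.
apply/ct_nrm_le => d d0 /=; exists N => n Nn.
by apply: (le_trans (ltW (hN _ _ Nn (leqnn _)))); rewrite lerDl ltW.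
Qed.

Lemma ct_complete (x : nat -> ctensor E F) : is_cauchy x -> exists l, converges_to x l.
Proof.
move=> hx.
have pos n : 0 < (n.+1%:R)^-1 :> R by rewrite invr_gt0.
have small (e : R) : 0 < e -> exists N, forall n, (N <= n)%N -> (n.+1%:R)^-1 < e.
  move=> e0; exists (Num.bound e^-1) => n Nn; rewrite invf_plt ?posrE//.
  apply: (@lt_le_trans _ _ (Num.bound e^-1)%:R).
    by apply: archi_boundP; rewrite invr_ge0 ltW.
  by rewrite ler_nat ltnW.
have [s hs] := @boolp.choice _ _ _ (fun n => ct_fsum_dense (x n) (pos n)).
have cs : tcauchy s.
  move=> e e0; have [N hN] := hx e e0; have [M hM] := small e e0.
  exists (maxn N M) => m n; rewrite !geq_max => /andP[Nm Mm] /andP[Nn Mn].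
  rewrite -nrm_ct_fsum -ct_fsumB.
  have -> : ct_fsum (s m) - ct_fsum (s n) =
     (x m - x n) - ((x m - ct_fsum (s m)) - (x n - ct_fsum (s n))).
    by rewrite opprB addrA addrA subrK opprB [RHS]addrC addrA subrK.
  rewrite (le_lt_trans (nrmB _ _))// gt_max hN//=.
  rewrite (le_lt_trans (nrmB _ _))// gt_max !(lt_trans (hs _))// hM//.
exists (cls (mk_tseq cs)) => e e0; have [M hM] := small e e0.
have e2 : 0 < e / 2 by rewrite divr_gt0.
have [N hN] := cs _ e2.
exists (maxn N M) => n; rewrite geq_max => /andP[Nn Mn].
have -> : x n - cls (mk_tseq cs) = (x n - ct_fsum (s n)) + (ct_fsum (s n) - cls (mk_tseq cs)).
  by rewrite addrA subrK.
rewrite (le_lt_trans (nrmD _ _))// gt_max (lt_trans (hs _)) ?hM//=.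
rewrite -scaleN1r ct_scalerE ct_addrE; apply: (@le_lt_trans _ _ (e / 2)); last by lra.
apply/ct_nrm_le => d d0 /=; exists N => m Nm.
by apply: (le_trans (ltW (hN _ _ Nn Nm))); rewrite lerDl ltW.
Qed.

HB.instance Definition _ := NANormed_isComplete.Build R K (ctensor E F) ct_complete.

Definition tens (x : E) (y : F) : ctensor E F := ct_fsum [:: (x, y)].

End CTensorLmod.

Section CTensorTheory.
Context (R : realType) (K : naFieldType R) (E F : naNormedType K).

Lemma tens_bilinear : is_bilinear (@tens R K E F).
Proof.
split=> [y a x x'|x a y y']; rewrite /tens ct_scalerE ct_addrE.
  apply/clsP/same_tequiv => n G b bb /=; case: (bb) => bl _.
  by rewrite /fsum !big_cons !big_nil !addr0/= (bl y) (is_linearZ (bl y)).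
apply/clsP/same_tequiv => n G b bb /=; case: (bb) => bl br.
by rewrite /fsum !big_cons !big_nil !addr0/= (br x) (is_linearZ (bl y)).
Qed.

Lemma ct_fsumE s : ct_fsum s = \sum_(p <- s) tens p.1 p.2 :> ctensor E F.
Proof.
elim: s => [|[x y] s IH]; first by rewrite big_nil.
rewrite big_cons -IH /tens ct_addrE; exact/clsP/same_tequiv.
Qed.

Lemma nrm_tens_le x y : nrm (tens x y : ctensor E F) <= nrm x * nrm y.
Proof.
rewrite nrm_ct_fsum (le_trans (tnorm_le (same_refl _)))// /rep_cost.
by rewrite big_cons big_nil/= ge_max lexx mulr_ge0 ?nrm_ge0.
Qed.

Lemma tens_bounded : bounded_bilinear (@tens R K E F).
Proof.
by split; [exact: tens_bilinear|exists 1 => x y; rewrite mul1r nrm_tens_le].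
Qed.

Lemma ct_map_uniq (G : naNormedType K) (f g : ctensor E F -> G) :
  bounded_linear f -> bounded_linear g ->
  (forall x y, f (tens x y) = g (tens x y)) -> f = g.
Proof.
move=> bf bg fg; apply/funext => z; apply/eqP; rewrite -subr_eq0; apply/eqP.
have [C [C0 hC]] := bounded_linear_pos bf.
have [D [D0 hD]] := bounded_linear_pos bg.
case: bf bg => lf _ [lg _]; apply: nrm_small => e e0.
have CD0 : 0 < C + D by rewrite addr_gt0.
have [s hs] := ct_fsum_dense z (divr_gt0 e0 CD0).
have fgs : f (ct_fsum s) = g (ct_fsum s).
  by rewrite ct_fsumE !is_linear_sum//; apply: eq_bigr => p _; exact: fg.
have -> : f z - g z = f (z - ct_fsum s) - g (z - ct_fsum s).
  by rewrite (is_linearB lf) (is_linearB lg) fgs opprB addrA subrK.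
have h : (C + D) * nrm (z - ct_fsum s) < e by rewrite mulrC -ltr_pdivlMr.
rewrite (le_lt_trans (nrmB _ _))// gt_max; apply/andP; split; apply: le_lt_trans h.
  by rewrite (le_trans (hC _))// ler_wpM2r ?nrm_ge0// lerDl ltW.
by rewrite (le_trans (hD _))// ler_wpM2r ?nrm_ge0// lerDr ltW.
Qed.

(* the continuous linear map determined by  x (x) y |-> b x y ; it exists for
   every bounded bilinear map into a Banach space, see [ctliftP] *)
Definition ctlift (G : naNormedType K) (b : E -> F -> G) : ctensor E F -> G :=
  xget (fun=> 0)
    [set h : ctensor E F -> G | bounded_linear h /\ forall x y, h (tens x y) = b x y].

Lemma ctlift_uniq (G : naNormedType K) (b : E -> F -> G) h :
  bounded_linear h -> (forall x y, h (tens x y) = b x y) -> ctlift b = h.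
Proof.
move=> bh hb; apply: xget_unique => // k [bk kb].
by apply: ct_map_uniq => // x y; rewrite kb hb.
Qed.

Lemma converges_comb (G : naNormedType K) (c : K) (u v : nat -> G) l m :
  converges_to u l -> converges_to v m ->
  converges_to (fun n => c *: u n + v n) (c *: l + m).
Proof.
move=> hu hv e e0.
have c1 : 0 < absv c + 1 :> R by rewrite ltr_wpDl ?absv_ge0.
have [N hN] := hu _ (divr_gt0 e0 c1); have [M hM] := hv e e0.
exists (maxn N M) => n; rewrite geq_max => /andP[/hN h1 /hM h2].
have -> : c *: u n + v n - (c *: l + m) = c *: (u n - l) + (v n - m).
  by rewrite opprD addrACA scalerBr.
rewrite (le_lt_trans (nrmD _ _))// gt_max h2 andbT nrmZ.
move: h1; rewrite ltr_pdivlMr// => h1; apply: le_lt_trans h1.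
by rewrite mulrDr mulr1 mulrC lerDl nrm_ge0.
Qed.

Lemma ctlift_exists (G : naBanachType K) (b : E -> F -> G) C :
  is_bilinear b -> 0 <= C -> (forall x y, nrm (b x y) <= C * (nrm x * nrm y)) ->
  exists h : ctensor E F -> G, [/\ is_linear h,
    forall z, nrm (h z) <= C * nrm z & forall x y, h (tens x y) = b x y].
Proof.
move=> bb C0 hC.
have C1 : 0 < C + 1 by rewrite ltr_wpDl.
have fs s e : 0 < e -> tnorm s < e / (C + 1) -> nrm (fsum b s) < e.
  move=> e0; rewrite ltr_pdivlMr// => hs; apply: le_lt_trans hs.
  apply: le_trans (fsum_tnorm s bb C0 hC) _.
  by rewrite mulrDr mulr1 mulrC lerDl tnorm_ge0.
have ex (u : tseq E F) : exists l, converges_to (fun n => fsum b (val u n)) l.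
  apply: na_complete => e e0; have [N hN] := tseqP u (divr_gt0 e0 C1).
  by exists N => m n Nm Nn; rewrite -fsum_sub//; apply: fs => //; exact: hN.
have [h hh] := @boolp.choice _ _ _ (fun x : ctensor E F => ex (repr x)).
have hcls (u : tseq E F) : converges_to (fun n => fsum b (val u n)) (h (cls u)).
  move=> e e0; have [N hN] := hh (cls u) e e0.
  have [M hM] := tequiv_sym (repr_cls u) (divr_gt0 e0 C1).
  exists (maxn N M) => n; rewrite geq_max => /andP[/hN h1 /hM h2].
  have -> : fsum b (val u n) - h (cls u) =
      fsum b (fsub (val u n) (val (repr (cls u)) n)) +
      (fsum b (val (repr (cls u)) n) - h (cls u)).
    by rewrite fsum_sub// addrA subrK.
  by rewrite (le_lt_trans (nrmD _ _))// gt_max h1 fs.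
exists h; split.
- move=> a; elim/cls_ind => u; elim/cls_ind => v; rewrite ct_scalerE ct_addrE.
  apply: converges_to_uniq (converges_comb a (hcls u) (hcls v)).
  move=> e e0; have [N hN] := hcls (mk_tseq (tcauchy_cat (tseqP
    (mk_tseq (tcauchy_scale a (tseqP u)))) (tseqP v))) e e0.
  by exists N => n /hN /=; rewrite fsum_cat fsum_scale.
- elim/cls_ind => u; apply/ler_addgt0Pr => e e0.
  have e1 := divr_gt0 e0 C1; have [N hN] := hcls u e e0.
  have /ct_nrm_le/(_ _ e1) [M hM] := lexx (nrm (cls u)).
  set n := maxn N M.
  have h1 := hN n (leq_maxl _ _); have h2 := hM n (leq_maxr _ _).
  have -> : h (cls u) = fsum b (val u n) - (fsum b (val u n) - h (cls u)).
    by rewrite opprB [RHS]addrC subrK.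
  rewrite (le_trans (nrmB _ _))// ge_max; apply/andP; split.
    apply: le_trans (fsum_tnorm _ bb C0 hC) _.
    apply: le_trans (ler_wpM2l C0 h2) _; rewrite mulrDr lerD2l.
    by rewrite mulrCA -[leRHS]mulr1 ler_pM2l// ler_pdivrMr// mul1r lerDl ler01.
  by rewrite (le_trans (ltW h1))// lerDr mulr_ge0// nrm_ge0.
- move=> x y; apply: converges_to_uniq (hcls _) _ => e e0; exists 0%N => n _ /=.
  by rewrite /fsum big_seq1 subrr nrm0.
Qed.

Lemma bounded_bilinear_pos (G : naNormedType K) (b : E -> F -> G) :
  bounded_bilinear b ->
  exists C, 0 < C /\ forall x y, nrm (b x y) <= C * (nrm x * nrm y).
Proof.
case=> _ [C hC].
have [|D [D0 hD]] := @bounded_pos _ (E * F)%type (fun p => nrm (b p.1 p.2))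
   (fun p => nrm p.1 * nrm p.2) (fun p => mulr_ge0 (nrm_ge0 _) (nrm_ge0 _)).
  by exists C => p; exact: hC.
by exists D; split=> // x y; exact: (hD (x, y)).
Qed.

Lemma ctliftP (G : naBanachType K) (b : E -> F -> G) : bounded_bilinear b ->
  bounded_linear (ctlift b) /\ forall x y, ctlift b (tens x y) = b x y.
Proof.
move=> bb; have [C [C0 hC]] := bounded_bilinear_pos bb.
have [h [lh hn hb]] := ctlift_exists (proj1 bb) (ltW C0) hC.
have bh : bounded_linear h by split=> //; exists C.
by rewrite (ctlift_uniq bh hb).
Qed.

Lemma ctlift_le (G : naBanachType K) (b : E -> F -> G) C z :
  is_bilinear b -> 0 <= C -> (forall x y, nrm (b x y) <= C * (nrm x * nrm y)) ->
  nrm (ctlift b z) <= C * nrm z.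
Proof.
move=> bb C0 hC; have [h [lh hn hb]] := ctlift_exists bb C0 hC.
have bh : bounded_linear h by split=> //; exists C.
by rewrite (ctlift_uniq bh hb).
Qed.

End CTensorTheory.

Section CTensorMap.
Context (R : realType) (K : naFieldType R) (E F E' F' : naNormedType K).

Definition ctmap (f : E -> E') (g : F -> F') : ctensor E F -> ctensor E' F' :=
  ctlift (fun x y => tens (f x) (g y)).

Lemma tens_comp_bounded (f : E -> E') (g : F -> F') :
  bounded_linear f -> bounded_linear g ->
  bounded_bilinear (fun x y => tens (f x) (g y)).
Proof.
move=> bf bg; have [C [C0 hC]] := bounded_linear_pos bf.
have [D [D0 hD]] := bounded_linear_pos bg; case: bf bg => lf _ [lg _].
have [tl tr] := tens_bilinear E' F'.
split; first split=> [y a x x'|x a y y'].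
- by rewrite lf; exact: (tl (g y)).
- by rewrite lg; exact: (tr (f x)).
exists (C * D) => x y; rewrite (le_trans (nrm_tens_le _ _))// mulrACA.
by apply: ler_pM; rewrite ?nrm_ge0.
Qed.

Lemma ctmapP (f : E -> E') (g : F -> F') :
  bounded_linear f -> bounded_linear g ->
  bounded_linear (ctmap f g) /\
  forall x y, ctmap f g (tens x y) = tens (f x) (g y).
Proof. by move=> bf bg; apply: ctliftP; exact: tens_comp_bounded. Qed.

Lemma ctmap_le (f : E -> E') (g : F -> F') C D z : is_linear f -> is_linear g ->
  0 <= C -> 0 <= D ->
  (forall x, nrm (f x) <= C * nrm x) -> (forall y, nrm (g y) <= D * nrm y) ->
  nrm (ctmap f g z) <= C * D * nrm z.
Proof.
move=> lf lg C0 D0 hC hD; apply: ctlift_le.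
- by apply: (proj1 (@tens_comp_bounded f g _ _)); split=> //; [exists C|exists D].
- exact: mulr_ge0.
- move=> x y; rewrite (le_trans (nrm_tens_le _ _))// mulrACA.
  by apply: ler_pM; rewrite ?nrm_ge0.
Qed.

End CTensorMap.

Section CTensorAlg.
Context (R : realType) (K : naFieldType R) (A B : naBanachAlgType K).

Lemma bmul_linear_l (D : naBanachAlgType K) (a : D) : bounded_linear (bmul a).
Proof.
by split=> [c x y|]; [exact: bmul_linr|exists (nrm a) => x; exact: nrm_bmul].
Qed.
Lemma bmul_linear_r (D : naBanachAlgType K) (a : D) : bounded_linear (bmul^~ a).
Proof.
by split=> [c x y|]; [exact: bmul_linl|exists (nrm a) => x; rewrite mulrC nrm_bmul].
Qed.

Definition ct_lmul (a : A) (b : B) : ctensor A B -> ctensor A B :=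
  ctmap (bmul a) (bmul b).

(* the product with  (a (x) b)(a' (x) b') = aa' (x) bb' *)
Definition ct_mul (z w : ctensor A B) : ctensor A B :=
  ctlift (fun a b => ct_lmul a b w) z.

Lemma ct_lmulP a b : bounded_linear (ct_lmul a b) /\
  forall x y, ct_lmul a b (tens x y) = tens (a ** x) (b ** y).
Proof. by apply: ctmapP; exact: bmul_linear_l. Qed.

Lemma ct_lmul_le a b w : nrm (ct_lmul a b w) <= nrm a * nrm b * nrm w.
Proof.
apply: ctmap_le; rewrite ?nrm_ge0//;
  by [exact: (proj1 (bmul_linear_l _))|move=> x; exact: nrm_bmul].
Qed.

Lemma ct_lmul_bilinear w : is_bilinear (fun a b => ct_lmul a b w).
Proof.
have [tl tr] := tens_bilinear A B.
split=> [b c a a'|a c b b'].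
  suff -> : ct_lmul (c *: a + a') b = (fun w => c *: ct_lmul a b w + ct_lmul a' b w) by [].
  apply: ct_map_uniq; first exact: (proj1 (ct_lmulP _ _)).
    apply: bounded_linear_comb; exact: (proj1 (ct_lmulP _ _)).
  move=> x y; rewrite !(proj2 (ct_lmulP _ _)) bmul_linl; exact: (tl (b ** y)).
suff -> : ct_lmul a (c *: b + b') = (fun w => c *: ct_lmul a b w + ct_lmul a b' w) by [].
apply: ct_map_uniq; first exact: (proj1 (ct_lmulP _ _)).
  apply: bounded_linear_comb; exact: (proj1 (ct_lmulP _ _)).
move=> x y; rewrite !(proj2 (ct_lmulP _ _)) bmul_linl; exact: (tr (a ** x)).
Qed.

Lemma ct_lmul_bounded w : bounded_bilinear (fun a b => ct_lmul a b w).
Proof.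
split; first exact: ct_lmul_bilinear.
by exists (nrm w) => a b; rewrite mulrC ct_lmul_le.
Qed.

Lemma ct_mul_tensl a b w : ct_mul (tens a b) w = ct_lmul a b w.
Proof. by rewrite /ct_mul (proj2 (ctliftP (ct_lmul_bounded w))). Qed.

Lemma ct_mul_tens a b a' b' :
  ct_mul (tens a b) (tens a' b') = tens (a ** a') (b ** b').
Proof. by rewrite ct_mul_tensl (proj2 (ct_lmulP _ _)). Qed.

Lemma ct_mul_boundedl w : bounded_linear (ct_mul^~ w).
Proof. exact: (proj1 (ctliftP (ct_lmul_bounded w))). Qed.

Lemma ct_mul_nrm z w : nrm (ct_mul z w) <= nrm z * nrm w.
Proof.
rewrite mulrC; apply: ctlift_le; rewrite ?nrm_ge0//; first exact: ct_lmul_bilinear.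
by move=> a b; rewrite mulrC ct_lmul_le.
Qed.

Lemma ct_mul_linl c z z' w : ct_mul (c *: z + z') w = c *: ct_mul z w + ct_mul z' w.
Proof. exact: (proj1 (ct_mul_boundedl w)). Qed.

Lemma ct_mul_linr c z w w' : ct_mul z (c *: w + w') = c *: ct_mul z w + ct_mul z w'.
Proof.
suff h : ct_mul^~ (c *: w + w') = (fun z => c *: ct_mul z w + ct_mul z w') by exact: (congr1 (@^~ z) h).
apply: ct_map_uniq; first exact: ct_mul_boundedl.
  by apply: bounded_linear_comb; exact: ct_mul_boundedl.
by move=> a b; rewrite !ct_mul_tensl (proj1 (proj1 (ct_lmulP a b))).
Qed.

Lemma ct_mul_boundedr z : bounded_linear (ct_mul z).
Proof.
by split=> [c w w'|]; [exact: ct_mul_linr|exists (nrm z) => w; exact: ct_mul_nrm].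
Qed.

Lemma ct_mulA x y z : ct_mul x (ct_mul y z) = ct_mul (ct_mul x y) z.
Proof.
suff h : ct_mul^~ (ct_mul y z) = (fun x => ct_mul (ct_mul x y) z) by exact: (congr1 (@^~ x) h).
apply: ct_map_uniq; first exact: ct_mul_boundedl.
  by apply: (bounded_linear_comp (ct_mul_boundedl z)); exact: ct_mul_boundedl.
move=> a b.
suff h : (fun y => ct_mul (tens a b) (ct_mul y z)) =
          (fun y => ct_mul (ct_mul (tens a b) y) z) by exact: (congr1 (@^~ y) h).
apply: ct_map_uniq.
- by apply: (bounded_linear_comp (ct_mul_boundedr _)); exact: ct_mul_boundedl.
- by apply: (bounded_linear_comp (ct_mul_boundedl z)); exact: ct_mul_boundedr.
move=> a' b'; rewrite ct_mul_tens.
suff h : (fun z => ct_mul (tens a b) (ct_mul (tens a' b') z)) =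
          ct_mul (tens (a ** a') (b ** b')) by exact: (congr1 (@^~ z) h).
apply: ct_map_uniq; [|exact: ct_mul_boundedr|].
  by apply: (bounded_linear_comp (ct_mul_boundedr _)); exact: ct_mul_boundedr.
by move=> a'' b''; rewrite !ct_mul_tens !bmulA.
Qed.

HB.instance Definition _ := NABanach_isAlgebra.Build R K (ctensor A B)
  ct_mulA ct_mul_linl ct_mul_linr ct_mul_nrm.

Lemma tens_mul (a a' : A) (b b' : B) :
  tens a b ** tens a' b' = tens (a ** a') (b ** b') :> ctensor A B.
Proof. exact: ct_mul_tens. Qed.

End CTensorAlg.

Section OpNorm.
Context (R : realType) (K : naFieldType R) (E F : naNormedType K).

Lemma nrm_gt0 (x : E) : x != 0 -> 0 < nrm x.
Proof.
move=> x0; rewrite lt_neqAle nrm_ge0 andbT eq_sym.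
by apply/eqP => /nrm_eq0 /eqP; rewrite (negbTE x0).
Qed.

Lemma opnorm_bound (f : E -> F) x : bounded_linear f ->
  nrm (f x) <= opnorm f * nrm x.
Proof.
move=> [lf [C hC]]; have [->|x0] := eqVneq x 0.
  by rewrite (is_linear0 lf) !nrm0 mulr0.
rewrite -ler_pdivrMr ?nrm_gt0//; apply: ub_le_sup; last by exists x.
exists C => _ [y /= y0 <-]; by rewrite ler_pdivrMr ?nrm_gt0.
Qed.

Lemma opnorm_le (f : E -> F) r : 0 <= r ->
  (forall x, nrm (f x) <= r * nrm x) -> opnorm f <= r.
Proof.
move=> r0 h; rewrite /opnorm; set S := (X in sup X).
have [->|/set0P S0] := eqVneq S set0; first by rewrite sup0.
by apply: ge_sup => // _ [y /= y0 <-]; rewrite ler_pdivrMr ?nrm_gt0.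
Qed.

Lemma opnorm_ge0 (f : E -> F) : bounded_linear f -> 0 <= opnorm f.
Proof.
move=> bf; rewrite /opnorm; set S := (X in sup X).
have [->|/set0P[r Sr]] := eqVneq S set0; first by rewrite sup0.
case: bf => _ [C hC]; case: (Sr) => y /= y0 ry.
apply: (@le_trans _ _ r); first by rewrite -ry divr_ge0 ?nrm_ge0.
apply: ub_le_sup => //; exists C => _ [z /= z0 <-].
by rewrite ler_pdivrMr ?nrm_gt0.
Qed.

Lemma bounded_linear0 : bounded_linear ((fun=> 0) : E -> F).
Proof.
split=> [a x y|]; first by rewrite scaler0 addr0.
by exists 0 => x; rewrite nrm0 mul0r.
Qed.

Lemma bounded_linear_add (f g : E -> F) :
  bounded_linear f -> bounded_linear g -> bounded_linear (fun x => f x + g x).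
Proof.
move=> bf bg; have -> : (fun x => f x + g x) = (fun x => 1 *: f x + g x).
  by apply/funext => x; rewrite scale1r.
exact: bounded_linear_comb.
Qed.

Lemma bounded_linear_scale c (f : E -> F) :
  bounded_linear f -> bounded_linear (fun x => c *: f x).
Proof.
move=> bf; have -> : (fun x => c *: f x) = (fun x => c *: f x + 0).
  by apply/funext => x; rewrite addr0.
by apply: bounded_linear_comb => //; exact: bounded_linear0.
Qed.

End OpNorm.

Section Multipliers.
Context (R : realType) (K : naFieldType R) (B : naBanachAlgType K).

(* a multiplier c acts by  c a = ml c a  and  a c = mr c a *)
Record mult := Mult {
  ml : B -> B;
  mr : B -> B;
  ml_bounded : bounded_linear ml;
  mr_bounded : bounded_linear mr;
  mlM : forall a b, ml (a ** b) = ml a ** b;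
  mrM : forall a b, mr (a ** b) = a ** mr b;
  mlrM : forall a b, mr a ** b = a ** ml b
}.

Lemma mult_ext (m n : mult) :
  (forall x, ml m x = ml n x) -> (forall x, mr m x = mr n x) -> m = n.
Proof.
case: m n => [l r p1 p2 p3 p4 p5] [l' r' q1 q2 q3 q4 q5] /= /funext h /funext k.
by subst l' r'; congr Mult; exact: Prop_irrelevance.
Qed.

HB.instance Definition _ := gen_eqMixin mult.
HB.instance Definition _ := gen_choiceMixin mult.

Let bmul0l (b : B) : 0 ** b = 0.
Proof. exact: (is_linear0 (proj1 (bmul_linear_r b))). Qed.
Let bmul0r (b : B) : b ** 0 = 0.
Proof. exact: (is_linear0 (proj1 (bmul_linear_l b))). Qed.
Let bmulDl (a a' b : B) : (a + a') ** b = a ** b + a' ** b.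
Proof. exact: (is_linearD (proj1 (bmul_linear_r b))). Qed.
Let bmulDr (a a' b : B) : b ** (a + a') = b ** a + b ** a'.
Proof. exact: (is_linearD (proj1 (bmul_linear_l b))). Qed.
Let bmulZl c (a b : B) : (c *: a) ** b = c *: (a ** b).
Proof. exact: (is_linearZ (proj1 (bmul_linear_r b))). Qed.
Let bmulZr c (a b : B) : b ** (c *: a) = c *: (b ** a).
Proof. exact: (is_linearZ (proj1 (bmul_linear_l b))). Qed.

Definition mult0 : mult.
refine (@Mult (fun=> 0) (fun=> 0) (bounded_linear0 _ _) (bounded_linear0 _ _) _ _ _).
- by move=> a b; rewrite bmul0l.
- by move=> a b; rewrite bmul0r.
- by move=> a b; rewrite bmul0l bmul0r.
Defined.

Definition mult_add (m n : mult) : mult.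
refine (@Mult (fun x => ml m x + ml n x) (fun x => mr m x + mr n x)
  (bounded_linear_add (ml_bounded m) (ml_bounded n))
  (bounded_linear_add (mr_bounded m) (mr_bounded n)) _ _ _).
- by move=> a b; rewrite !mlM bmulDl.
- by move=> a b; rewrite !mrM bmulDr.
- by move=> a b; rewrite bmulDl bmulDr !mlrM.
Defined.

Definition mult_scale (c : K) (m : mult) : mult.
refine (@Mult (fun x => c *: ml m x) (fun x => c *: mr m x)
  (bounded_linear_scale c (ml_bounded m))
  (bounded_linear_scale c (mr_bounded m)) _ _ _).
- by move=> a b; rewrite mlM bmulZl.
- by move=> a b; rewrite mrM bmulZr.
- by move=> a b; rewrite bmulZl bmulZr mlrM.
Defined.

Definition mult_opp (m : mult) : mult := mult_scale (-1) m.

Lemma mult_addA : associative mult_add.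
Proof. by move=> m n p; apply: mult_ext => x /=; rewrite addrA. Qed.
Lemma mult_addC : commutative mult_add.
Proof. by move=> m n; apply: mult_ext => x /=; rewrite addrC. Qed.
Lemma mult_add0 : left_id mult0 mult_add.
Proof. by move=> m; apply: mult_ext => x /=; rewrite add0r. Qed.
Lemma mult_addN : left_inverse mult0 mult_opp mult_add.
Proof. by move=> m; apply: mult_ext => x /=; rewrite scaleN1r addNr. Qed.

HB.instance Definition _ := GRing.isZmodule.Build mult
  mult_addA mult_addC mult_add0 mult_addN.

Lemma mlD (m n : mult) x : ml (m + n) x = ml m x + ml n x. Proof. by []. Qed.
Lemma mrD (m n : mult) x : mr (m + n) x = mr m x + mr n x. Proof. by []. Qed.
Lemma ml0 x : ml (0 : mult) x = 0. Proof. by []. Qed.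
Lemma mr0 x : mr (0 : mult) x = 0. Proof. by []. Qed.

Lemma mult_scaleA a b m : mult_scale a (mult_scale b m) = mult_scale (a * b) m.
Proof. by apply: mult_ext => x /=; rewrite scalerA. Qed.
Lemma mult_scale1 : left_id 1 mult_scale.
Proof. by move=> m; apply: mult_ext => x /=; rewrite scale1r. Qed.
Lemma mult_scaleDr : right_distributive mult_scale +%R.
Proof. by move=> c m n; apply: mult_ext => x /=; rewrite scalerDr. Qed.
Lemma mult_scaleDl m : {morph mult_scale^~ m : a b / a + b}.
Proof. by move=> a b; apply: mult_ext => x /=; rewrite scalerDl. Qed.

HB.instance Definition _ := GRing.Zmodule_isLmodule.Build K mult
  mult_scaleA mult_scale1 mult_scaleDr mult_scaleDl.

Lemma mlZ c (m : mult) x : ml (c *: m) x = c *: ml m x. Proof. by []. Qed.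
Lemma mrZ c (m : mult) x : mr (c *: m) x = c *: mr m x. Proof. by []. Qed.
Lemma mlN (m : mult) x : ml (- m) x = - ml m x.
Proof. by rewrite -scaleN1r mlZ scaleN1r. Qed.
Lemma mrN (m : mult) x : mr (- m) x = - mr m x.
Proof. by rewrite -scaleN1r mrZ scaleN1r. Qed.

Definition mult_norm (m : mult) : R := Num.max (opnorm (ml m)) (opnorm (mr m)).

Lemma mult_norm_ge0 m : 0 <= mult_norm m.
Proof. by rewrite le_max opnorm_ge0//; exact: ml_bounded. Qed.

Lemma ml_le m x : nrm (ml m x) <= mult_norm m * nrm x.
Proof.
apply: (le_trans (opnorm_bound _ (ml_bounded m))).
by rewrite ler_wpM2r ?nrm_ge0// le_max lexx.
Qed.

Lemma mr_le m x : nrm (mr m x) <= mult_norm m * nrm x.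
Proof.
apply: (le_trans (opnorm_bound _ (mr_bounded m))).
by rewrite ler_wpM2r ?nrm_ge0// le_max lexx orbT.
Qed.

Lemma mult_norm_le m r : 0 <= r -> (forall x, nrm (ml m x) <= r * nrm x) ->
  (forall x, nrm (mr m x) <= r * nrm x) -> mult_norm m <= r.
Proof. by move=> r0 hl hr; rewrite ge_max !opnorm_le. Qed.

Lemma mult_norm_eq0 m : mult_norm m = 0 -> m = 0.
Proof.
move=> h; apply: mult_ext => x; apply: nrm_eq0; apply/eqP; rewrite eq_le nrm_ge0 andbT.
  by rewrite (le_trans (ml_le m x))// h mul0r.
by rewrite (le_trans (mr_le m x))// h mul0r.
Qed.

Lemma mult_normZ_le a m : mult_norm (a *: m) <= absv a * mult_norm m.
Proof.
apply: mult_norm_le; first by rewrite mulr_ge0 ?absv_ge0 ?mult_norm_ge0.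
- by move=> x; rewrite mlZ nrmZ -mulrA ler_wpM2l ?absv_ge0 ?ml_le.
- by move=> x; rewrite mrZ nrmZ -mulrA ler_wpM2l ?absv_ge0 ?mr_le.
Qed.

Lemma mult_normZ a m : mult_norm (a *: m) = absv a * mult_norm m.
Proof.
apply/eqP; rewrite eq_le mult_normZ_le/=; have [->|a0] := eqVneq a 0.
  by rewrite absv0 mul0r mult_norm_ge0.
have := mult_normZ_le a^-1 (a *: m); rewrite scalerA mulVf// scale1r absvV//.
by rewrite ler_pdivlMl// absv_gt0.
Qed.

Lemma mult_normD m n : mult_norm (m + n) <= Num.max (mult_norm m) (mult_norm n).
Proof.
apply: mult_norm_le; first by rewrite le_max mult_norm_ge0.
- move=> x; rewrite mlD (le_trans (nrmD _ _))// ge_max; apply/andP; split.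
    by rewrite (le_trans (ml_le _ _))// ler_wpM2r ?nrm_ge0// le_max lexx.
  by rewrite (le_trans (ml_le _ _))// ler_wpM2r ?nrm_ge0// le_max lexx orbT.
- move=> x; rewrite mrD (le_trans (nrmD _ _))// ge_max; apply/andP; split.
    by rewrite (le_trans (mr_le _ _))// ler_wpM2r ?nrm_ge0// le_max lexx.
  by rewrite (le_trans (mr_le _ _))// ler_wpM2r ?nrm_ge0// le_max lexx orbT.
Qed.

HB.instance Definition _ := Lmodule_isNANormed.Build R K mult
  mult_norm_eq0 mult_normZ mult_normD.

Lemma nrm_ml (m : mult) x : nrm (ml m x) <= nrm m * nrm x.
Proof. exact: ml_le. Qed.
Lemma nrm_mr (m : mult) x : nrm (mr m x) <= nrm m * nrm x.
Proof. exact: mr_le. Qed.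
Lemma nrm_mult_le (m : mult) r : 0 <= r -> (forall x, nrm (ml m x) <= r * nrm x) ->
  (forall x, nrm (mr m x) <= r * nrm x) -> nrm m <= r.
Proof. exact: mult_norm_le. Qed.

Lemma op_limit (f : nat -> B -> B) : (forall n, bounded_linear (f n)) ->
  (forall e : R, 0 < e -> exists N, forall m n, (N <= m)%N -> (N <= n)%N ->
     forall x, nrm (f m x - f n x) <= e * nrm x) ->
  exists g, [/\ bounded_linear g, forall x, converges_to (f^~ x) (g x) &
    forall e : R, 0 < e -> exists N, forall n, (N <= n)%N ->
      forall x, nrm (f n x - g x) <= e * nrm x].
Proof.
move=> bf cf.
have ex x : exists l, converges_to (f^~ x) l.
  apply: na_complete => e e0.
  have x1 : 0 < nrm x + 1 by rewrite ltr_wpDl ?nrm_ge0.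
  have [N hN] := cf _ (divr_gt0 e0 x1); exists N => m n Nm Nn.
  apply: (le_lt_trans (hN _ _ Nm Nn x)).
  by rewrite mulrAC ltr_pdivrMr// ltr_pM2l// ltrDl.
have [g hg] := @boolp.choice _ _ _ ex.
have cg (e : R) : 0 < e -> exists N, forall n, (N <= n)%N ->
    forall x, nrm (f n x - g x) <= e * nrm x.
  move=> e0; have [N hN] := cf e e0; exists N => n Nn x.
  apply/ler_addgt0Pr => d d0; have [M hM] := hg x d d0.
  set m := maxn N M.
  have -> : f n x - g x = (f n x - f m x) + (f m x - g x) by rewrite addrA subrK.
  rewrite (le_trans (nrmD _ _))// ge_max; apply/andP; split.
    by rewrite (le_trans (hN _ _ Nn (leq_maxl _ _) x))// lerDl ltW.
  rewrite (le_trans (ltW (hM _ (leq_maxr _ _))))// lerDr mulr_ge0 ?nrm_ge0//.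
  exact: ltW.
exists g; split=> //; split.
  move=> a x y; apply: converges_to_uniq (hg _) _.
  have -> : f^~ (a *: x + y) = (fun n => a *: f n x + f n y).
    by apply/funext => n; rewrite (proj1 (bf n)).
  exact: converges_comb.
have [N hN] := cg 1 ltr01.
have [C [C0 hC]] := bounded_linear_pos (bf N).
exists (C + 1) => x.
have -> : g x = f N x - (f N x - g x) by rewrite opprB [RHS]addrC subrK.
rewrite (le_trans (nrmB _ _))// ge_max mulrDl; apply/andP; split.
  by rewrite (le_trans (hC _))// lerDl mul1r nrm_ge0.
by rewrite (le_trans (hN _ (leqnn _) _))// lerDr mulr_ge0 ?nrm_ge0// ltW.
Qed.

Lemma mult_complete (u : nat -> mult) : is_cauchy u -> exists l, converges_to u l.
Proof.
move=> hu.
have [e e0|gl [bgl cgl ugl]] := @op_limit (fun n => ml (u n)) (fun n => ml_bounded (u n)).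
  have [N hN] := hu e e0; exists N => m n Nm Nn x.
  have -> : ml (u m) x - ml (u n) x = ml (u m - u n) x by rewrite mlD mlN.
  by rewrite (le_trans (nrm_ml _ _))// ler_wpM2r ?nrm_ge0// ltW// hN.
have [e e0|gr [bgr cgr ugr]] := @op_limit (fun n => mr (u n)) (fun n => mr_bounded (u n)).
  have [N hN] := hu e e0; exists N => m n Nm Nn x.
  have -> : mr (u m) x - mr (u n) x = mr (u m - u n) x by rewrite mrD mrN.
  by rewrite (le_trans (nrm_mr _ _))// ler_wpM2r ?nrm_ge0// ltW// hN.
have h1 a b : gl (a ** b) = gl a ** b.
  apply: converges_to_uniq (cgl _) _.
  have -> : (fun n => ml (u n) (a ** b)) = (fun n => ml (u n) a ** b).
    by apply/funext => n; rewrite mlM.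
  exact: (bounded_linear_conv (bmul_linear_r b) (cgl a)).
have h2 a b : gr (a ** b) = a ** gr b.
  apply: converges_to_uniq (cgr _) _.
  have -> : (fun n => mr (u n) (a ** b)) = (fun n => a ** mr (u n) b).
    by apply/funext => n; rewrite mrM.
  exact: (bounded_linear_conv (bmul_linear_l a) (cgr b)).
have h3 a b : gr a ** b = a ** gl b.
  apply: converges_to_uniq (bounded_linear_conv (bmul_linear_r b) (cgr a)) _.
  have -> : (fun n => mr (u n) a ** b) = (fun n => a ** ml (u n) b).
    by apply/funext => n; rewrite mlrM.
  exact: (bounded_linear_conv (bmul_linear_l a) (cgl b)).
exists (Mult bgl bgr h1 h2 h3) => e e0.
have e2 : 0 < e / 2 by rewrite divr_gt0.
have [N hN] := ugl _ e2; have [M hM] := ugr _ e2.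
exists (maxn N M) => n; rewrite geq_max => /andP[Nn Mn].
apply: (@le_lt_trans _ _ (e / 2)); last by lra.
apply: nrm_mult_le; first exact: ltW.
- by move=> x; rewrite mlD mlN; exact: hN.
- by move=> x; rewrite mrD mrN; exact: hM.
Qed.

HB.instance Definition _ := NANormed_isComplete.Build R K mult mult_complete.

Definition mult_mul (m n : mult) : mult.
refine (@Mult (fun x => ml m (ml n x)) (fun x => mr n (mr m x))
  (bounded_linear_comp (ml_bounded m) (ml_bounded n))
  (bounded_linear_comp (mr_bounded n) (mr_bounded m)) _ _ _).
- by move=> a b; rewrite !mlM.
- by move=> a b; rewrite !mrM.
- by move=> a b; rewrite !mlrM.
Defined.

Lemma mult_mulA m n p : mult_mul m (mult_mul n p) = mult_mul (mult_mul m n) p.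
Proof. exact: mult_ext. Qed.

Lemma mult_mul_linl c m m' n :
  mult_mul (c *: m + m') n = c *: mult_mul m n + mult_mul m' n.
Proof.
by apply: mult_ext => x //=; rewrite (proj1 (mr_bounded n)).
Qed.

Lemma mult_mul_linr c m n n' :
  mult_mul m (c *: n + n') = c *: mult_mul m n + mult_mul m n'.
Proof.
by apply: mult_ext => x //=; rewrite (proj1 (ml_bounded m)).
Qed.

Lemma mult_mul_nrm m n : nrm (mult_mul m n) <= nrm m * nrm n.
Proof.
apply: nrm_mult_le; first by rewrite mulr_ge0 ?nrm_ge0.
- move=> x /=; rewrite (le_trans (nrm_ml _ _))// -mulrA.
  by rewrite ler_wpM2l ?nrm_ge0 ?nrm_ml.
- move=> x /=; rewrite (le_trans (nrm_mr _ _))// (mulrC (nrm m)) -mulrA.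
  by rewrite ler_wpM2l ?nrm_ge0 ?nrm_mr.
Qed.

HB.instance Definition _ := NABanach_isAlgebra.Build R K mult
  mult_mulA mult_mul_linl mult_mul_linr mult_mul_nrm.

Lemma mlE (m n : mult) x : ml (m ** n) x = ml m (ml n x). Proof. by []. Qed.
Lemma mrE (m n : mult) x : mr (m ** n) x = mr n (mr m x). Proof. by []. Qed.

Definition mult1 : mult.
by refine (@Mult id id (bounded_linear_id _) (bounded_linear_id _) _ _ _).
Defined.

Definition to_mult (b : B) : mult.
refine (@Mult (bmul b) (bmul^~ b) (bmul_linear_l b) (bmul_linear_r b) _ _ _).
- by move=> x y; rewrite bmulA.
- by move=> x y; rewrite bmulA.
- by move=> x y; rewrite bmulA.
Defined.

(* B is identified with its image in M(B): [lies_in_alg m] says that m belongs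
   to B, and then [of_mult m] is m regarded as an element of B; this element is
   unique if the product of B is nondegenerate *)
Definition lies_in_alg (m : mult) : Prop := exists b, to_mult b = m.
Definition of_mult (m : mult) : B := xget 0 [set b | to_mult b = m].

Lemma to_multK_ex m : lies_in_alg m -> to_mult (of_mult m) = m.
Proof. exact: (xgetPex 0). Qed.

End Multipliers.

Section MultTensor.
Context (R : realType) (K : naFieldType R) (A B : naBanachAlgType K).

(* M(A) (x) M(B) acts on A (x) B *)
Definition mtens (m : mult A) (n : mult B) : mult (ctensor A B).
refine (@Mult _ _ (ctensor A B) (ctmap (ml m) (ml n)) (ctmap (mr m) (mr n))
  (proj1 (ctmapP (ml_bounded m) (ml_bounded n)))
  (proj1 (ctmapP (mr_bounded m) (mr_bounded n))) _ _ _).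
- have [bl hl] := ctmapP (ml_bounded m) (ml_bounded n); move=> z w.
  suff h : (fun z => ctmap (ml m) (ml n) (z ** w)) =
     (fun z => ctmap (ml m) (ml n) z ** w) by exact: (congr1 (@^~ z) h).
  apply: ct_map_uniq.
  + exact: (bounded_linear_comp bl (bmul_linear_r w)).
  + exact: (bounded_linear_comp (bmul_linear_r w) bl).
  move=> a b; suff h : (fun w => ctmap (ml m) (ml n) (tens a b ** w)) =
     (fun w => ctmap (ml m) (ml n) (tens a b) ** w) by exact: (congr1 (@^~ w) h).
  apply: ct_map_uniq.
  + exact: (bounded_linear_comp bl (bmul_linear_l _)).
  + exact: bmul_linear_l.
  by move=> a' b'; rewrite tens_mul !hl tens_mul !mlM.
- have [bl hl] := ctmapP (mr_bounded m) (mr_bounded n); move=> z w.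
  suff h : (fun z => ctmap (mr m) (mr n) (z ** w)) =
     (fun z => z ** ctmap (mr m) (mr n) w) by exact: (congr1 (@^~ z) h).
  apply: ct_map_uniq.
  + exact: (bounded_linear_comp bl (bmul_linear_r w)).
  + exact: bmul_linear_r.
  move=> a b; suff h : (fun w => ctmap (mr m) (mr n) (tens a b ** w)) =
     (fun w => tens a b ** ctmap (mr m) (mr n) w) by exact: (congr1 (@^~ w) h).
  apply: ct_map_uniq.
  + exact: (bounded_linear_comp bl (bmul_linear_l _)).
  + exact: (bounded_linear_comp (bmul_linear_l _) bl).
  by move=> a' b'; rewrite tens_mul !hl tens_mul !mrM.
- have [bl hl] := ctmapP (ml_bounded m) (ml_bounded n).
  have [br hr] := ctmapP (mr_bounded m) (mr_bounded n); move=> z w.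
  suff h : (fun z => ctmap (mr m) (mr n) z ** w) =
     (fun z => z ** ctmap (ml m) (ml n) w) by exact: (congr1 (@^~ z) h).
  apply: ct_map_uniq.
  + exact: (bounded_linear_comp (bmul_linear_r w) br).
  + exact: bmul_linear_r.
  move=> a b; suff h : (fun w => ctmap (mr m) (mr n) (tens a b) ** w) =
     (fun w => tens a b ** ctmap (ml m) (ml n) w) by exact: (congr1 (@^~ w) h).
  apply: ct_map_uniq.
  + exact: bmul_linear_l.
  + exact: (bounded_linear_comp (bmul_linear_l _) bl).
  by move=> a' b'; rewrite hr hl !tens_mul !mlrM.
Defined.

End MultTensor.

Section MultTensorTheory.
Context (R : realType) (K : naFieldType R).

Lemma ctmap_bilinear (E F E' F' : naNormedType K) (f f' : E -> E') (g g' : F -> F') c :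
  bounded_linear f -> bounded_linear f' -> bounded_linear g -> bounded_linear g' ->
  ctmap (fun x => c *: f x + f' x) g = (fun z => c *: ctmap f g z + ctmap f' g z) /\
  ctmap f (fun x => c *: g x + g' x) = (fun z => c *: ctmap f g z + ctmap f g' z).
Proof.
move=> bf bf' bg bg'; have [tl tr] := tens_bilinear E' F'.
have H h k : bounded_linear h -> bounded_linear k -> bounded_linear (@ctmap R K E F E' F' h k).
  by move=> bh bk; case: (ctmapP bh bk).
have T h k x y : bounded_linear h -> bounded_linear k ->
    @ctmap R K E F E' F' h k (tens x y) = tens (h x) (k y).
  by move=> bh bk; case: (ctmapP bh bk).
split; apply: ct_map_uniq.
- by apply: H => //; exact: bounded_linear_comb.
- by apply: bounded_linear_comb; exact: H.
- by move=> x y; rewrite !T//; [exact: (tl (g y))|exact: bounded_linear_comb].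
- by apply: H => //; exact: bounded_linear_comb.
- by apply: bounded_linear_comb; exact: H.
- by move=> x y; rewrite !T//; [exact: (tr (f x))|exact: bounded_linear_comb].
Qed.

Lemma mtens_bilinear (A B : naBanachAlgType K) : is_bilinear (@mtens R K A B).
Proof.
split=> [n c m m'|m c n n']; apply: mult_ext => z /=.
- exact: (congr1 (@^~ z) (proj1 (ctmap_bilinear c (ml_bounded m) (ml_bounded m')
    (ml_bounded n) (ml_bounded n)))).
- exact: (congr1 (@^~ z) (proj1 (ctmap_bilinear c (mr_bounded m) (mr_bounded m')
    (mr_bounded n) (mr_bounded n)))).
- exact: (congr1 (@^~ z) (proj2 (ctmap_bilinear c (ml_bounded m) (ml_bounded m)
    (ml_bounded n) (ml_bounded n')))).
- exact: (congr1 (@^~ z) (proj2 (ctmap_bilinear c (mr_bounded m) (mr_bounded m)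
    (mr_bounded n) (mr_bounded n')))).
Qed.

Lemma nrm_mtens_le (A B : naBanachAlgType K) (m : mult A) (n : mult B) :
  nrm (mtens m n) <= nrm m * nrm n.
Proof.
apply: nrm_mult_le; first by rewrite mulr_ge0 ?nrm_ge0.
- move=> z; apply: ctmap_le; rewrite ?nrm_ge0//;
    by [exact: (proj1 (ml_bounded _))|move=> x; exact: nrm_ml].
- move=> z; apply: ctmap_le; rewrite ?nrm_ge0//;
    by [exact: (proj1 (mr_bounded _))|move=> x; exact: nrm_mr].
Qed.

Lemma to_mult_tens (A B : naBanachAlgType K) (a : A) (b : B) :
  mtens (to_mult a) (to_mult b) = to_mult (tens a b).
Proof.
apply: mult_ext => z /=.
- suff h : ctmap (bmul a) (bmul b) = bmul (tens a b) by exact: (congr1 (@^~ z) h).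
  have [bl hl] := ctmapP (bmul_linear_l a) (bmul_linear_l b).
  by apply: ct_map_uniq => // [|x y]; [exact: bmul_linear_l|rewrite hl tens_mul].
- suff h : ctmap (bmul^~ a) (bmul^~ b) = bmul^~ (tens a b) by exact: (congr1 (@^~ z) h).
  have [bl hl] := ctmapP (bmul_linear_r a) (bmul_linear_r b).
  by apply: ct_map_uniq => // [|x y]; [exact: bmul_linear_r|rewrite hl tens_mul].
Qed.

(* the identification of  (E (x) F) (x) G  with  E (x) (F (x) G) *)
Definition ctassoc (E F G : naNormedType K) :
    ctensor (ctensor E F) G -> ctensor E (ctensor F G) :=
  ctlift (fun z c => ctlift (fun a b => tens a (tens b c)) z).

Lemma ctassocP (E F G : naNormedType K) : bounded_linear (@ctassoc E F G) /\
  forall x y z, ctassoc (tens (tens x y) z) = tens x (tens y z) :> ctensor E (ctensor F G).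
Proof.
have [tl tr] := tens_bilinear E (ctensor F G); have [sl sr] := tens_bilinear F G.
have inner_le (c : G) (a : E) (b : F) :
    nrm (tens a (tens b c) : ctensor E (ctensor F G)) <= nrm c * (nrm a * nrm b).
  rewrite (le_trans (nrm_tens_le _ _))// mulrCA ler_wpM2l ?nrm_ge0// mulrC.
  exact: nrm_tens_le.
have inner_bil (c : G) : is_bilinear (fun (a : E) (b : F) => tens a (tens b c)).
  split=> [b k a a'|a k b b']; first exact: (tl (tens b c)).
  by rewrite (sl c); exact: (tr a).
have inner (c : G) : bounded_bilinear (fun (a : E) (b : F) => tens a (tens b c)).
  by split; [exact: inner_bil|exists (nrm c)].
have outer : bounded_bilinear (fun (z : ctensor E F) (c : G) =>
    ctlift (fun a b => tens a (tens b c)) z).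
  split; first split=> [c|z k c c'].
  - exact: (proj1 (proj1 (ctliftP (inner c)))).
  - suff h : ctlift (fun (a : E) (b : F) => tens a (tens b (k *: c + c'))) =
      (fun z => k *: ctlift (fun (a : E) (b : F) => tens a (tens b c)) z +
         ctlift (fun (a : E) (b : F) => tens a (tens b c')) z) by exact: (congr1 (@^~ z) h).
    have [b1 h1] := ctliftP (inner c); have [b2 h2] := ctliftP (inner c').
    apply: ctlift_uniq; first exact: bounded_linear_comb.
    by move=> x y; rewrite h1 h2 (sr y) (tr x).
  - exists 1 => z c; rewrite mul1r mulrC.
    by apply: ctlift_le => //; exact: nrm_ge0.
have [b1 h1] := ctliftP outer; split=> // x y z.
by rewrite /ctassoc h1 (proj2 (ctliftP (inner z))).
Qed.

End MultTensorTheory.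

Section Conditions.
Context (R : realType) (K : naFieldType R).

Definition is_polar (E : naNormedType K) := forall y : E, 1 < nrm y ->
  exists f : E -> K^o, [/\ bounded_linear f,
    forall x : E, nrm x <= 1 -> absv (f x : K) <= 1 :> R & 1 < absv (f y : K) :> R].

Definition nondegenerate_product (A : naBanachAlgType K) :=
  (forall a : A, (forall b : A, a ** b = 0) -> a = 0) /\
  (forall b : A, (forall a : A, a ** b = 0) -> b = 0).

Definition unit_normalized (A : naBanachAlgType K) :=
  forall e : A, (forall a : A, e ** a = a /\ a ** e = a) -> nrm e = 1.

Definition directed (I : Type) (le : I -> I -> Prop) :=
  [/\ inhabited I, forall i, le i i, forall i j k, le i j -> le j k -> le i k &
    forall i j, exists k, le i k /\ le j k].

Definition has_bounded_approximate_identity (A : naBanachAlgType K) :=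
  exists (I : Type) (le : I -> I -> Prop) (e : I -> A),
    [/\ directed le,
        exists C : R, forall i, nrm (e i) <= C &
        forall (x : A) (d : R), 0 < d -> exists i0, forall i, le i0 i ->
          nrm (e i ** x - x) < d /\ nrm (x ** e i - x) < d].

Definition cont_hom (A B : naBanachAlgType K) (Phi : A -> B) :=
  bounded_linear Phi /\ forall a b : A, Phi (a ** b) = Phi a ** Phi b.

Definition dense_span (E : naNormedType K) (S : set E) :=
  forall (y : E) (d : R), 0 < d -> exists s : seq (K * E),
    (forall p, p \in s -> S p.2) /\ nrm (y - \sum_(p <- s) p.1 *: p.2) < d.

Definition nondegenerate_hom (A B : naBanachAlgType K) (Phi : A -> mult B) :=
  dense_span [set ml (Phi p.1) p.2 | p in [set: A * B]] /\
  dense_span [set mr (Phi p.1) p.2 | p in [set: A * B]].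

(* Ext is an extension of Phi : A -> M(B) to a continuous homomorphism
   M(A) -> M(B); by [extends_hom_uniq] it is unique if Phi is nondegenerate *)
Definition extends_hom (A B : naBanachAlgType K) (Phi : A -> mult B)
    (Ext : mult A -> mult B) :=
  cont_hom Ext /\ forall a, Ext (to_mult a) = Phi a.

Lemma dense_span_eq (E F : naNormedType K) (S : set E) (f g : E -> F) :
  dense_span S -> bounded_linear f -> bounded_linear g ->
  (forall x, S x -> f x = g x) -> f =1 g.
Proof.
move=> dS bf bg fg z; apply/eqP; rewrite -subr_eq0; apply/eqP.
have [C [C0 hC]] := bounded_linear_pos bf.
have [D [D0 hD]] := bounded_linear_pos bg.
case: bf bg => lf _ [lg _]; apply: nrm_small => e e0.
have CD0 : 0 < C + D by rewrite addr_gt0.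
have [s [sS hs]] := dS z _ (divr_gt0 e0 CD0).
set y := \sum_(p <- s) _ in hs.
have fgs : f y = g y.
  rewrite /y !is_linear_sum//; apply: eq_big_seq => p /sS ps.
  by rewrite (is_linearZ lf) (is_linearZ lg) fg.
have -> : f z - g z = f (z - y) - g (z - y).
  by rewrite (is_linearB lf) (is_linearB lg) fgs opprB addrA subrK.
have h : (C + D) * nrm (z - y) < e by rewrite mulrC -ltr_pdivlMr.
rewrite (le_lt_trans (nrmB _ _))// gt_max; apply/andP; split; apply: le_lt_trans h.
  by rewrite (le_trans (hC _))// ler_wpM2r ?nrm_ge0// lerDl ltW.
by rewrite (le_trans (hD _))// ler_wpM2r ?nrm_ge0// lerDr ltW.
Qed.

Lemma extends_hom_uniq (A B : naBanachAlgType K) (Phi : A -> mult B) Ext Ext' :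
  nondegenerate_hom Phi -> extends_hom Phi Ext -> extends_hom Phi Ext' -> Ext = Ext'.
Proof.
move=> [dl dr] [[_ hM] hE] [[_ hM'] hE']; apply/funext => m; apply: mult_ext.
- apply: (dense_span_eq dl (ml_bounded _) (ml_bounded _)) => _ [[a b] _ <-] /=.
  have h : m ** to_mult a = to_mult (ml m a).
    by apply: mult_ext => x /=; rewrite ?mlM ?mlrM.
  by rewrite -{1}hE -{1}hE' -!mlE -hM -hM' h hE hE'.
- apply: (dense_span_eq dr (mr_bounded _) (mr_bounded _)) => _ [[a b] _ <-] /=.
  have h : to_mult a ** m = to_mult (mr m a).
    by apply: mult_ext => x /=; rewrite ?mrM ?mlrM.
  by rewrite -{1}hE -{1}hE' -!mrE -hM -hM' h hE hE'.
Qed.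

End Conditions.

Section Hopf.
Context (R : realType) (K : naFieldType R).

Section Functionals.
Context (E F : naNormedType K).

(* omega (x) id *)
Definition slicel (omega : E -> K^o) : ctensor E F -> F :=
  ctlift (fun x y => (omega x : K) *: y).
(* id (x) omega *)
Definition slicer (omega : F -> K^o) : ctensor E F -> E :=
  ctlift (fun x y => (omega y : K) *: x).
(* omega_1 (x) omega_2 *)
Definition functens (omega1 : E -> K^o) (omega2 : F -> K^o) : ctensor E F -> K^o :=
  ctlift (fun x y => (omega1 x * omega2 y : K) : K^o).

End Functionals.

Section Comultiplication.
Context (A : naBanachAlgType K) (Delta : A -> mult (ctensor A A)).

Let one : mult A := mult1 A.

Definition mT1 (a b : A) : mult (ctensor A A) := Delta a ** mtens one (to_mult b).
Definition mT2 (a b : A) : mult (ctensor A A) := mtens (to_mult a) one ** Delta b.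
Definition mT3 (a b : A) : mult (ctensor A A) := mtens one (to_mult b) ** Delta a.
Definition mT4 (a b : A) : mult (ctensor A A) := Delta b ** mtens (to_mult a) one.

Definition T1 (a b : A) : ctensor A A := of_mult (mT1 a b).
Definition T2 (a b : A) : ctensor A A := of_mult (mT2 a b).
Definition T3 (a b : A) : ctensor A A := of_mult (mT3 a b).
Definition T4 (a b : A) : ctensor A A := of_mult (mT4 a b).

Definition Delta_id : ctensor A A -> mult (ctensor (ctensor A A) A) :=
  ctlift (fun a b => mtens (Delta a) (to_mult b)).
Definition id_Delta : ctensor A A -> mult (ctensor A (ctensor A A)) :=
  ctlift (fun a b => mtens (to_mult a) (Delta b)).

(* multipliers of the two triple tensor products are compared along [ctassoc] *)
Definition coassociative :=
  exists (Ext1 : mult (ctensor A A) -> mult (ctensor (ctensor A A) A))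
         (Ext2 : mult (ctensor A A) -> mult (ctensor A (ctensor A A))),
    [/\ extends_hom Delta_id Ext1, extends_hom id_Delta Ext2 &
      forall (a : A) (z : ctensor (ctensor A A) A),
        ctassoc (ml (Ext1 (Delta a)) z) = ml (Ext2 (Delta a)) (ctassoc z) /\
        ctassoc (mr (Ext1 (Delta a)) z) = mr (Ext2 (Delta a)) (ctassoc z)].

Record comultiplication : Prop := Comultiplication {
  comult_hom : cont_hom Delta;
  comult_nondegenerate : nondegenerate_hom Delta;
  comult_T_in_alg : forall a b : A,
    [/\ lies_in_alg (mT1 a b), lies_in_alg (mT2 a b), lies_in_alg (mT3 a b) & lies_in_alg (mT4 a b)];
  comult_coassociative : coassociative
}.

Definition extends_to_bij_isometry (T : A -> A -> ctensor A A) :=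
  exists h : ctensor A A -> ctensor A A,
    [/\ is_linear h, isometric h, bijective h & forall a b : A, h (tens a b) = T a b].

Record multiplier_banach_hopf : Prop := MultiplierBanachHopf {
  mbh_polar : is_polar A;
  mbh_unit : unit_normalized A;
  mbh_nondegenerate : nondegenerate_product A;
  mbh_approx : has_bounded_approximate_identity A;
  mbh_comult : comultiplication;
  mbh_T1 : extends_to_bij_isometry T1;
  mbh_T2 : extends_to_bij_isometry T2;
  mbh_T3 : extends_to_bij_isometry T3;
  mbh_T4 : extends_to_bij_isometry T4
}.

(* m (a (x) b) = ab *)
Definition mulmap : ctensor A A -> A := ctlift (fun a b => a ** b).

(* epsilon(a) b = m (T1^-1 (a (x) b)) *)
Definition is_counit (epsilon : A -> K) :=
  forall (a b : A) (z : ctensor A A), ctlift T1 z = tens a b ->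
    epsilon a *: b = mulmap z.

Definition left_invariant (omega : A -> K^o) :=
  [/\ bounded_linear omega, exists a, omega a <> 0 &
    forall a b : A, slicer omega (T4 b a) = (omega a : K) *: b /\
                    slicer omega (T2 b a) = (omega a : K) *: b].

Definition right_invariant (omega : A -> K^o) :=
  [/\ bounded_linear omega, exists a, omega a <> 0 &
    forall a b : A, slicel omega (T1 a b) = (omega a : K) *: b /\
                    slicel omega (T3 a b) = (omega a : K) *: b].

End Comultiplication.

Definition norm_reproducing (A : naBanachAlgType K) (omega : A -> K^o) :=
  forall a : A,
    nrm a = sup [set nrm (omega (x ** a)) / nrm x | x in [set x : A | x != 0]].

Section Dual.
Context (A : naBanachAlgType K) (Delta : A -> mult (ctensor A A)) (phi : A -> K^o).
Context (B : naBanachAlgType K) (DeltaB : B -> mult (ctensor B B)) (ev : B -> A -> K^o).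

(* elements of B (x) B as functionals on A (x) A, when the elements of B are
   regarded as functionals on A through ev *)
Definition ev2 (u : ctensor B B) (z : ctensor A A) : K^o :=
  ctlift (fun w1 w2 => functens (ev w1) (ev w2) z) u.

(* (B, DeltaB) together with ev, which identifies B with the set of functionals
   phi ( . a), is a realization of the dual object of (A, Delta). [dual_comult1]
   and [dual_comult2] are the formulas for DeltaB(w1)(1 (x) w2) and for
   (w1 (x) 1)DeltaB(w2) as functionals; on the right-hand sides, T2 Delta x y is
   (x (x) 1)Delta(y) and T1 Delta x y is Delta(x)(1 (x) y). *)
Record dual_object : Prop := DualObject {
  dual_lin : forall (c : K) (w w' : B) (x : A),
    ev (c *: w + w') x = c *: ev w x + ev w' x;
  dual_inj : injective ev;
  dual_range : range ev = [set (fun x => phi (x ** a)) | a in [set: A]];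
  dual_norm : forall (w : B) (a : A), ev w = (fun x => phi (x ** a)) -> nrm w = nrm a;
  dual_mul : forall (w1 w2 : B) (a1 a2 : A),
    ev w1 = (fun x => phi (x ** a1)) -> ev w2 = (fun x => phi (x ** a2)) ->
    forall x : A, ev (w1 ** w2) x = functens phi phi (ml (Delta x) (tens a1 a2));
  dual_comult1 : forall w1 w2 : B, lies_in_alg (mT1 DeltaB w1 w2) /\
    forall x y : A, ev2 (T1 DeltaB w1 w2) (tens x y) =
                    functens (ev w1) (ev w2) (T2 Delta x y);
  dual_comult2 : forall w1 w2 : B, lies_in_alg (mT2 DeltaB w1 w2) /\
    forall x y : A, ev2 (T2 DeltaB w1 w2) (tens x y) =
                    functens (ev w1) (ev w2) (T1 Delta x y)
}.

(* the functional  omega |-> epsilon(a)  for  omega = psi (a . ) *)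
Definition is_dual_functional (psi : A -> K^o) (epsilon : A -> K) (phiB : B -> K^o) :=
  forall (w : B) (a : A), ev w = (fun x => psi (a ** x)) -> phiB w = epsilon a.

End Dual.

End Hopf.

(* Main.v *)
Require Import Defs.
From HB Require Import structures.
From mathcomp Require Import all_boot all_order all_algebra.
From mathcomp Require Import boolp classical_sets reals.
From mathcomp Require Import lra.

Set Implicit Arguments.
Unset Strict Implicit.
Unset Printing Implicit Defensive.

Import Order.TTheory GRing.Theory Num.Theory.

Local Open Scope ring_scope.

(** Write P for the inverse of the antipode of A. The bidual consists of the
functionals  w |-> c phih(w w0)  on the dual of A, so everything rests on one
formula: for w0 = phi(P(x) . ) and every w in the dual,
<<
   phih(w w0) = k w(x)       with a nonzero scalar k.
>>
Indeed, write w = psi(a . ) and w0 = phi(q . ). If a (x) q is the (possibly infinite)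
sum of the (1 (x) q_i)Delta(p_i), then right invariance of psi gives w w0 = psi(d . )
with d the sum of the phi(q_i) p_i ([convolution]), so that phih(w w0) = epsilon(d).
The sum of the epsilon(p_i) q_i being q P(a), this number is phi(q P(a))
([counit_convolution]). For q = P(x) it equals phi(P(a x)), and phi o P = k psi
because phi o P is right-invariant and right-invariant functionals are unique up to
scalars ([phi_antipodeV]). The result is k psi(a x) = k w(x)
([phih_mul]).

To use the formula for all x, and to reach all of the bidual, the four families of
functionals phi( . a), phi(a . ), psi( . a), psi(a . ) have to coincide, with
comparable norms. This is obtained from bounded linear maps h with, for instance,
phi(q . ) = phi( . h(q)) ([psil_phil], [phil_psil], [phir_psil], [psil_phir]); their
construction evaluates  (psi (x) phi)((a (x) 1)Delta(x)(1 (x) b))  in two ways, which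
needs the antipode.

The antipode is found inside the isometries T1, ..., T4. Coassociativity makes T2 and
T4, acting in the first two legs of the tensor cube, commute with T1 and T3, acting in
the last two ([coassociativity]). It follows that the operator
T4^-1 T1 flip T3^-1  acts on the first leg only; that action is P
([t1_antipodeV]).

Multiplicativity of Gamma is the duality between the product of the dual of A and
Delta, tested along an approximate identity of the dual ([GammaM]). For the
coproducts, both sides have the same values on products of functionals, and a tensor
z in the completed tensor square of A is determined by the numbers (w1 (x) w2)(z)
([ev_tensor_inj]). The last point is specific to the non-Archimedean setting: finite
tensors have representations with an almost orthogonal system in the first leg
([exists_orthogonal]), so that slices bound the norm ([slicer_inj]). *)

(** * Maps of completed tensor products *)

Section TensorMaps.
Context (R : realType) (K : naFieldType R).

Lemma ct_ext (E F G : naNormedType K) (f g : ctensor E F -> G) :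
  bounded_linear f -> bounded_linear g ->
  (forall x y, f (tens x y) = g (tens x y)) -> forall z, f z = g z.
Proof. by move=> bf bg h z; rewrite (ct_map_uniq bf bg h). Qed.

Lemma tens_bll (E F : naNormedType K) (y : F) :
  bounded_linear (fun x : E => tens x y).
Proof.
split; first exact: (proj1 (tens_bilinear E F) y).
by exists (nrm y) => x; rewrite mulrC nrm_tens_le.
Qed.

Lemma tens_blr (E F : naNormedType K) (x : E) : bounded_linear (@tens R K E F x).
Proof.
split; first exact: (proj2 (tens_bilinear E F) x).
by exists (nrm x) => y; rewrite nrm_tens_le.
Qed.

Lemma ctmap_bl (E F E' F' : naNormedType K) (f : E -> E') (g : F -> F') :
  bounded_linear f -> bounded_linear g -> bounded_linear (ctmap f g).
Proof. by move=> bf bg; exact: (proj1 (ctmapP bf bg)). Qed.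

Lemma ctmapE (E F E' F' : naNormedType K) (f : E -> E') (g : F -> F') x y :
  bounded_linear f -> bounded_linear g ->
  ctmap f g (tens x y) = tens (f x) (g y).
Proof. by move=> bf bg; exact: (proj2 (ctmapP bf bg)). Qed.

Section Slices.
Context (E F : naBanachType K).

Lemma slicel_bilinear (om : E -> K^o) : bounded_linear om ->
  bounded_bilinear (fun (x : E) (y : F) => (om x : K) *: y).
Proof.
move=> [lo [C hC]]; split; first split=> [y a x x'|x a y y'].
- by rewrite lo scalerDl scalerA.
- by rewrite scalerDr !scalerA mulrC.
exists C => x y; rewrite nrmZ mulrA ler_wpM2r ?nrm_ge0//; exact: hC.
Qed.

Lemma slicer_bilinear (om : F -> K^o) : bounded_linear om ->
  bounded_bilinear (fun (x : E) (y : F) => (om y : K) *: x).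
Proof.
move=> [lo [C hC]]; split; first split=> [y a x x'|x a y y'].
- by rewrite scalerDr !scalerA mulrC.
- by rewrite lo scalerDl scalerA.
exists C => x y; rewrite nrmZ (mulrC (nrm x)) mulrA ler_wpM2r ?nrm_ge0//; exact: hC.
Qed.

Lemma slicel_bl (om : E -> K^o) : bounded_linear om ->
  bounded_linear (@slicel R K E F om).
Proof. by move=> bo; exact: (proj1 (ctliftP (slicel_bilinear bo))). Qed.

Lemma slicer_bl (om : F -> K^o) : bounded_linear om ->
  bounded_linear (@slicer R K E F om).
Proof. by move=> bo; exact: (proj1 (ctliftP (slicer_bilinear bo))). Qed.

Lemma slicelE (om : E -> K^o) (x : E) (y : F) : bounded_linear om ->
  slicel om (tens x y) = (om x : K) *: y.
Proof. by move=> bo; exact: (proj2 (ctliftP (slicel_bilinear bo))). Qed.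

Lemma slicerE (om : F -> K^o) (x : E) (y : F) : bounded_linear om ->
  slicer om (tens x y) = (om y : K) *: x.
Proof. by move=> bo; exact: (proj2 (ctliftP (slicer_bilinear bo))). Qed.

Lemma slicer_le (om : F -> K^o) C (z : ctensor E F) : bounded_linear om -> 0 <= C ->
  (forall y, nrm (om y) <= C * nrm y) -> nrm (slicer om z) <= C * nrm z.
Proof.
move=> bo C0 hC; apply: ctlift_le => //; first exact: (proj1 (slicer_bilinear bo)).
move=> x y; rewrite nrmZ (mulrC (nrm x)) mulrA ler_wpM2r ?nrm_ge0//; exact: hC.
Qed.

(** The value at a tensor of a product functional is obtained by two
successive slices, in either order. As the slices take values in Banach spaces, they
exist over an arbitrary ground field; this is how the existence of the product
functional is obtained. *)
Lemma functensl (om1 : E -> K^o) (om2 : F -> K^o) (z : ctensor E F) :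
  bounded_linear om1 -> bounded_linear om2 ->
  functens om1 om2 z = om2 (slicel om1 z).
Proof.
move=> b1 b2; suff -> : functens om1 om2 = (fun z => om2 (slicel om1 z)) by [].
apply: ctlift_uniq; first exact: (bounded_linear_comp b2 (slicel_bl b1)).
by move=> x y; rewrite slicelE// (is_linearZ (proj1 b2)).
Qed.

Lemma functensr (om1 : E -> K^o) (om2 : F -> K^o) (z : ctensor E F) :
  bounded_linear om1 -> bounded_linear om2 ->
  functens om1 om2 z = om1 (slicer om2 z).
Proof.
move=> b1 b2; suff -> : functens om1 om2 = (fun z => om1 (slicer om2 z)) by [].
apply: ctlift_uniq; first exact: (bounded_linear_comp b1 (slicer_bl b2)).
by move=> x y; rewrite slicerE// (is_linearZ (proj1 b1)) [RHS]mulrC.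
Qed.

Lemma slice_fubini (om1 : E -> K^o) (om2 : F -> K^o) (z : ctensor E F) :
  bounded_linear om1 -> bounded_linear om2 ->
  om2 (slicel om1 z) = om1 (slicer om2 z).
Proof. by move=> b1 b2; rewrite -functensl// functensr. Qed.

Lemma functens_bl (om1 : E -> K^o) (om2 : F -> K^o) :
  bounded_linear om1 -> bounded_linear om2 -> bounded_linear (functens om1 om2).
Proof.
move=> b1 b2; suff -> : functens om1 om2 = (fun z => om2 (slicel om1 z)).
  exact: (bounded_linear_comp b2 (slicel_bl b1)).
by apply/funext => z; exact: functensl.
Qed.

Lemma functens_tens (om1 : E -> K^o) (om2 : F -> K^o) x y :
  bounded_linear om1 -> bounded_linear om2 ->
  functens om1 om2 (tens x y) = om1 x * om2 y.
Proof.
by move=> b1 b2; rewrite functensl// slicelE// (is_linearZ (proj1 b2)).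
Qed.

End Slices.

Definition ctswap (E F : naNormedType K) : ctensor E F -> ctensor F E :=
  ctlift (fun x y => tens y x).

Lemma ctswapP (E F : naNormedType K) : bounded_linear (@ctswap E F) /\
  forall x y, ctswap (tens x y) = tens y x :> ctensor F E.
Proof.
apply: ctliftP; split.
  by split=> [y|x]; [exact: (proj2 (tens_bilinear F E) y)|exact: (proj1 (tens_bilinear F E) x)].
by exists 1 => x y; rewrite mul1r mulrC nrm_tens_le.
Qed.

Definition ctassocV (E F G : naNormedType K) :
    ctensor E (ctensor F G) -> ctensor (ctensor E F) G :=
  ctlift (fun a t => ctmap (tens a) id t).

Lemma ctassocVP (E F G : naNormedType K) : bounded_linear (@ctassocV E F G) /\
  forall x y z, ctassocV (tens x (tens y z)) = tens (tens x y) z :> ctensor (ctensor E F) G.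
Proof.
have bt a := tens_blr F (a : E); have bi := @bounded_linear_id R K G.
have bb : bounded_bilinear (fun (a : E) (t : ctensor F G) => ctmap (tens a) id t).
  split; first split=> [t|a].
  - move=> k a a'; move: t.
    apply: ct_ext; [exact: ctmap_bl|by apply: bounded_linear_comb; exact: ctmap_bl|].
    move=> y z; rewrite !ctmapE// (proj1 (tens_bilinear E F)).
    exact: (proj1 (tens_bilinear (ctensor E F) G)).
  - exact: (proj1 (ctmap_bl (bt a) bi)).
  exists 1 => a t; rewrite mul1r -[nrm a]mulr1; apply: ctmap_le; rewrite ?nrm_ge0//.
  - exact: (proj1 (bt a)).
  - by move=> y; exact: nrm_tens_le.
  - by move=> y; rewrite mul1r.
have [b1 h1] := ctliftP bb; split=> // x y z; rewrite /ctassocV h1 ctmapE//.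
Qed.

End TensorMaps.

Lemma to_mult_bl (R : realType) (K : naFieldType R) (B : naBanachAlgType K) :
  bounded_linear (@to_mult R K B).
Proof.
split=> [c x y|]; first by apply: mult_ext => z /=; rewrite ?bmul_linl ?bmul_linr.
exists 1 => x; rewrite mul1r; apply: nrm_mult_le; rewrite ?nrm_ge0//.
  by move=> y; exact: nrm_bmul.
by move=> y; rewrite mulrC; exact: nrm_bmul.
Qed.

Section BoundedCombinators.
Context (R : realType) (K : naFieldType R) (G : naNormedType K).

Lemma bmull_bl (D : naBanachAlgType K) (f : G -> D) y :
  bounded_linear f -> bounded_linear (fun x => f x ** y).
Proof. exact: (bounded_linear_comp (bmul_linear_r y)). Qed.

Lemma bmulr_bl (D : naBanachAlgType K) (f : G -> D) y :
  bounded_linear f -> bounded_linear (fun x => y ** f x).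
Proof. exact: (bounded_linear_comp (bmul_linear_l y)). Qed.

Lemma tensl_bl (E F : naNormedType K) (f : G -> E) (y : F) :
  bounded_linear f -> bounded_linear (fun x => tens (f x) y).
Proof. exact: (bounded_linear_comp (tens_bll E y)). Qed.

Lemma tensr_bl (E F : naNormedType K) (f : G -> F) (y : E) :
  bounded_linear f -> bounded_linear (fun x => tens y (f x)).
Proof. exact: (bounded_linear_comp (tens_blr F y)). Qed.

End BoundedCombinators.

Create HintDb bl discriminated.
#[export] Hint Constants Opaque : bl.
#[export] Hint Variables Opaque : bl.

(* decides that a composite of the basic maps is bounded linear; the head symbols
   are matched syntactically, since unification would unfold the completions *)
Ltac bl :=
  match goal with
  | h : bounded_linear ?f |- bounded_linear ?f => exact h
  | |- bounded_linear (fun x => x) => exact (bounded_linear_id _)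
  | |- bounded_linear id => exact (bounded_linear_id _)
  | |- bounded_linear (ml ?m) => exact (ml_bounded m)
  | |- bounded_linear (mr ?m) => exact (mr_bounded m)
  | |- bounded_linear (bmul ?a) => exact (bmul_linear_l a)
  | |- bounded_linear (@to_mult _ _ _) => exact (to_mult_bl _)
  | |- bounded_linear (@ctswap _ _ _ _) => exact (proj1 (ctswapP _ _))
  | |- bounded_linear (@ctassoc _ _ _ _ _) => exact (proj1 (ctassocP _ _ _))
  | |- bounded_linear (@ctassocV _ _ _ _ _) => exact (proj1 (ctassocVP _ _ _))
  | |- bounded_linear (tens ?a) => exact (tens_blr _ a)
  | |- bounded_linear (ctmap _ _) => refine (ctmap_bl _ _); bl
  | |- bounded_linear (slicel _) => apply: slicel_bl; bl
  | |- bounded_linear (slicer _) => apply: slicer_bl; bl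
  | |- bounded_linear (functens _ _) => apply: functens_bl; bl
  | |- bounded_linear (fun x => tens (@?h x) ?y) => refine (tensl_bl y _); bl
  | |- bounded_linear (fun x => tens ?y (@?h x)) => refine (tensr_bl y _); bl
  | |- bounded_linear (fun x => bmul (@?h x) ?y) => refine (bmull_bl y _); bl
  | |- bounded_linear (fun x => bmul ?y (@?h x)) => refine (bmulr_bl y _); bl
  | |- bounded_linear (fun x => 0) => exact (bounded_linear0 _ _)
  | |- bounded_linear (fun x => ?k *: (@?h x)) => refine (bounded_linear_scale k _); bl
  | |- bounded_linear (fun x => ?g x) => change (bounded_linear g); bl
  | |- bounded_linear (fun x => ?g (@?f x)) =>
      refine (@bounded_linear_comp _ _ _ _ _ g f _ _); bl
  | |- _ => solve [auto 2 with bl nocore]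
  end.

(* proves an identity between bounded linear expressions in z on pure tensors *)
Ltac tens_ind z :=
  match goal with |- ?l = ?r =>
    let f := (eval pattern z in l) in let g := (eval pattern z in r) in
    match f with ?f' z => match g with ?g' z =>
      apply: (@ct_ext _ _ _ _ _ f' g' _ _ _ z); [try bl|try bl|]
    end end end.

Section SliceMaps.
Context (R : realType) (K : naFieldType R) (E F E' F' : naBanachType K).
Context (f : E -> E') (g : F -> F').
Hypotheses (bf : bounded_linear f) (bg : bounded_linear g).

Lemma slicel_ctmap (om : E' -> K^o) (z : ctensor E F) : bounded_linear om ->
  slicel om (ctmap f g z) = g (slicel (fun x => om (f x)) z).
Proof.
move=> bo; have bof : bounded_linear (fun x => om (f x)) by bl.
tens_ind z.
by move=> x y; rewrite ctmapE// !slicelE// (is_linearZ (proj1 bg)).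
Qed.

Lemma slicer_ctmap (om : F' -> K^o) (z : ctensor E F) : bounded_linear om ->
  slicer om (ctmap f g z) = f (slicer (fun y => om (g y)) z).
Proof.
move=> bo; have bof : bounded_linear (fun x => om (g x)) by bl.
tens_ind z.
by move=> x y; rewrite ctmapE// !slicerE// (is_linearZ (proj1 bf)).
Qed.

End SliceMaps.

Lemma slicel_idl (R : realType) (K : naFieldType R) (E F F' : naBanachType K)
  (g : F -> F') (om : E -> K^o) (z : ctensor E F) : bounded_linear g ->
  bounded_linear om -> slicel om (ctmap id g z) = g (slicel om z).
Proof. by move=> bg bo; rewrite (slicel_ctmap (@bounded_linear_id _ _ E) bg). Qed.

Lemma slicer_idr (R : realType) (K : naFieldType R) (E E' F : naBanachType K)
  (f : E -> E') (om : F -> K^o) (z : ctensor E F) : bounded_linear f ->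
  bounded_linear om -> slicer om (ctmap f id z) = f (slicer om z).
Proof. by move=> bf bo; rewrite (slicer_ctmap bf (@bounded_linear_id _ _ F)). Qed.

Lemma ctswapK (R : realType) (K : naFieldType R) (E F : naNormedType K)
  (z : ctensor E F) : ctswap (ctswap z) = z.
Proof. by tens_ind z => x y; rewrite !(proj2 (ctswapP _ _)). Qed.

Lemma ctmap_comp (R : realType) (K : naFieldType R) (E F E1 F1 E2 F2 : naNormedType K)
  (f : E -> E1) (f' : E1 -> E2) (g : F -> F1) (g' : F1 -> F2) z :
  bounded_linear f -> bounded_linear f' -> bounded_linear g -> bounded_linear g' ->
  ctmap f' g' (ctmap f g z) = ctmap (fun x => f' (f x)) (fun y => g' (g y)) z.
Proof.
move=> b1 b2 b3 b4; have b12 : bounded_linear (fun x => f' (f x)) by bl.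
have b34 : bounded_linear (fun x => g' (g x)) by bl.
by tens_ind z => x y; rewrite !ctmapE.
Qed.

Lemma ctmap_id (R : realType) (K : naFieldType R) (E F : naNormedType K)
  (z : ctensor E F) : ctmap id id z = z.
Proof. by tens_ind z => x y; rewrite ctmapE//; bl. Qed.

Lemma ctassocK (R : realType) (K : naFieldType R) (E F G : naNormedType K)
  (z : ctensor (ctensor E F) G) : ctassocV (ctassoc z) = z.
Proof.
tens_ind z => t c; tens_ind t => a b.
by rewrite (proj2 (ctassocP _ _ _)) (proj2 (ctassocVP _ _ _)).
Qed.

Lemma ctassocVK (R : realType) (K : naFieldType R) (E F G : naNormedType K)
  (z : ctensor E (ctensor F G)) : ctassoc (ctassocV z) = z.
Proof.
tens_ind z => a t; tens_ind t => b c.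
by rewrite (proj2 (ctassocVP _ _ _)) (proj2 (ctassocP _ _ _)).
Qed.

(** The product b a of the entries of a (x) b is what the counit makes of
T3(a (x) b) and of T4(a (x) b). *)
Definition mulop (R : realType) (K : naFieldType R) (A : naBanachAlgType K) :
  ctensor A A -> A := fun z => mulmap (ctswap z).

Section ProductMaps.
Context (R : realType) (K : naFieldType R) (A : naBanachAlgType K).

Lemma mulmapP : bounded_linear (@mulmap R K A) /\
  forall x y : A, mulmap (tens x y) = x ** y.
Proof.
apply: ctliftP; split; last by exists 1 => x y; rewrite mul1r nrm_bmul.
by split=> y; [exact: (proj1 (bmul_linear_r y))|exact: (proj1 (bmul_linear_l y))].
Qed.

Lemma mulopP : bounded_linear (@mulop R K A) /\
  forall x y : A, mulop (tens x y) = y ** x.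
Proof.
have [bm mE] := mulmapP; split; first by rewrite /mulop; bl.
by move=> x y; rewrite /mulop (proj2 (ctswapP _ _)) mE.
Qed.

Lemma mul_tens (A' : naBanachAlgType K) (z : ctensor A A') r s :
  z ** tens r s = ctmap id (bmul^~ s) (ctmap (bmul^~ r) id z).
Proof. by tens_ind z => x y; rewrite tens_mul !ctmapE//; bl. Qed.

Lemma tens_mull (A' : naBanachAlgType K) (z : ctensor A A') r s :
  tens r s ** z = ctmap (bmul r) id (ctmap id (bmul s) z).
Proof. by tens_ind z => x y; rewrite tens_mul !ctmapE//; bl. Qed.

End ProductMaps.

Lemma ctassocM (R : realType) (K : naFieldType R) (A B C : naBanachAlgType K)
  (z w : ctensor (ctensor A B) C) : ctassoc (z ** w) = ctassoc z ** ctassoc w.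
Proof.
tens_ind z => t c; tens_ind t => a b.
tens_ind w => t' c'; tens_ind t' => a' b'.
by rewrite !tens_mul !(proj2 (ctassocP _ _ _)) !tens_mul.
Qed.

(** * Approximate identities *)

Section ApproximateIdentity.
Context (R : realType) (K : naFieldType R).

Lemma bai_left_dense (A : naBanachAlgType K) : has_bounded_approximate_identity A ->
  forall (x : A) (d : R), 0 < d -> exists e, nrm (e ** x - x) < d.
Proof.
move=> [I [le [e [[_ ler _ _] _ he]]]] x d d0.
by have [i /(_ i (ler i)) [h _]] := he x d d0; exists (e i).
Qed.

Lemma bai_right_dense (A : naBanachAlgType K) : has_bounded_approximate_identity A ->
  forall (x : A) (d : R), 0 < d -> exists e, nrm (x ** e - x) < d.
Proof.
move=> [I [le [e [[_ ler _ _] _ he]]]] x d d0.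
by have [i /(_ i (ler i)) [_ h]] := he x d d0; exists (e i).
Qed.

Lemma bai_right0 (A : naBanachAlgType K) : has_bounded_approximate_identity A ->
  forall z : A, (forall b, z ** b = 0) -> z = 0.
Proof.
move=> hA z h; apply: nrm_small => d d0; have [e] := bai_right_dense hA z d0.
by rewrite h sub0r nrmN.
Qed.

Lemma bai_left0 (A : naBanachAlgType K) : has_bounded_approximate_identity A ->
  forall z : A, (forall b, b ** z = 0) -> z = 0.
Proof.
move=> hA z h; apply: nrm_small => d d0; have [e] := bai_left_dense hA z d0.
by rewrite h sub0r nrmN.
Qed.

Lemma bai_right_inj (A : naBanachAlgType K) : has_bounded_approximate_identity A ->
  forall z w : A, (forall b, z ** b = w ** b) -> z = w.
Proof.
move=> hA z w h; apply/eqP; rewrite -subr_eq0; apply/eqP.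
apply: (bai_right0 hA) => b.
by rewrite (is_linearB (proj1 (bmul_linear_r b))) h subrr.
Qed.

Lemma bai_left_inj (A : naBanachAlgType K) : has_bounded_approximate_identity A ->
  forall z w : A, (forall b, b ** z = b ** w) -> z = w.
Proof.
move=> hA z w h; apply/eqP; rewrite -subr_eq0; apply/eqP.
apply: (bai_left0 hA) => b.
by rewrite (is_linearB (proj1 (bmul_linear_l b))) h subrr.
Qed.

(** Products are dense: x is close to e x. *)
Lemma bai_ext (A : naBanachAlgType K) (F : naNormedType K) (f g : A -> F) :
  has_bounded_approximate_identity A -> bounded_linear f -> bounded_linear g ->
  (forall a b, f (a ** b) = g (a ** b)) -> forall x, f x = g x.
Proof.
move=> hA bf bg fg x; apply/eqP; rewrite -subr_eq0; apply/eqP.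
have bh : bounded_linear (fun x => (-1) *: g x + f x) by exact: bounded_linear_comb.
have [C [C0 hC]] := bounded_linear_pos bh.
have -> : f x - g x = - 1 *: g x + f x by rewrite scaleN1r addrC.
apply: nrm_small => d d0; have [e he] := bai_left_dense hA x (divr_gt0 d0 C0).
have -> : -1 *: g x + f x = - ((-1) *: g (e ** x - x) + f (e ** x - x)).
  rewrite (is_linearB (proj1 bf)) (is_linearB (proj1 bg)) fg !scaleN1r.
  by rewrite opprB addrA addrNK opprB addrC.
rewrite nrmN (le_lt_trans (hC _))// mulrC -ltr_pdivlMr//.
Qed.

(** For a uniformly bounded net of operators, convergence to the identity can be
tested on elementary tensors. *)
Lemma net_conv_ctensor (E F : naNormedType K) (I : Type) (le : I -> I -> Prop)
    (U : I -> ctensor E F -> ctensor E F) (C : R) : directed le ->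
  (forall i, is_linear (U i)) -> (forall i z, nrm (U i z) <= C * nrm z) ->
  (forall x y d, 0 < d -> exists i0, forall i, le i0 i ->
     nrm (U i (tens x y) - tens x y) < d) ->
  forall z d, 0 < d -> exists i0, forall i, le i0 i -> nrm (U i z - z) < d.
Proof.
move=> [[i1] ler letr dir] lU bU hU z d d0.
pose C' := Num.max C 1; have C'0 : 0 < C' by rewrite lt_max ltr01 orbT.
have [s hs] := ct_fsum_dense z (divr_gt0 d0 C'0).
have [i0 hi0] : exists i0, forall i, le i0 i -> nrm (U i (ct_fsum s) - ct_fsum s) < d.
  rewrite ct_fsumE; elim: s {hs} => [|[x y] s [i hi]].
    by exists i1 => i _; rewrite big_nil (is_linear0 (lU i)) subrr nrm0.
  have [j hj] := hU x y d d0; have [k [ik jk]] := dir i j; exists k => l kl.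
  rewrite big_cons (is_linearD (lU l)) opprD addrACA (le_lt_trans (nrmD _ _))//.
  by rewrite gt_max hj ?hi//; [exact: letr ik kl|exact: letr jk kl].
exists i0 => i /hi0 hi.
have -> : U i z - z = U i (z - ct_fsum s) + ((U i (ct_fsum s) - ct_fsum s) - (z - ct_fsum s)).
  by rewrite (is_linearB (lU i)) [RHS]addrA [X in _ = X - _]addrA addrNK opprB addrA addrNK.
have h1 : C' * nrm (z - ct_fsum s) < d by rewrite mulrC -ltr_pdivlMr.
rewrite (le_lt_trans (nrmD _ _))// gt_max; apply/andP; split.
  apply: le_lt_trans h1; rewrite (le_trans (bU _ _))// ler_wpM2r ?nrm_ge0//.
  by rewrite le_max lexx.
rewrite (le_lt_trans (nrmB _ _))// gt_max hi/=.
by apply: le_lt_trans h1; rewrite ler_peMl ?nrm_ge0// le_max lexx orbT.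
Qed.

Lemma tens_near (E F : naNormedType K) (x x' : E) (y y' : F) (C d : R) :
  0 < C -> nrm y' <= C * nrm y ->
  nrm (x' - x) * (C * nrm y) < d -> nrm x * nrm (y' - y) < d ->
  nrm (tens x' y' - tens x y : ctensor E F) < d.
Proof.
move=> C0 hy h1 h2.
have -> : tens x' y' - tens x y = tens (x' - x) y' + tens x (y' - y) :> ctensor E F.
  rewrite (is_linearB (proj1 (tens_bll E y'))) (is_linearB (proj1 (tens_blr F x))).
  by rewrite addrA addrNK.
rewrite (le_lt_trans (nrmD _ _))// gt_max; apply/andP; split.
  by apply: le_lt_trans h1; rewrite (le_trans (nrm_tens_le _ _))// ler_wpM2l ?nrm_ge0.
by apply: le_lt_trans h2; exact: nrm_tens_le.
Qed.

Lemma pdiv1_mul (t d : R) : 0 <= t -> 0 < d -> 0 < d / (t + 1) /\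
  forall s, s < d / (t + 1) -> 0 <= s -> s * t < d.
Proof.
move=> t0 d0; have t1 : 0 < t + 1 by rewrite ltr_wpDl.
split=> [|s]; first exact: divr_gt0.
rewrite ltr_pdivlMr// => h s0; apply: le_lt_trans h.
by rewrite ler_wpM2l// lerDl.
Qed.

(** The elementary tensors of two approximate identities form one, by
[net_conv_ctensor]. *)
Lemma bai_ctensor (A B : naBanachAlgType K) : has_bounded_approximate_identity A ->
  has_bounded_approximate_identity B -> has_bounded_approximate_identity (ctensor A B).
Proof.
move=> [I [leI [e [[[i1] rI tI dI] [C hC] he]]]] [J [leJ [f [[[j1] rJ tJ dJ] [D hD] hf]]]].
pose le (p q : I * J) := leI p.1 q.1 /\ leJ p.2 q.2.
pose u (p : I * J) : ctensor A B := tens (e p.1) (f p.2).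
have dle : directed le.
  split; first exact: (inhabits (i1, j1)).
  - by move=> p; split.
  - move=> p q r [h1 h2] [h3 h4]; split; [exact: tI h1 h3|exact: tJ h2 h4].
  - move=> p q; have [i [h1 h2]] := dI p.1 q.1; have [j [h3 h4]] := dJ p.2 q.2.
    by exists (i, j).
pose D' := Num.max D 1; have D'0 : 0 < D' by rewrite lt_max ltr01 orbT.
have hD' j : nrm (f j) <= D' by rewrite le_max hD.
have bu p : nrm (u p) <= C * D.
  by rewrite (le_trans (nrm_tens_le _ _))// ler_pM ?nrm_ge0.
have pt (x : A) (y : B) (d : R) : 0 < d -> exists i0 : I * J, forall i, le i0 i ->
    nrm (u i ** tens x y - tens x y) < d /\ nrm (tens x y ** u i - tens x y) < d.
  move=> d0.
  have [p1 q1] := pdiv1_mul (mulr_ge0 (ltW D'0) (nrm_ge0 y)) d0.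
  have [p2 q2] := pdiv1_mul (nrm_ge0 x) d0.
  have [i hi] := he x _ p1; have [j hj] := hf y _ p2.
  exists (i, j) => -[i' j'] [/= /hi [a1 a2] /hj [b1 b2]]; rewrite !tens_mul; split.
  - apply: (tens_near D'0).
    + by rewrite (le_trans (nrm_bmul _ _))// ler_wpM2r ?nrm_ge0.
    + exact: q1 a1 (nrm_ge0 _).
    + by rewrite mulrC; exact: q2 b1 (nrm_ge0 _).
  - apply: (tens_near D'0).
    + by rewrite (le_trans (nrm_bmul _ _))// mulrC ler_wpM2r ?nrm_ge0.
    + exact: q1 a2 (nrm_ge0 _).
    + by rewrite mulrC; exact: q2 b2 (nrm_ge0 _).
exists (I * J)%type, le, u; split=> //; first by exists (C * D) => p; exact: bu.
move=> z d d0.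
have [p hp] := @net_conv_ctensor A B _ le (fun i z => u i ** z) (C * D) dle
  (fun i => proj1 (bmul_linear_l (u i)))
  (fun i z => le_trans (nrm_bmul _ _) (ler_wpM2r (nrm_ge0 z) (bu i)))
  (fun x y d d0 => let: ex_intro i h := pt x y d d0 in ex_intro _ i (fun j k => proj1 (h j k)))
  z d d0.
have br i (w : ctensor A B) : nrm (w ** u i) <= C * D * nrm w.
  by rewrite mulrC (le_trans (nrm_bmul _ _))// ler_wpM2l ?nrm_ge0.
have [q hq] := @net_conv_ctensor A B _ le (fun i z => z ** u i) (C * D) dle
  (fun i => proj1 (bmul_linear_r (u i))) br
  (fun x y d d0 => let: ex_intro i h := pt x y d d0 in ex_intro _ i (fun j k => proj2 (h j k)))
  z d d0.
have [_ _ tr dr] := dle; have [r [pr qr]] := dr p q.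
by exists r => i ri; split; [apply: hp; exact: tr pr ri|apply: hq; exact: tr qr ri].
Qed.

End ApproximateIdentity.

(** * Multipliers *)

Section MultiplierAlgebra.
Context (R : realType) (K : naFieldType R).

Lemma mult_to_mult (B : naBanachAlgType K) (m : mult B) x :
  m ** to_mult x = to_mult (ml m x).
Proof. by apply: mult_ext => y /=; rewrite ?mlM ?mlrM. Qed.

Lemma to_mult_mult (B : naBanachAlgType K) (m : mult B) x :
  to_mult x ** m = to_mult (mr m x).
Proof. by apply: mult_ext => y /=; rewrite ?mrM ?mlrM. Qed.

Lemma to_multM (B : naBanachAlgType K) (x y : B) :
  to_mult (x ** y) = to_mult x ** to_mult y.
Proof. by rewrite mult_to_mult. Qed.

Lemma mult1l (B : naBanachAlgType K) (m : mult B) : mult1 B ** m = m.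
Proof. exact: mult_ext. Qed.

Lemma mult1r (B : naBanachAlgType K) (m : mult B) : m ** mult1 B = m.
Proof. exact: mult_ext. Qed.

Lemma to_mult_inj (B : naBanachAlgType K) : has_bounded_approximate_identity B ->
  injective (@to_mult R K B).
Proof.
move=> hB x y h; apply: (bai_right_inj hB) => b.
by have /(congr1 (fun m => ml m b)) := h.
Qed.

(** The relation  (x m) y = x (m y)  recovers the right part of m from the left one. *)
Lemma mult_extl (B : naBanachAlgType K) (m n : mult B) :
  has_bounded_approximate_identity B -> (forall x, ml m x = ml n x) -> m = n.
Proof.
move=> hB h; apply: mult_ext => // x; apply: (bai_right_inj hB) => y.
by rewrite !mlrM h.
Qed.

Lemma mtensM (A B : naBanachAlgType K) (m m' : mult A) (n n' : mult B) :
  mtens m n ** mtens m' n' = mtens (m ** m') (n ** n').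
Proof.
apply: mult_ext => z /=; apply: ctmap_comp; by [exact: ml_bounded|exact: mr_bounded].
Qed.

(** Conjugation of multipliers serves twice: to identify the multipliers of the two
triple tensor products, and to extend an isomorphism between tensor squares. *)
Section Transport.
Context (B B' : naBanachAlgType K) (f : B -> B') (g : B' -> B).
Hypotheses (bf : bounded_linear f) (bg : bounded_linear g).
Hypotheses (fK : cancel f g) (gK : cancel g f).
Hypothesis (fM : forall x y, f (x ** y) = f x ** f y).

Let gM x y : g (x ** y) = g x ** g y.
Proof. by apply: (can_inj fK); rewrite fM !gK. Qed.

Definition mult_transport (m : mult B) : mult B'.
refine (@Mult _ _ B' (fun x => f (ml m (g x))) (fun x => f (mr m (g x)))
  (bounded_linear_comp bf (bounded_linear_comp (ml_bounded m) bg))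
  (bounded_linear_comp bf (bounded_linear_comp (mr_bounded m) bg)) _ _ _).
- by move=> a b; rewrite gM mlM fM gK.
- by move=> a b; rewrite gM mrM fM gK.
- by move=> a b; apply: (can_inj gK); rewrite !gM !fK mlrM.
Defined.

Lemma mult_transport_hom : cont_hom mult_transport.
Proof.
have [C [C0 hC]] := bounded_linear_pos bf; have [D [D0 hD]] := bounded_linear_pos bg.
split; last by move=> m n; apply: mult_ext => x /=; rewrite fK.
split; first by move=> c m n; apply: mult_ext => x /=; exact: (proj1 bf).
exists (C * D) => m; apply: nrm_mult_le.
- by rewrite !mulr_ge0 ?nrm_ge0 ?ltW.
- move=> x /=; rewrite (le_trans (hC _))// -!mulrA ler_pM2l//.
  by rewrite (le_trans (nrm_ml _ _))// mulrCA ler_wpM2l ?nrm_ge0.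
- move=> x /=; rewrite (le_trans (hC _))// -!mulrA ler_pM2l//.
  by rewrite (le_trans (nrm_mr _ _))// mulrCA ler_wpM2l ?nrm_ge0.
Qed.

Lemma mult_transport_to_mult x : mult_transport (to_mult x) = to_mult (f x).
Proof. by apply: mult_ext => y /=; rewrite fM gK. Qed.

End Transport.

Section TensorTransport.
Context (A B : naBanachAlgType K) (f : A -> B) (g : B -> A).
Hypotheses (bf : bounded_linear f) (bg : bounded_linear g).
Hypotheses (fK : cancel f g) (gK : cancel g f).
Hypothesis (fM : forall x y, f (x ** y) = f x ** f y).

Lemma ctmapK : cancel (ctmap f f) (ctmap g g).
Proof.
by move=> z; rewrite ctmap_comp// (_ : (fun x => _) = id) ?ctmap_id//; apply/funext.
Qed.

Lemma ctmapVK : cancel (ctmap g g) (ctmap f f).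
Proof.
by move=> z; rewrite ctmap_comp// (_ : (fun x => _) = id) ?ctmap_id//; apply/funext.
Qed.

Lemma ctmapM z w : ctmap f f (z ** w) = ctmap f f z ** ctmap f f w.
Proof.
tens_ind z => a b; tens_ind w => a' b'.
by rewrite tens_mul !ctmapE// tens_mul !fM.
Qed.

Definition tensor_transport : mult (ctensor A A) -> mult (ctensor B B) :=
  mult_transport (ctmap_bl bf bf) (ctmap_bl bg bg) ctmapK ctmapVK ctmapM.

Lemma tensor_transport_extends :
  extends_hom (fun z => to_mult (ctmap f f z)) tensor_transport.
Proof.
by split; [exact: mult_transport_hom|move=> z; exact: mult_transport_to_mult].
Qed.

End TensorTransport.

End MultiplierAlgebra.

(** * Orthogonal representations of tensors *)

Section Orthogonality.
Context (R : realType) (K : naFieldType R).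

Definition complete_field := forall u : nat -> K^o, is_cauchy u -> exists l, converges_to u l.

(** A Banach space with a nonzero continuous functional forces the ground field to
be complete: push a Cauchy sequence of scalars into a line of the space. *)
Lemma complete_of_functional (E : naBanachType K) (f : E -> K^o) q :
  bounded_linear f -> f q = 1 -> complete_field.
Proof.
move=> bf fq u cu.
have [l hl] : exists l, converges_to (fun n => (u n : K) *: q) l.
  apply: na_complete => e e0; have q1 : 0 < nrm q + 1 by rewrite ltr_wpDl ?nrm_ge0.
  have [N hN] := cu _ (divr_gt0 e0 q1); exists N => m n Nm Nn.
  have := hN m n Nm Nn; rewrite ltr_pdivlMr// -scalerBl nrmZ => h.
  by apply: le_lt_trans h; rewrite ler_wpM2l ?absv_ge0// lerDl.
exists (f l); have := bounded_linear_conv bf hl.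
suff -> : (fun n => f ((u n : K) *: q)) = u by [].
by apply/funext => n; rewrite (is_linearZ (proj1 bf)) fq; exact: mulr1.
Qed.

Section System.
Context (E F : naNormedType K).
Implicit Types (s : seq (E * F)) (c : nat -> K).

Fixpoint comb c s : E :=
  if s is p :: s' then c 0%N *: p.1 + comb (fun n => c n.+1) s' else 0.

Fixpoint comb_cost c s : R :=
  if s is p :: s' then Num.max (absv (c 0%N) * nrm p.1) (comb_cost (fun n => c n.+1) s')
  else 0.

(** The usual notion of a t-orthogonal system, for the first components of s; the
second components are carried along for the sake of [exists_orthogonal]. *)
Definition orthogonal (t : R) s := forall c, t * comb_cost c s <= nrm (comb c s).

Lemma comb_cost_ge0 c s : 0 <= comb_cost c s.
Proof. by elim: s c => [|p s IH] c //=; rewrite le_max IH orbT. Qed.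

Lemma combD (k : K) c c' s : comb (fun n => k * c n + c' n) s = k *: comb c s + comb c' s.
Proof.
elim: s c c' => [|p s IH] c c' /=; first by rewrite scaler0 addr0.
by rewrite IH scalerDl scalerDr scalerA addrACA.
Qed.

Lemma orthogonal_le t t' s : t' <= t -> orthogonal t s -> orthogonal t' s.
Proof.
by move=> tt' h c; apply: le_trans (h c); rewrite ler_wpM2r ?comb_cost_ge0.
Qed.

Lemma orthogonal_behead t p s : 0 < t -> orthogonal t (p :: s) -> orthogonal t s.
Proof.
move=> t0 h c; have := h (fun n => if n is m.+1 then c m else 0).
rewrite /= scale0r add0r absv0 mul0r; apply: le_trans.
by rewrite ler_pM2l// le_max lexx orbT.
Qed.

Lemma converges_sub (G : naNormedType K) (u v : nat -> G) l m :
  converges_to u l -> converges_to v m -> converges_to (fun n => u n - v n) (l - m).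
Proof.
move=> hu hv; have := converges_comb (-1) hv hu.
have E1 (a b : G) : -1 *: a + b = b - a by rewrite scaleN1r addrC.
by rewrite E1 (_ : (fun n => _) = (fun n => u n - v n))//; apply/funext => n; rewrite E1.
Qed.

(** The span of an orthogonal system is closed, as the coefficients of a convergent
sequence converge. *)
Lemma orthogonal_closed t s : complete_field -> 0 < t -> orthogonal t s ->
  forall (c : nat -> nat -> K) x, converges_to (fun n => comb (c n) s) x ->
  exists c', x = comb c' s.
Proof.
move=> Kc t0; elim: s => [|p s IH] os c x cx.
  exists (fun=> 0) => /=; apply: converges_to_uniq cx _ => e e0.
  by exists 0%N => n _ /=; rewrite subrr nrm0.
have [k hk] : exists k : K, converges_to (fun n => c n 0%N *: p.1) (k *: p.1).
  have [p0|p0] := eqVneq p.1 0.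
    by exists 0 => e e0; exists 0%N => n _; rewrite p0 !scaler0 subrr nrm0.
  have pp := nrm_gt0 p0.
  have [l hl] : exists l, converges_to (fun n => (c n 0%N : K^o)) l.
    apply: Kc => e e0.
    have [N hN] := converges_cauchy cx (mulr_gt0 t0 (mulr_gt0 e0 pp)).
    exists N => m n Nm Nn; have := hN m n Nm Nn.
    have -> : comb (c m) (p :: s) - comb (c n) (p :: s) =
              comb (fun i => -1 * c n i + c m i) (p :: s).
      by rewrite combD scaleN1r addrC.
    move=> /(le_lt_trans (os _)); rewrite ltr_pM2l// /= gt_max => /andP[h _].
    by move: h; rewrite ltr_pM2r// mulN1r addrC.
  exists l => e e0; have [N hN] := hl _ (divr_gt0 e0 pp); exists N => n /hN.
  by rewrite ltr_pdivlMr// -scalerBl nrmZ.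
have [|c' hc'] := IH (orthogonal_behead t0 os) (fun n i => c n i.+1) (x - k *: p.1).
  have := converges_sub cx hk; congr converges_to; apply/funext => n /=.
  by rewrite addrC addKr.
exists (fun n => if n is m.+1 then c' m else k) => /=.
by rewrite -hc' addrC subrK.
Qed.

(** Replacing x by x + comb c s in the first leg of x (x) y + s amounts to this change
of the second components of s. *)
Fixpoint add_second c (y : F) s : seq (E * F) :=
  if s is p :: s' then (p.1, p.2 + c 0%N *: y) :: add_second (fun n => c n.+1) y s' else [::].

Lemma comb_add_second c d y s : comb d (add_second c y s) = comb d s.
Proof. by elim: s c d => [//|p s IH] c d /=; rewrite IH. Qed.

Lemma orthogonal_add_second c y s t : orthogonal t s -> orthogonal t (add_second c y s).
Proof.
move=> h d; rewrite comb_add_second; apply: le_trans (h d).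
suff -> : comb_cost d (add_second c y s) = comb_cost d s by [].
by elim: s c d {h} => [//|p s IH] c d /=; rewrite IH.
Qed.

Lemma fsum_add_second (G : lmodType K) (b : E -> F -> G) c y s : is_bilinear b ->
  fsum b (add_second c y s) = fsum b s + b (comb c s) y.
Proof.
move=> [lb rb]; rewrite /fsum; elim: s c => [|p s IH] c /=.
  by rewrite !big_nil (is_linear0 (lb y)) addr0.
rewrite !big_cons IH /= (is_linearD (rb _)) (is_linearZ (rb _)) (lb y).
by rewrite addrACA.
Qed.

(** The Gram-Schmidt procedure with almost best approximations: a new vector x is
replaced by its difference to a nearly closest point of the span of the previous
ones, or eliminated if it belongs to the span. *)
Lemma exists_orthogonal t s : complete_field -> 0 < t -> t < 1 ->
  exists s', same_tensor s s' /\ orthogonal t s'.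
Proof.
move=> Kc; elim: s t => [|[x y] s IH] t t0 t1.
  by exists [::]; split=> // c /=; rewrite mulr0 nrm0.
(* t <= r * r : one factor r comes from the old system, the other from the new vector *)
set r := (1 + t) / 2; have r0 : 0 < r by rewrite /r; lra.
have r1 : r < 1 by rewrite /r; lra.
have trr : t <= r * r by rewrite /r; have := sqr_ge0 (1 - t); rewrite expr2; lra.
have tr : t <= r by rewrite /r; lra.
have [s1 [ss os]] := IH r r0 r1.
pose S := [set nrm (x - comb c s1) | c in [set: nat -> K]]%classic.
have S0 : (S !=set0)%classic by exists (nrm (x - comb (fun=> 0) s1)), (fun=> 0).
have Slb : has_lbound S by exists 0 => _ [c _ <-]; exact: nrm_ge0.
have same_cons x' c : x = x' + comb c s1 ->
    same_tensor ((x, y) :: s) ((x', y) :: add_second c y s1).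
  move=> xE G b bb; have := fsum_add_second c y s1 bb; rewrite /fsum !big_cons /= => ->.
  have := ss G b bb; rewrite /fsum => ->; case: (bb) => lb _.
  by rewrite xE (is_linearD (lb y)) -!addrA; congr (_ + _); exact: addrC.
have [D0|D0] : inf S = 0 \/ 0 < inf S.
  have : 0 <= inf S by apply: lb_le_inf => // _ [c _ <-]; exact: nrm_ge0.
  by rewrite le_eqVlt => /predU1P[<-|]; [left|right].
- have app (n : nat) : exists c, nrm (x - comb c s1) < n.+1%:R^-1.
    have : inf S < n.+1%:R^-1 by rewrite D0 invr_gt0.
    by case/(inf_lt S0) => _ [c _ <-] h; exists c.
  have [c hc] := @boolp.choice _ _ _ app.
  have [|c' xc'] := orthogonal_closed Kc r0 os (c := c) (x := x).
    move=> e e0; exists (Num.bound e^-1) => n Nn; rewrite nrm_distC.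
    apply: (lt_trans (hc n)); rewrite invf_plt ?posrE//.
    apply: (@lt_le_trans _ _ (Num.bound e^-1)%:R).
      by apply: archi_boundP; rewrite invr_ge0 ltW.
    by rewrite ler_nat ltnW.
  exists (add_second c' y s1); split; last first.
    by apply: orthogonal_add_second; exact: orthogonal_le tr os.
  have := same_cons 0 c'; rewrite add0r => /(_ xc') h G b bb.
  have := h G b bb; rewrite {2}/fsum big_cons /= (is_linear0 (proj1 bb y)) add0r.
  by [].
have [_ [c _ <-] hc] : exists2 d, S d & d < inf S / r.
  by apply: inf_lt => //; rewrite ltr_pdivlMr// mulrC gtr_pMl.
set x' := x - comb c s1 in hc.
have xx' : x = x' + comb c s1 by rewrite subrK.
exists ((x', y) :: add_second c y s1); split; first exact: same_cons.
move=> e /=; rewrite comb_add_second.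
set v := comb _ s1; set k := e 0%N.
have h1 : r * (absv k * nrm x') <= nrm (k *: x' + v).
  have [->|k0] := eqVneq k 0; first by rewrite absv0 mul0r mulr0 nrm_ge0.
  have -> : k *: x' + v = k *: (x - comb (fun n => - k^-1 * e n.+1 + c n) s1).
    rewrite combD -/v scaleNr opprD opprK addrCA [RHS]scalerDr scalerA divff// scale1r.
    by rewrite [LHS]addrC.
  rewrite nrmZ mulrCA ler_wpM2l ?absv_ge0//.
  move: hc; rewrite ltr_pdivlMr// mulrC => /ltW/le_trans; apply.
  by apply: ge_inf => //; eexists.
have h2 : r * nrm v <= nrm (k *: x' + v).
  have -> : v = (k *: x' + v) - k *: x' by rewrite addrC addKr.
  rewrite [X in _ <= nrm X]addrC subrK mulrC -ler_pdivlMr//.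
  rewrite (le_trans (nrmB _ _))// ge_max !ler_pdivlMr//; apply/andP; split.
    by rewrite ler_piMr ?nrm_ge0// ltW.
  by rewrite mulrC nrmZ.
rewrite maxr_pMr ?(ltW t0)// ge_max; apply/andP; split.
  by apply: le_trans h1; rewrite ler_wpM2r// mulr_ge0 ?absv_ge0 ?nrm_ge0.
have h3 := orthogonal_add_second c y os (fun n => e n.+1).
rewrite comb_add_second -/v in h3.
apply: le_trans h2; apply: le_trans (ler_wpM2l (ltW r0) h3).
by rewrite mulrA; apply: ler_wpM2r trr; exact: comb_cost_ge0.
Qed.

End System.

Lemma rep_cost_le (E F : naNormedType K) (s : seq (E * F)) (r : R) : 0 <= r ->
  (forall p, p \in s -> nrm p.1 * nrm p.2 <= r) -> rep_cost s <= r.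
Proof.
rewrite /rep_cost => r0; elim: s => [|p s IH] h; first by rewrite big_nil.
rewrite big_cons ge_max h ?mem_head//=; apply: IH => q qs; apply: h.
by rewrite inE qs orbT.
Qed.

(** A tensor is determined by its slices along a norming family of functionals.
A finite sum close to z is rewritten with an almost orthogonal system in the first
leg; then each slice bounds every single coefficient. *)
Lemma slicer_inj (E F : naBanachType K) (I : Type) (g : I -> F -> K^o) (M : I -> R)
    (z : ctensor E F) : complete_field ->
  (forall i, bounded_linear (g i)) -> (forall i, 0 < M i) ->
  (forall i y, nrm (g i y) <= M i * nrm y) ->
  (forall y r, r < nrm y -> exists i, r * M i < nrm (g i y)) ->
  (forall i, slicer (g i) z = 0) -> z = 0.
Proof.
move=> Kc bg M0 hM hg hz; apply: nrm_small => e e0.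
have e4 : 0 < e / 4 by rewrite divr_gt0.
have [s0 hs0] := ct_fsum_dense z e4.
have [||s [ss os]] := @exists_orthogonal E F (1 / 2) s0 Kc; [lra|lra|].
have E0 : ct_fsum s0 = ct_fsum s :> ctensor E F by apply/clsP/same_tequiv.
rewrite E0 in hs0.
suff hs : nrm (ct_fsum s : ctensor E F) <= e / 2.
  have -> : z = (z - ct_fsum s) + ct_fsum s by rewrite subrK.
  rewrite (le_lt_trans (nrmD _ _))// gt_max; apply/andP; split.
    by apply: (lt_trans hs0); lra.
  by apply: (le_lt_trans hs); lra.
rewrite nrm_ct_fsum; apply: (le_trans (tnorm_le (same_refl s))).
have e2 : 0 <= e / 2 by lra.
apply: rep_cost_le => // p ps.
have key i : nrm (g i p.2) * nrm p.1 <= M i * (e / 2).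
  have cost_ge : nrm (g i p.2) * nrm p.1 <= comb_cost (fun n => g i (nth p s n).2) s.
    move: (p) ps => q; elim: s {ss os E0 hs0} => [//|p' s IH] /=.
    rewrite inE le_max => /predU1P[->|/IH h]; first by rewrite lexx.
    by rewrite h orbT.
  have combE : comb (fun n => g i (nth p s n).2) s = slicer (g i) (ct_fsum s).
    rewrite ct_fsumE (is_linear_sum (proj1 (slicer_bl E (bg i)))).
    move: (p) => q; elim: s {ps ss os E0 hs0 cost_ge} => [|p' s IH]; first by rewrite big_nil.
    by rewrite big_cons slicerE//= -IH.
  have := os (fun n => g i (nth p s n).2); rewrite combE.
  have -> : slicer (g i) (ct_fsum s) = - slicer (g i) (z - ct_fsum s).
    by rewrite (is_linearB (proj1 (slicer_bl E (bg i)))) hz sub0r opprK.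
  rewrite nrmN => h; apply: (le_trans cost_ge).
  have h2 := slicer_le (z - ct_fsum s) (bg i) (ltW (M0 i)) (hM i).
  have h3 : M i * nrm (z - ct_fsum s) <= M i * (e / 4) by rewrite ler_pM2l// ltW.
  by have := le_trans h (le_trans h2 h3); lra.
rewrite leNgt; apply/negP => lt.
have p1 : 0 < nrm p.1.
  rewrite lt_neqAle nrm_ge0 andbT; apply/eqP => h.
  by move: lt; rewrite -h mul0r ltNge e2.
have [i hi] : exists i, e / 2 / nrm p.1 * M i < nrm (g i p.2).
  by apply: hg; rewrite ltr_pdivrMr// [X in _ < X]mulrC.
have := key i; rewrite leNgt => /negP; apply.
by rewrite [X in X < _]mulrC -ltr_pdivrMr// mulrAC.
Qed.

End Orthogonality.

(** * The four canonical maps *)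

(* multiplication by c on the left or on the right, in the first or the second leg *)
Notation L1 c := (ctmap (bmul c) id).
Notation L2 c := (ctmap id (bmul c)).
Notation R1 c := (ctmap (bmul^~ c) id).
Notation R2 c := (ctmap id (bmul^~ c)).

Section InverseOfExtension.
Context (R : realType) (K : naFieldType R) (A : naBanachAlgType K).

Definition ctlift_inv (T : A -> A -> ctensor A A) (z : ctensor A A) : ctensor A A :=
  xget 0 [set v | ctlift T v = z]%classic.

Lemma ctlift_invP (T : A -> A -> ctensor A A) : extends_to_bij_isometry T ->
  [/\ bounded_linear (ctlift T), forall a b, ctlift T (tens a b) = T a b,
      bounded_linear (ctlift_inv T), cancel (ctlift T) (ctlift_inv T) &
      cancel (ctlift_inv T) (ctlift T)].
Proof.
move=> [h [lh ih bh hT]].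
have bh' : bounded_linear h by split=> //; exists 1 => x; rewrite ih mul1r.
have -> : ctlift T = h by exact: ctlift_uniq.
have [g hg gh] := bh.
have gE z : ctlift_inv T z = g z.
  rewrite /ctlift_inv (ctlift_uniq bh' hT); apply: xget_unique => /= [|v <-].
    exact: gh.
  by rewrite hg.
split=> //; [|by move=> z; rewrite gE hg|by move=> z; rewrite gE gh].
have -> : ctlift_inv T = g by apply/funext => z; exact: gE.
split=> [c x y|]; first by apply: (can_inj hg); rewrite lh !gh.
by exists 1 => x; rewrite mul1r -(ih (g x)) gh.
Qed.

End InverseOfExtension.

Section HopfMaps.
Context (R : realType) (K : naFieldType R) (A : naBanachAlgType K).
Context (Delta : A -> mult (ctensor A A)) (H : multiplier_banach_hopf Delta).

(* t_i is the isometry that extends T_i, and u_i its inverse *)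
Local Notation t1 := (ctlift (T1 Delta)).
Local Notation t2 := (ctlift (T2 Delta)).
Local Notation t3 := (ctlift (T3 Delta)).
Local Notation t4 := (ctlift (T4 Delta)).
Local Notation u1 := (ctlift_inv (T1 Delta)).
Local Notation u2 := (ctlift_inv (T2 Delta)).
Local Notation u3 := (ctlift_inv (T3 Delta)).
Local Notation u4 := (ctlift_inv (T4 Delta)).
Let one : mult A := mult1 A.

Let hA := mbh_approx H.
Let hA2 := bai_ctensor hA hA.
Let hA3 := bai_ctensor hA hA2.
Let hA3' := bai_ctensor hA2 hA.

Lemma Delta_bl : bounded_linear Delta.
Proof. exact: (proj1 (comult_hom (mbh_comult H))). Qed.
Lemma DeltaM a b : Delta (a ** b) = Delta a ** Delta b.
Proof. exact: (proj2 (comult_hom (mbh_comult H))). Qed.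

Lemma t1_bl : bounded_linear t1. Proof. by case: (ctlift_invP (mbh_T1 H)). Qed.
Lemma t2_bl : bounded_linear t2. Proof. by case: (ctlift_invP (mbh_T2 H)). Qed.
Lemma t3_bl : bounded_linear t3. Proof. by case: (ctlift_invP (mbh_T3 H)). Qed.
Lemma t4_bl : bounded_linear t4. Proof. by case: (ctlift_invP (mbh_T4 H)). Qed.
Lemma u1_bl : bounded_linear u1. Proof. by case: (ctlift_invP (mbh_T1 H)). Qed.
Lemma u2_bl : bounded_linear u2. Proof. by case: (ctlift_invP (mbh_T2 H)). Qed.
Lemma u3_bl : bounded_linear u3. Proof. by case: (ctlift_invP (mbh_T3 H)). Qed.
Lemma u4_bl : bounded_linear u4. Proof. by case: (ctlift_invP (mbh_T4 H)). Qed.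
Lemma t1E a b : t1 (tens a b) = T1 Delta a b. Proof. by case: (ctlift_invP (mbh_T1 H)). Qed.
Lemma t2E a b : t2 (tens a b) = T2 Delta a b. Proof. by case: (ctlift_invP (mbh_T2 H)). Qed.
Lemma t3E a b : t3 (tens a b) = T3 Delta a b. Proof. by case: (ctlift_invP (mbh_T3 H)). Qed.
Lemma t4E a b : t4 (tens a b) = T4 Delta a b. Proof. by case: (ctlift_invP (mbh_T4 H)). Qed.
Lemma t1K : cancel t1 u1. Proof. by case: (ctlift_invP (mbh_T1 H)). Qed.
Lemma t2K : cancel t2 u2. Proof. by case: (ctlift_invP (mbh_T2 H)). Qed.
Lemma t3K : cancel t3 u3. Proof. by case: (ctlift_invP (mbh_T3 H)). Qed.
Lemma t4K : cancel t4 u4. Proof. by case: (ctlift_invP (mbh_T4 H)). Qed.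
Lemma u1K : cancel u1 t1. Proof. by case: (ctlift_invP (mbh_T1 H)). Qed.
Lemma u2K : cancel u2 t2. Proof. by case: (ctlift_invP (mbh_T2 H)). Qed.
Lemma u3K : cancel u3 t3. Proof. by case: (ctlift_invP (mbh_T3 H)). Qed.
Lemma u4K : cancel u4 t4. Proof. by case: (ctlift_invP (mbh_T4 H)). Qed.

Hint Resolve Delta_bl t1_bl t2_bl t3_bl t4_bl u1_bl u2_bl u3_bl u4_bl : bl.

(* identities in the tensor square are proved in its multiplier algebra *)
Let toT1 a b : to_mult (T1 Delta a b) = Delta a ** mtens one (to_mult b).
Proof. by apply: to_multK_ex; have [] := comult_T_in_alg (mbh_comult H) a b. Qed.
Let toT2 a b : to_mult (T2 Delta a b) = mtens (to_mult a) one ** Delta b.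
Proof. by apply: to_multK_ex; have [] := comult_T_in_alg (mbh_comult H) a b. Qed.
Let toT3 a b : to_mult (T3 Delta a b) = mtens one (to_mult b) ** Delta a.
Proof. by apply: to_multK_ex; have [] := comult_T_in_alg (mbh_comult H) a b. Qed.
Let toT4 a b : to_mult (T4 Delta a b) = Delta b ** mtens (to_mult a) one.
Proof. by apply: to_multK_ex; have [] := comult_T_in_alg (mbh_comult H) a b. Qed.

Let toL1 c (z : ctensor A A) : to_mult (L1 c z) = mtens (to_mult c) one ** to_mult z.
Proof. by rewrite mult_to_mult. Qed.
Let toL2 c (z : ctensor A A) : to_mult (L2 c z) = mtens one (to_mult c) ** to_mult z.
Proof. by rewrite mult_to_mult. Qed.
Let toR1 c (z : ctensor A A) : to_mult (R1 c z) = to_mult z ** mtens (to_mult c) one.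
Proof. by rewrite to_mult_mult. Qed.
Let toR2 c (z : ctensor A A) : to_mult (R2 c z) = to_mult z ** mtens one (to_mult c).
Proof. by rewrite to_mult_mult. Qed.
Let to12 (a b : A) : to_mult (tens a b) = mtens (to_mult a) one ** mtens one (to_mult b).
Proof. by rewrite mtensM mult1l mult1r to_mult_tens. Qed.
Let to21 (a b : A) : to_mult (tens a b) = mtens one (to_mult b) ** mtens (to_mult a) one.
Proof. by rewrite mtensM mult1l mult1r to_mult_tens. Qed.
Let mtens1M (a b : A) :
  mtens (to_mult (a ** b)) one = mtens (to_mult a) one ** mtens (to_mult b) one.
Proof. by rewrite mtensM to_multM mult1l. Qed.
Let mtens2M (a b : A) :
  mtens one (to_mult (a ** b)) = mtens one (to_mult a) ** mtens one (to_mult b).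
Proof. by rewrite mtensM to_multM mult1l. Qed.

Let toE := (toT1, toT2, toT3, toT4, toL1, toL2, toR1, toR2, DeltaM, mtens1M, mtens2M).

Lemma T1_mull c a b : T1 Delta (c ** a) b = ml (Delta c) (T1 Delta a b).
Proof. by apply: (to_mult_inj hA2); rewrite -mult_to_mult !(toE, bmulA). Qed.
Lemma T2_mulr a b c : T2 Delta a (b ** c) = mr (Delta c) (T2 Delta a b).
Proof. by apply: (to_mult_inj hA2); rewrite -to_mult_mult !(toE, bmulA). Qed.
Lemma T3_mulr a b c : T3 Delta (a ** c) b = mr (Delta c) (T3 Delta a b).
Proof. by apply: (to_mult_inj hA2); rewrite -to_mult_mult !(toE, bmulA). Qed.
Lemma T3_mull a b c : T3 Delta a (c ** b) = L2 c (T3 Delta a b).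
Proof. by apply: (to_mult_inj hA2); rewrite !(toE, bmulA). Qed.
Lemma T4_mull a b c : T4 Delta a (c ** b) = ml (Delta c) (T4 Delta a b).
Proof. by apply: (to_mult_inj hA2); rewrite -mult_to_mult !(toE, bmulA). Qed.
Lemma T4_mulr a b c : T4 Delta (a ** c) b = R1 c (T4 Delta a b).
Proof. by apply: (to_mult_inj hA2); rewrite !(toE, bmulA). Qed.

(* the associativity of  x Delta(b) y  for x, y in one of the two legs *)
Lemma L2_T1 a b c : L2 b (T1 Delta a c) = R2 c (T3 Delta a b).
Proof. by apply: (to_mult_inj hA2); rewrite !(toE, bmulA). Qed.
Lemma L1_T1 a b c : L1 a (T1 Delta b c) = R2 c (T2 Delta a b).
Proof. by apply: (to_mult_inj hA2); rewrite !(toE, bmulA). Qed.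
Lemma L1_T4 a b c : L1 c (T4 Delta a b) = R1 a (T2 Delta c b).
Proof. by apply: (to_mult_inj hA2); rewrite !(toE, bmulA). Qed.
Lemma L2_T4 a b x : L2 x (T4 Delta a b) = R1 a (T3 Delta b x).
Proof. by apply: (to_mult_inj hA2); rewrite !(toE, bmulA). Qed.
Lemma Delta_tens1 a p q : ml (Delta a) (tens p q) = R1 p (T1 Delta a q).
Proof. by apply: (to_mult_inj hA2); rewrite -mult_to_mult to21 !(toE, bmulA). Qed.
Lemma Delta_tens3 a p q : mr (Delta a) (tens p q) = L1 p (T3 Delta a q).
Proof. by apply: (to_mult_inj hA2); rewrite -to_mult_mult to12 !(toE, bmulA). Qed.
Lemma Delta_tens2 a p q : mr (Delta a) (tens p q) = L2 q (T2 Delta p a).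
Proof. by apply: (to_mult_inj hA2); rewrite -to_mult_mult to21 !(toE, bmulA). Qed.

Lemma t1_L1 c z : t1 (L1 c z) = ml (Delta c) (t1 z).
Proof. by tens_ind z => a b; rewrite ctmapE ?t1E ?T1_mull//; bl. Qed.
Lemma t2_R2 c z : t2 (R2 c z) = mr (Delta c) (t2 z).
Proof. by tens_ind z => a b; rewrite ctmapE ?t2E ?T2_mulr//; bl. Qed.
Lemma t3_R1 c z : t3 (R1 c z) = mr (Delta c) (t3 z).
Proof. by tens_ind z => a b; rewrite ctmapE ?t3E ?T3_mulr//; bl. Qed.
Lemma t3_L2 c z : t3 (L2 c z) = L2 c (t3 z).
Proof. by tens_ind z => a b; rewrite ctmapE ?t3E ?T3_mull//; bl. Qed.
Lemma t4_L2 c z : t4 (L2 c z) = ml (Delta c) (t4 z).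
Proof. by tens_ind z => a b; rewrite ctmapE ?t4E ?T4_mull//; bl. Qed.
Lemma t4_R1 c z : t4 (R1 c z) = R1 c (t4 z).
Proof. by tens_ind z => a b; rewrite ctmapE ?t4E ?T4_mulr//; bl. Qed.

Lemma u3_Delta c z : u3 (mr (Delta c) z) = R1 c (u3 z).
Proof. by apply: (can_inj t3K); rewrite t3_R1 !u3K. Qed.
Lemma u3_L2 c z : u3 (L2 c z) = L2 c (u3 z).
Proof. by apply: (can_inj t3K); rewrite t3_L2 !u3K. Qed.
Lemma u4_Delta c z : u4 (ml (Delta c) z) = L2 c (u4 z).
Proof. by apply: (can_inj t4K); rewrite t4_L2 !u4K. Qed.
Lemma u4_R1 c z : u4 (R1 c z) = R1 c (u4 z).
Proof. by apply: (can_inj t4K); rewrite t4_R1 !u4K. Qed.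

(** * Coassociativity *)

Lemma Delta_id_P : bounded_linear (Delta_id Delta) /\
  forall a b, Delta_id Delta (tens a b) = mtens (Delta a) (to_mult b).
Proof.
apply: ctliftP; split; first split=> [b|a].
- move=> k x y; rewrite (proj1 Delta_bl); exact: (proj1 (mtens_bilinear _ _)).
- move=> k x y; rewrite (proj1 (to_mult_bl A)); exact: (proj2 (mtens_bilinear _ _)).
have [C [C0 hC]] := bounded_linear_pos Delta_bl.
have [D [D0 hD]] := bounded_linear_pos (to_mult_bl A).
exists (C * D) => x y; rewrite (le_trans (nrm_mtens_le _ _))// mulrACA.
by apply: ler_pM; rewrite ?nrm_ge0.
Qed.

Lemma id_Delta_P : bounded_linear (id_Delta Delta) /\
  forall a b, id_Delta Delta (tens a b) = mtens (to_mult a) (Delta b).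
Proof.
apply: ctliftP; split; first split=> [b|a].
- move=> k x y; rewrite (proj1 (to_mult_bl A)); exact: (proj1 (mtens_bilinear _ _)).
- move=> k x y; rewrite (proj1 Delta_bl); exact: (proj2 (mtens_bilinear _ _)).
have [C [C0 hC]] := bounded_linear_pos Delta_bl.
have [D [D0 hD]] := bounded_linear_pos (to_mult_bl A).
exists (D * C) => x y; rewrite (le_trans (nrm_mtens_le _ _))// mulrACA.
by apply: ler_pM; rewrite ?nrm_ge0.
Qed.

(** The leg on which the extended homomorphism is the identity is fixed, because
the elements on which this can be tested span a dense subspace. *)
Lemma Ext1_mtens Ext (n : mult A) : extends_hom (Delta_id Delta) Ext ->
  Ext (mtens one n) = mtens (mult1 _) n.
Proof.
move=> [[_ EM] EE]; apply: (mult_extl hA3') => t.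
have key z w : ml (Ext (mtens one n)) (ml (Delta_id Delta z) w) =
    ml (Delta_id Delta (ml (mtens one n) z)) w.
  by rewrite -!EE -mult_to_mult EM.
have [_ DE] := Delta_id_P.
tens_ind t => w s; move: s.
apply: (bai_ext hA); [bl|bl|move=> b s].
move: w; have [dl _] := comult_nondegenerate (mbh_comult H).
apply: (dense_span_eq dl); [bl|bl|].
move=> _ [[a y] _ <-] /=.
have := key (tens a b) (tens y s).
by rewrite /= !ctmapE ?DE/= ?ctmapE//= ?mlM; bl.
Qed.

Lemma Ext2_mtens Ext (n : mult A) : extends_hom (id_Delta Delta) Ext ->
  Ext (mtens n one) = mtens n (mult1 _).
Proof.
move=> [[_ EM] EE]; apply: (mult_extl hA3) => t.
have key z w : ml (Ext (mtens n one)) (ml (id_Delta Delta z) w) =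
    ml (id_Delta Delta (ml (mtens n one) z)) w.
  by rewrite -!EE -mult_to_mult EM.
have [_ DE] := id_Delta_P.
tens_ind t => s w; move: s.
apply: (bai_ext hA); [bl|bl|move=> b s].
move: w; have [dl _] := comult_nondegenerate (mbh_comult H).
apply: (dense_span_eq dl); [bl|bl|].
move=> _ [[a y] _ <-] /=.
have := key (tens b a) (tens s y).
by rewrite /= !ctmapE ?DE/= ?ctmapE//= ?mlM; bl.
Qed.

Definition leg12 (f : ctensor A A -> ctensor A A) :
    ctensor A (ctensor A A) -> ctensor A (ctensor A A) :=
  fun t => ctassoc (ctmap f id (ctassocV t)).

Definition leg23 (f : ctensor A A -> ctensor A A) :
    ctensor A (ctensor A A) -> ctensor A (ctensor A A) := ctmap id f.

Lemma leg12_bl f : bounded_linear f -> bounded_linear (leg12 f).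
Proof. by move=> bf; rewrite /leg12; bl. Qed.
Lemma leg23_bl f : bounded_linear f -> bounded_linear (leg23 f).
Proof. by move=> bf; rewrite /leg23; bl. Qed.
Hint Resolve leg12_bl leg23_bl : bl.

Lemma leg12E f a b c : bounded_linear f ->
  leg12 f (tens a (tens b c)) = ctassoc (tens (f (tens a b)) c).
Proof. by move=> bf; rewrite /leg12 (proj2 (ctassocVP _ _ _)) ctmapE//; bl. Qed.
Lemma leg23E f a z : bounded_linear f ->
  leg23 f (tens a z) = tens a (f z).
Proof. by move=> bf; rewrite /leg23 ctmapE//; bl. Qed.

Let tau := mult_transport (proj1 (ctassocP A A A)) (proj1 (ctassocVP A A A))
  (@ctassocK R K A A A) (@ctassocVK R K A A A) (@ctassocM R K A A A).
Let tauM m n : tau (m ** n) = tau m ** tau n.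
Proof. exact: (proj2 (mult_transport_hom _ _ _ _ _)). Qed.
Let tau_bl : bounded_linear tau.
Proof. exact: (proj1 (mult_transport_hom _ _ _ _ _)). Qed.
Let tau_to x : tau (to_mult x) = to_mult (ctassoc x).
Proof. exact: mult_transport_to_mult. Qed.
Let tau_mtens m n p : tau (mtens (mtens m n) p) = mtens m (mtens n p).
Proof.
apply: (mult_extl hA3) => t; tens_ind t => a z; tens_ind z => b c.
have bm : bounded_linear (ctmap (ml m) (ml n)) by bl.
have bn : bounded_linear (ctmap (ml n) (ml p)) by bl.
rewrite /= (proj2 (ctassocVP _ _ _)) !ctmapE; try bl.
by rewrite (proj2 (ctassocP _ _ _)).
Qed.

(** M b stands for  (Delta (x) id)Delta(b) = (id (x) Delta)Delta(b). *)
Section Coassociativity.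
Variables (M : A -> mult (ctensor A (ctensor A A))).
Let D1 z := tau (Delta_id Delta z).
Let D2 z := id_Delta Delta z.
Let c3 c : mult (ctensor A (ctensor A A)) := mtens one (mtens one (to_mult c)).
Let a1 a : mult (ctensor A (ctensor A A)) := mtens (to_mult a) (mtens one one).
Hypothesis D1_1 : forall b c, D1 (T1 Delta b c) = M b ** c3 c.
Hypothesis D1_3 : forall b c, D1 (T3 Delta b c) = c3 c ** M b.
Hypothesis D2_2 : forall a b, D2 (T2 Delta a b) = a1 a ** M b.
Hypothesis D2_4 : forall a b, D2 (T4 Delta a b) = M b ** a1 a.

Let D1_bl : bounded_linear D1.
Proof. by have [b _] := Delta_id_P; rewrite /D1; exact: (bounded_linear_comp tau_bl b). Qed.
Let D2_bl : bounded_linear D2. Proof. exact: (proj1 id_Delta_P). Qed.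
Hint Resolve D1_bl D2_bl : bl.

Let D1E a b : D1 (tens a b) = tau (mtens (Delta a) (to_mult b)).
Proof. by rewrite /D1 (proj2 Delta_id_P). Qed.
Let D2E a b : D2 (tens a b) = mtens (to_mult a) (Delta b).
Proof. exact: (proj2 id_Delta_P). Qed.

Let c3a1 c a : c3 c ** a1 a = a1 a ** c3 c.
Proof. by rewrite !mtensM !mult1l !mult1r. Qed.

Let leg12_t4 a z : to_mult (leg12 t4 (tens a z)) = D1 z ** a1 a.
Proof.
tens_ind z => p q; rewrite leg12E; last by bl.
by rewrite t4E -tau_to -to_mult_tens toT4 D1E /a1 -tau_mtens -tauM mtensM mult1r.
Qed.

Let leg12_t2 a z : to_mult (leg12 t2 (tens a z)) = a1 a ** D1 z.
Proof.
tens_ind z => p q; rewrite leg12E; last by bl.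
by rewrite t2E -tau_to -to_mult_tens toT2 D1E /a1 -tau_mtens -tauM mtensM mult1l.
Qed.

Let leg23_t3 z c : to_mult (leg23 t3 (ctassoc (tens z c))) = c3 c ** D2 z.
Proof.
tens_ind z => p q; rewrite (proj2 (ctassocP _ _ _)) leg23E; last by bl.
by rewrite t3E -to_mult_tens toT3 D2E mtensM mult1l.
Qed.

Let leg23_t1 z c : to_mult (leg23 t1 (ctassoc (tens z c))) = D2 z ** c3 c.
Proof.
tens_ind z => p q; rewrite (proj2 (ctassocP _ _ _)) leg23E; last by bl.
by rewrite t1E -to_mult_tens toT1 D2E mtensM mult1r.
Qed.

Lemma coassoc_legs t :
  [/\ leg12 t4 (leg23 t3 t) = leg23 t3 (leg12 t4 t),
      leg12 t4 (leg23 t1 t) = leg23 t1 (leg12 t4 t) &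
      leg12 t2 (leg23 t1 t) = leg23 t1 (leg12 t2 t)].
Proof.
split; tens_ind t => a z; tens_ind z => b c; apply: (to_mult_inj hA3);
  rewrite leg12E ?leg23E; try bl.
- by rewrite t3E leg12_t4 D1_3 t4E leg23_t3 D2_4 bmulA.
- by rewrite t1E leg12_t4 D1_1 t4E leg23_t1 D2_4 -!bmulA c3a1.
- by rewrite t1E leg12_t2 D1_1 t2E leg23_t1 D2_2 !bmulA.
Qed.

End Coassociativity.

(** Multiplying  (Delta (x) id)Delta(b) = (id (x) Delta)Delta(b)  by elements of
the outer legs turns coassociativity into commutation relations between the maps
of the first two legs and those of the last two. *)
Lemma coassociativity t :
  [/\ leg12 t4 (leg23 t3 t) = leg23 t3 (leg12 t4 t),
      leg12 t4 (leg23 t1 t) = leg23 t1 (leg12 t4 t) &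
      leg12 t2 (leg23 t1 t) = leg23 t1 (leg12 t2 t)].
Proof.
have [E1 [E2 [h1 h2 h12]]] := comult_coassociative (mbh_comult H).
have tE b : tau (E1 (Delta b)) = E2 (Delta b).
  by apply: (mult_extl hA3) => z; rewrite /= (proj1 (h12 b _)) ctassocVK.
have [[_ E1M] E1E] := h1; have [[_ E2M] E2E] := h2.
have n1 := Ext1_mtens _ h1; have n2 := Ext2_mtens _ h2.
have oneE : mult1 (ctensor A A) = mtens one one.
  by apply: (mult_extl hA2) => z; rewrite /= ctmap_id.
apply: (coassoc_legs (M := fun b => E2 (Delta b))) => [b c|b c|a b|a b].
- by rewrite -E1E toT1 E1M n1 oneE tauM tE tau_mtens.
- by rewrite -E1E toT3 E1M n1 oneE tauM tE tau_mtens.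
- by rewrite -E2E toT2 E2M n2 oneE.
- by rewrite -E2E toT4 E2M n2 oneE.
Qed.


Context (epsilon : A -> K^o) (epsilonP : is_counit Delta epsilon).
Context (phi : A -> K^o) (phi_left : left_invariant Delta phi).
Context (q0 : A) (phi_q0 : phi q0 = 1).

Let b1 := t1_bl. Let b2 := t2_bl. Let b3 := t3_bl. Let b4 := t4_bl.
Let c1 := u1_bl. Let c2 := u2_bl. Let c3' := u3_bl. Let c4 := u4_bl.
Let swE x y : ctswap (tens x y : ctensor A A) = tens y x := proj2 (ctswapP A A) x y.
Let bmap := proj1 (mulmapP A). Let bmop := proj1 (mulopP A).
Let mapE := proj2 (mulmapP A). Let mopE := proj2 (mulopP A).

Let bphi : bounded_linear phi. Proof. by case: phi_left. Qed.

Let phiZ k x : phi (k *: x) = k * phi x.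
Proof. exact: (is_linearZ (proj1 bphi)). Qed.

Lemma R1_inj (z w : ctensor A A) : (forall r, R1 r z = R1 r w) -> z = w.
Proof.
move=> h; apply: (bai_right_inj hA2) => b; tens_ind b => r s.
by rewrite !mul_tens h.
Qed.

Lemma L2_inj (z w : ctensor A A) : (forall r, L2 r z = L2 r w) -> z = w.
Proof.
move=> h; apply: (bai_left_inj hA2) => b; tens_ind b => r s.
by rewrite !tens_mull h.
Qed.

(** * The counit *)

(** Evaluating phi turns the defining relation of the counit into a formula for it. *)
Lemma counit_bl : bounded_linear epsilon.
Proof.
have -> : epsilon = (fun a => phi (mulmap (u1 (tens a q0)))).
  apply/funext => a; rewrite -(epsilonP (u1K _)) phiZ phi_q0; exact/esym/mulr1.
bl.
Qed.
Let beps := counit_bl.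

Lemma counit_t1 z : slicel epsilon (t1 z) = mulmap z.
Proof.
have h w : slicel epsilon w = mulmap (u1 w).
  by tens_ind w => a b; rewrite slicelE// (epsilonP (u1K _)).
by rewrite h t1K.
Qed.

Lemma counit_t3 z : slicel epsilon (t3 z) = mulop z.
Proof.
tens_ind z => a b; rewrite t3E mopE; apply: (bai_right_inj hA) => c.
rewrite -(slicel_idl (g := bmul^~ c)); try bl.
rewrite -L2_T1 slicel_idl; try bl.
by rewrite -t1E counit_t1 mapE bmulA.
Qed.

(** The counit is defined through T1, so that it is a counit for the first leg of
Delta; coassociativity transfers this to the second leg. *)
Lemma counit_t2 z : slicer epsilon (t2 z) = mulmap z.
Proof.
tens_ind z => a p; rewrite mapE; pose F x := slicer epsilon (t2 (tens a x)).
have bF : bounded_linear F by rewrite /F; bl.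
have FT w : ctmap F id (t1 w) = L1 a (t1 w).
  have bs : bounded_linear (ctmap id (slicel epsilon) :
    ctensor A (ctensor A A) -> ctensor A A) by bl.
  have E1 v : ctmap id (slicel epsilon) (leg12 t2 (tens a v)) = ctmap F id v.
    tens_ind v => x y; rewrite leg12E// ctmapE//; last by bl.
    rewrite /F; move: (t2 (tens a x)) => w'; tens_ind w' => x' y'.
    by rewrite (proj2 (ctassocP _ _ _)) ctmapE ?slicelE ?slicerE//; [|bl|bl];
       rewrite (is_linearZ (proj1 (tens_blr _ _))) (is_linearZ (proj1 (tens_bll _ _))).
  have E2 v y : ctmap id (slicel epsilon) (leg23 t1 (ctassoc (tens v y))) = R2 y v.
    tens_ind v => x x'; rewrite (proj2 (ctassocP _ _ _)) leg23E// !ctmapE; try bl.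
    by rewrite counit_t1 mapE.
  rewrite -E1; tens_ind w => x y.
  have [_ _] := coassociativity (tens a (tens x y)).
  by rewrite leg23E// => ->; rewrite leg12E// E2 t1E L1_T1// t2E.
have : ctmap F id (tens p q0) = L1 a (tens p q0) by rewrite -(u1K (tens p q0)) FT.
rewrite !ctmapE; try bl.
by move/(congr1 (slicer phi)); rewrite !slicerE// phi_q0 !scale1r.
Qed.

Lemma counit_t4 z : slicer epsilon (t4 z) = mulop z.
Proof.
tens_ind z => a b; rewrite t4E mopE; apply: (bai_left_inj hA) => c.
rewrite -(slicer_idr (f := bmul c)); try bl.
rewrite L1_T4 slicer_idr; try bl.
by rewrite -t2E counit_t2 mapE bmulA.
Qed.

(** A form of multiplicativity of the counit: it is compatible with the left action of
Delta(a), and Delta(a)(p (x) q) is the product of T1(a (x) q) with p (x) 1. *)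
Lemma counit_R1 p (z : ctensor A A) : slicel epsilon (R1 p z) = (epsilon p : K) *: slicel epsilon z.
Proof.
have hD a w : slicel epsilon (ml (Delta a) w) = a ** slicel epsilon w.
  rewrite -(u1K w); move: (u1 w) => v; rewrite -t1_L1 !counit_t1.
  by tens_ind v => x y; rewrite ctmapE ?mapE ?bmulA//; bl.
rewrite -(u1K z); move: (u1 z) => v.
tens_ind v => a q.
rewrite t1E -Delta_tens1 hD -t1E counit_t1 mapE slicelE//.
exact: (is_linearZ (proj1 (bmul_linear_l a))).
Qed.

Lemma counitM a b : epsilon (a ** b) = epsilon a * epsilon b.
Proof.
have := counit_R1 b (tens a q0).
rewrite ctmapE; try bl.
rewrite !slicelE// => /(congr1 phi); rewrite !phiZ phi_q0.
by rewrite !mulr1 [RHS]mulrC.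
Qed.

Lemma counit_T3 b x : slicer epsilon (T3 Delta b x) = (epsilon x : K) *: b.
Proof.
have bL c : bounded_linear (fun y => epsilon (c ** y)) by bl.
have hL c (z : ctensor A A) : slicer epsilon (L2 c z) = (epsilon c : K) *: slicer epsilon z.
  tens_ind z => x' y.
  by rewrite ctmapE ?slicerE ?counitM ?scalerA//; bl.
apply: (bai_right_inj hA) => r.
rewrite -(slicer_idr (f := bmul^~ r)); try bl.
rewrite -L2_T4 hL -t4E counit_t4 mopE.
by rewrite (is_linearZ (proj1 (bmul_linear_r r))).
Qed.

Lemma counit_neq0 : exists x, epsilon x != 0.
Proof.
apply: contrapT => h; have e0 x : epsilon x = 0.
  by apply/eqP; apply: contra_notT h => hx; exists x.
have z0 : q0 = 0.
  apply: (bai_right0 hA) => b; rewrite -mapE -counit_t1.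
  tens_ind (t1 (tens q0 b)) => // x y; by rewrite slicelE// e0 scale0r.
by move: phi_q0; rewrite z0 (is_linear0 (proj1 bphi)) => /esym/eqP; rewrite oner_eq0.
Qed.

(** * The antipode *)

Let counit_u3 z : mulop (u3 z) = slicel epsilon z.
Proof. by rewrite -counit_t3 u3K. Qed.
Let counit_u4 z : mulop (u4 z) = slicer epsilon z.
Proof. by rewrite -counit_t4 u4K. Qed.

(* the commutation relation that produces the antipode *)
Let legs_inv t : leg12 u4 (leg23 u3 t) = leg23 u3 (leg12 u4 t).
Proof.
have k12 v : leg12 t4 (leg12 u4 v) = v.
  rewrite /leg12 ctassocK ctmap_comp; try bl.
  rewrite -[RHS]ctassocVK; congr ctassoc; move: (ctassocV v) => w.
  by rewrite (_ : (fun x => t4 (u4 x)) = id) ?ctmap_id//; apply/funext => x; exact: u4K.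
have k12' v : leg12 u4 (leg12 t4 v) = v.
  rewrite /leg12 ctassocK ctmap_comp; try bl.
  rewrite -[RHS]ctassocVK; congr ctassoc; move: (ctassocV v) => w.
  by rewrite (_ : (fun x => u4 (t4 x)) = id) ?ctmap_id//; apply/funext => x; exact: t4K.
have k23 v : leg23 t3 (leg23 u3 v) = v.
  rewrite /leg23 ctmap_comp; try bl.
  by rewrite (_ : (fun x => t3 (u3 x)) = id) ?ctmap_id//; apply/funext => x; exact: u3K.
have k23' v : leg23 u3 (leg23 t3 v) = v.
  rewrite /leg23 ctmap_comp; try bl.
  by rewrite (_ : (fun x => u3 (t3 x)) = id) ?ctmap_id//; apply/funext => x; exact: t3K.
have [cc _ _] := coassociativity (leg12 u4 (leg23 u3 t)).
move: cc; rewrite k12 k23 => /(congr1 (leg12 u4)); rewrite k12'.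
by move=> /(congr1 (leg23 u3)); rewrite k23'.
Qed.

(* contractions of the last two and of the first two legs, by the opposite product *)
Let con23 (w : ctensor A A) (c : A) : ctmap id (@mulop R K A) (ctassoc (tens w c)) = L2 c w.
Proof.
by tens_ind w => x y; rewrite (proj2 (ctassocP _ _ _)) !ctmapE ?mopE//; bl.
Qed.

Let con12 (t : ctensor A (ctensor A A)) : ctensor A A :=
  ctmap (@mulop R K A) id (ctassocV t).

Let con12_bl : bounded_linear con12. Proof. by rewrite /con12; bl. Qed.

Let con12E (x : A) (w : ctensor A A) : con12 (tens x w) = R1 x w.
Proof.
rewrite /con12; tens_ind w => y z.
by rewrite (proj2 (ctassocVP _ _ _)) !ctmapE ?mopE//; bl.
Qed.

Let con_con t : mulop (con12 t) = mulop (ctmap id (@mulop R K A) t).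
Proof.
tens_ind t => x w; rewrite con12E ctmapE; try bl.
tens_ind w => y z; rewrite ctmapE ?mopE; try bl.
by rewrite bmulA.
Qed.

Let counit23 (w : ctensor A A) (c : A) :
  ctmap id (slicel epsilon) (ctassoc (tens w c)) = tens (slicer epsilon w) c.
Proof.
tens_ind w => x y; rewrite (proj2 (ctassocP _ _ _)) ctmapE ?slicelE ?slicerE//; try bl.
by rewrite (is_linearZ (proj1 (tens_blr _ _))) (is_linearZ (proj1 (tens_bll _ _))).
Qed.

Let counit12 (x : A) (w : ctensor A A) :
  ctmap (slicer epsilon) id (ctassocV (tens x w)) = tens x (slicel epsilon w).
Proof.
tens_ind w => y z; rewrite (proj2 (ctassocVP _ _ _)) ctmapE ?slicelE ?slicerE//; try bl.
by rewrite (is_linearZ (proj1 (tens_blr _ _))) (is_linearZ (proj1 (tens_bll _ _))).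
Qed.

(* In Sweedler notation  T4^-1(r (x) a) = P(a1)r (x) a2  and
   T3^-1(a (x) q) = a1 (x) qP(a2),  so that these slices are P(a)r and qP(a). *)
Let slice4 (r a : A) := slicer epsilon (u4 (tens r a)).
Let slice3 (a q : A) := slicel epsilon (u3 (tens a q)).

Let con_legs (a y q : A) :
  ctmap id (@mulop R K A) (leg12 u4 (leg23 u3 (tens a (tens y q)))) = tens (slice4 a y) q /\
  con12 (leg12 u4 (leg23 u3 (tens a (tens y q)))) = tens a (slice3 y q).
Proof.
split.
  rewrite legs_inv leg12E// /leg23 ctmap_comp; try bl.
  rewrite (_ : (fun x => mulop (u3 x)) = slicel epsilon) ?counit23//.
  by apply/funext => x; exact: counit_u3.
rewrite leg23E// /con12 /leg12 ctassocK ctmap_comp; try bl.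
rewrite (_ : (fun x => mulop (u4 x)) = slicer epsilon) ?counit12//.
by apply/funext => x; exact: counit_u4.
Qed.

Let W (z : ctensor A A) := u4 (t1 (ctswap (u3 z))).
Let bW : bounded_linear W. Proof. by rewrite /W; bl. Qed.

Let W_R1 (r a q : A) : R1 r (W (tens a q)) = tens (slice4 r a) q.
Proof.
rewrite -(proj1 (con_legs r a q)) leg23E// /W; move: (u3 _) => z.
tens_ind z => x y; rewrite leg12E// con23 swE t1E -u4_R1//.
by rewrite -Delta_tens1 u4_Delta.
Qed.

(** By [W_R1] the operator  W = T4^-1 T1 flip T3^-1  acts on the first leg only; the
inverse of the antipode is that action. *)
Definition antipodeV (a : A) : A := slicer phi (W (tens a q0)).

Lemma antipodeV_bl : bounded_linear antipodeV.
Proof. by rewrite /antipodeV; bl. Qed.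
Let bP := antipodeV_bl.

Lemma antipodeV_mulr a r : antipodeV a ** r = slicer epsilon (u4 (tens r a)).
Proof.
rewrite /antipodeV -(slicer_idr (f := bmul^~ r)); try bl.
by rewrite W_R1 slicerE// phi_q0 scale1r.
Qed.

Let W_E z : W z = ctmap antipodeV id z.
Proof.
tens_ind z => a q; apply: R1_inj => r.
by rewrite W_R1 !ctmapE ?antipodeV_mulr//; bl.
Qed.

Lemma t1_antipodeV z : t1 (ctswap z) = t4 (ctmap antipodeV id (t3 z)).
Proof. by rewrite -W_E /W t3K u4K. Qed.

(** The left and the right multiplier described by the slices of T4^-1 and T3^-1 belong
to one element: compare the two orders of contracting
P(a1)r (x) a2 (x) qP(a3)  to  qP(a3)a2P(a1)r. *)
Lemma antipodeV_mull q y : q ** antipodeV y = slicel epsilon (u3 (tens y q)).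
Proof.
apply: (bai_right_inj hA) => a; have [h1 h2] := con_legs a y q.
have := con_con (leg12 u4 (leg23 u3 (tens a (tens y q)))).
by rewrite h1 h2 !mopE -bmulA antipodeV_mulr => ->.
Qed.

(** The mirror image of [t1_antipodeV], with the two legs exchanged. *)
Lemma t2_antipodeV z : t2 (ctswap z) = t3 (ctmap id antipodeV (t4 z)).
Proof.
suff h v : u3 (t2 (ctswap (u4 v))) = ctmap id antipodeV v by rewrite -h t4K u3K.
tens_ind v => x y; apply: L2_inj => q; rewrite !ctmapE; try bl.
rewrite antipodeV_mull -/(slice3 y q) -(proj2 (con_legs x y q)) legs_inv leg12E//.
move: (u4 _) => w.
have b' : bounded_linear (fun w => ctassoc (tens w q : ctensor (ctensor A A) A)) by bl.
tens_ind w => a b; rewrite (proj2 (ctassocP _ _ _)) leg23E// con12E swE.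
by rewrite -u3_L2 t2E -Delta_tens2 u3_Delta.
Qed.

(** The inverse of W acts on the first leg only as well. *)
Definition antipode (a : A) : A := slicer phi (t3 (ctswap (u1 (t4 (tens a q0))))).

Lemma antipode_bl : bounded_linear antipode.
Proof. by rewrite /antipode; bl. Qed.

Lemma antipodeK : cancel antipode antipodeV.
Proof.
move=> a; rewrite /antipode -(slicer_idr (f := antipodeV)); try bl.
by rewrite -W_E /W t3K ctswapK u1K t4K slicerE// phi_q0 scale1r.
Qed.

Lemma antipodeVK : cancel antipodeV antipode.
Proof.
move=> a; rewrite /antipode.
have -> : tens (antipodeV a) q0 = W (tens a q0) by rewrite W_E ctmapE//; bl.
by rewrite /W u4K t1K ctswapK u3K slicerE// phi_q0 scale1r.
Qed.

Lemma antipodeVM x y : antipodeV (x ** y) = antipodeV y ** antipodeV x.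
Proof.
apply: (bai_left_inj hA) => q; rewrite antipodeV_mull bmulA (antipodeV_mull q y).
have -> : tens (x ** y) q = L1 x (t3 (u3 (tens y q))) by rewrite u3K ctmapE//; bl.
move: (u3 (tens y q)) => w.
tens_ind w => y' q'; rewrite t3E -Delta_tens3 u3_Delta counit_R1.
by rewrite -antipodeV_mull slicelE// (is_linearZ (proj1 (bmul_linear_r _))).
Qed.

(** T3 and T4 do not change the slices by an invariant functional, so that they drop
out on the outside of [t2_antipodeV] and [t1_antipodeV]. *)
Lemma slicel_antipodeV (om : A -> K^o) z : bounded_linear om ->
  (forall w, slicel om (t3 w) = slicel om w) ->
  slicel om (t2 (ctswap z)) = antipodeV (slicel om (t4 z)).
Proof. by move=> bo ho; rewrite t2_antipodeV ho slicel_idl. Qed.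

Lemma slicer_antipodeV (om : A -> K^o) z : bounded_linear om ->
  (forall w, slicer om (t4 w) = slicer om w) ->
  slicer om (t1 (ctswap z)) = antipodeV (slicer om (t3 z)).
Proof. by move=> bo ho; rewrite t1_antipodeV ho slicer_idr. Qed.


(** * Invariant functionals *)

Context (psi : A -> K^o) (psi_right : right_invariant Delta psi).
Context (r0 : A) (psi_r0 : psi r0 = 1).
Context (phi_faithful : forall a, (forall x, phi (x ** a) = 0) -> a = 0).

Local Notation P := antipodeV.
Local Notation S := antipode.

Let bpsi : bounded_linear psi. Proof. by case: psi_right. Qed.
Let bS := antipode_bl.
Let SK := antipodeK.
Let PK := antipodeVK.
Let PM := antipodeVM.

Lemma funZ (om : A -> K^o) k x : bounded_linear om -> om (k *: x) = k * om x.
Proof. by move=> bo; exact: (is_linearZ (proj1 bo)). Qed.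

Lemma phi_t4 z : slicer phi (t4 z) = slicer phi z.
Proof.
by tens_ind z => a b; rewrite t4E slicerE//; case: phi_left => _ _ /(_ b a) [].
Qed.
Lemma phi_t2 z : slicer phi (t2 z) = slicer phi z.
Proof.
by tens_ind z => a b; rewrite t2E slicerE//; case: phi_left => _ _ /(_ b a) [].
Qed.
Lemma psi_t1 z : slicel psi (t1 z) = slicel psi z.
Proof.
by tens_ind z => a b; rewrite t1E slicelE//; case: psi_right => _ _ /(_ a b) [].
Qed.
Lemma psi_t3 z : slicel psi (t3 z) = slicel psi z.
Proof.
by tens_ind z => a b; rewrite t3E slicelE//; case: psi_right => _ _ /(_ a b) [].
Qed.

(** Evaluating  (psi (x) om)(Delta(x) z)  in the two possible ways turns functionals
psi( . c) into functionals om( . a). *)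
Lemma right_translates (om : A -> K^o) z x : bounded_linear om ->
  (forall w, slicer om (t4 w) = slicer om w) ->
  psi (x ** slicer om (u1 z)) = om (x ** slicel psi (u4 z)).
Proof.
move=> bo ho; transitivity (om (slicel psi (ml (Delta x) z))).
  rewrite -{2}(u1K z) -t1_L1// psi_t1 slice_fubini// slicer_idr//; bl.
rewrite slice_fubini// -{1}(u4K z) -t4_L2// ho -slice_fubini// slicel_idl//; bl.
Qed.

Lemma left_translates (om : A -> K^o) z x : bounded_linear om ->
  (forall w, slicel om (t3 w) = slicel om w) ->
  om (slicer phi (u3 z) ** x) = phi (slicel om (u2 z) ** x).
Proof.
move=> bo ho; transitivity (phi (slicel om (mr (Delta x) z))).
  by rewrite -{2}(u3K z) -t3_R1// ho slice_fubini// slicer_idr//; bl.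
by rewrite slice_fubini// -{1}(u2K z) -t2_R2// phi_t2 -slice_fubini// slicel_idl//; bl.
Qed.

Lemma slicer_T1_eq (om1 om2 : A -> K^o) a1 a2 x :
  bounded_linear om1 -> bounded_linear om2 ->
  (forall y, om1 (y ** a1) = om2 (y ** a2)) ->
  slicer om1 (T1 Delta x a1) = slicer om2 (T1 Delta x a2).
Proof.
move=> bo1 bo2 h; apply: (bai_left_inj hA) => c.
rewrite -!(slicer_idr (f := bmul c)); try bl.
rewrite !L1_T1 !(slicer_ctmap (@bounded_linear_id _ _ A)); try bl.
by rewrite (funext h).
Qed.

Lemma slicel_T2_eq (om1 om2 : A -> K^o) a1 a2 x :
  bounded_linear om1 -> bounded_linear om2 ->
  (forall y, om1 (a1 ** y) = om2 (a2 ** y)) ->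
  slicel om1 (T2 Delta a1 x) = slicel om2 (T2 Delta a2 x).
Proof.
move=> bo1 bo2 h; apply: (bai_right_inj hA) => c.
rewrite -!(slicel_idl (g := bmul^~ c)); try bl.
rewrite -!L1_T1 !(slicel_ctmap _ (@bounded_linear_id _ _ A)); try bl.
by rewrite (funext h).
Qed.

(** If  phi( . b) = om( . a),  the slices of Delta(x)(1 (x) b) by phi and of
Delta(x)(1 (x) a) by om agree. By [slicer_antipodeV] so do the slices of
(1 (x) x)Delta(b) and (1 (x) x)Delta(a), and on these psi takes the values
psi(b)phi(x) and psi(a)om(x). *)
Lemma left_invariant_uniq (om : A -> K^o) : bounded_linear om ->
  (forall w, slicer om (t4 w) = slicer om w) -> exists k : K, forall x, om x = k * phi x.
Proof.
move=> bo ho; have [[p op]|nop] := pselect (exists p, om p != 0); last first.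
  exists 0 => x; rewrite mul0r; apply/eqP; apply: contra_notT nop => h; by exists x.
pose p1 := (om p)^-1 *: p; have op1 : om p1 = 1 by rewrite funZ// mulVf.
pose z := t4 (tens r0 r0); pose c := slicer phi (u1 z).
have h1 x : psi (x ** c) = phi (x ** r0).
  by rewrite (right_translates _ _ bphi phi_t4) t4K slicelE// psi_r0 scale1r.
pose a := slicel psi (u4 (t1 (tens c p1))).
have h2 x : psi (x ** c) = om (x ** a).
  by rewrite -(right_translates _ _ bo ho) t1K slicerE// op1 scale1r.
have h3 x : phi x = psi a * om x.
  have : slicer phi (T1 Delta x r0) = slicer om (T1 Delta x a).
    by apply: slicer_T1_eq => // y; rewrite -h1 h2.
  have E b y : T1 Delta y b = t1 (ctswap (tens b y)) by rewrite swE t1E.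
  rewrite !E !(slicer_antipodeV)//; last exact: phi_t4.
  move/(can_inj PK)/(congr1 psi); rewrite -!slice_fubini// !psi_t3 !slicelE//.
  by rewrite !funZ// psi_r0 mul1r.
have a0 : psi a != 0.
  by apply/eqP => h; move: (h3 q0); rewrite h mul0r phi_q0 => /eqP; rewrite oner_eq0.
by exists (psi a)^-1 => x; rewrite h3 mulKf.
Qed.

(** As for [left_invariant_uniq], with the legs exchanged. *)
Lemma right_invariant_uniq (om : A -> K^o) p : bounded_linear om -> om p = 1 ->
  (forall w, slicel om (t3 w) = slicel om w) ->
  exists k : K, k != 0 /\ forall x, om x = k * psi x.
Proof.
move=> bo op ho.
pose d := slicel psi (u2 (t3 (tens q0 q0))).
have h1 x : psi (q0 ** x) = phi (d ** x).
  by rewrite -(left_translates _ _ bpsi psi_t3) t3K slicerE// phi_q0 scale1r.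
pose a := slicer phi (u3 (t2 (tens p d))).
have h2 x : om (a ** x) = phi (d ** x).
  by rewrite (left_translates _ _ bo ho) t2K slicelE// op scale1r.
have h3 x : psi x = phi a * om x.
  have : slicel psi (T2 Delta q0 x) = slicel om (T2 Delta a x).
    by apply: slicel_T2_eq => // y; rewrite h1 h2.
  have E b y : T2 Delta b y = t2 (ctswap (tens y b)) by rewrite swE t2E.
  rewrite !E !(slicel_antipodeV)//; last exact: psi_t3.
  move/(can_inj PK)/(congr1 phi); rewrite !slice_fubini// !phi_t4 !slicerE//.
  by rewrite !funZ// phi_q0 mul1r.
have a0 : phi a != 0.
  by apply/eqP => h; move: (h3 r0); rewrite h mul0r psi_r0 => /eqP; rewrite oner_eq0.
by exists (phi a)^-1; split=> [|x]; rewrite ?invr_eq0// h3 mulKf.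
Qed.

(** For fixed b the functional  y |-> (phi (x) phi)(Delta(y)(1 (x) b))  is again
left-invariant, by coassociativity. *)
Lemma left_invariant_square b :
  let om := fun y => functens phi phi (t1 (tens y b)) in
  bounded_linear om /\ forall w, slicer om (t4 w) = slicer om w.
Proof.
move=> om; have bo : bounded_linear om by rewrite /om; bl.
split=> // w.
have bf : bounded_linear (functens phi phi : ctensor A A -> K^o) by bl.
pose S3 (t : ctensor A (ctensor A A)) := slicer (functens phi phi) t.
have bS3 : bounded_linear S3 by rewrite /S3; bl.
have E1 v : slicer om v = S3 (leg23 t1 (ctassoc (tens v b))).
  tens_ind v => x y; rewrite (proj2 (ctassocP _ _ _)) leg23E// /S3 !slicerE//.
have E2 v c : S3 (ctassoc (tens v c)) = (phi c : K) *: slicer phi v.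
  tens_ind v => x y; rewrite (proj2 (ctassocP _ _ _)) /S3 !slicerE//.
  by rewrite functens_tens// scalerA mulrC.
have E3 a z : S3 (leg12 t4 (tens a z)) = (functens phi phi z : K) *: a.
  have bz : bounded_linear (fun z : ctensor A A => (functens phi phi z : K) *: a).
    have ba : bounded_linear (fun k : K^o => (k : K) *: a).
      split=> [k x y|]; first by rewrite scalerDl scalerA.
      by exists (nrm a) => k; rewrite nrmZ mulrC.
    exact: (bounded_linear_comp ba bf).
  tens_ind z => x c.
  rewrite leg12E// E2 phi_t4 slicerE// functens_tens// scalerA mulrC//.
tens_ind w => a y; rewrite E1 slicerE// -leg12E//.
have [_ <- _] := coassociativity (tens a (tens y b)).
by rewrite leg23E// E3.
Qed.

(** The inverse antipode carries the left-invariant functional to a right-invariant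
one. By uniqueness  (phi (x) phi)(Delta(x)(1 (x) b)) = k(b) phi(x)  for some k, and
faithfulness of phi together with the counit identifies k with  phi o P. *)
Lemma antipodeV_right_invariant z :
  slicel (fun x => phi (P x)) (t3 z) = slicel (fun x => phi (P x)) z.
Proof.
have bpp : bounded_linear (fun x => phi (P x)) by bl.
tens_ind z => b x; rewrite t3E slicelE//.
have [bo ho] := left_invariant_square b; have [k hk] := left_invariant_uniq bo ho.
have key y : phi (slicel (fun x => phi (P x)) (T3 Delta b y)) = k * phi y.
  rewrite -hk functensr// slice_fubini// -t3E.
  by rewrite -(slicer_antipodeV _ bphi phi_t4) swE.
have E y : slicel (fun x => phi (P x)) (T3 Delta b y) = k *: y.
  apply/eqP; rewrite -subr_eq0; apply/eqP; apply: phi_faithful => c.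
  rewrite (is_linearB (proj1 (bmul_linear_l c))) (is_linearB (proj1 bphi)).
  rewrite -(slicel_idl (g := bmul c)); try bl.
  by rewrite -T3_mull key (is_linearZ (proj1 (bmul_linear_l c))) funZ// subrr.
rewrite E; congr (_ *: _).
have [y ey] := counit_neq0.
move/(congr1 epsilon): (E y); rewrite slice_fubini// (counit_T3).
by rewrite (is_linearZ (proj1 bP)) !funZ// [RHS]mulrC => /(mulfI ey).
Qed.

Lemma phi_antipodeV : exists k : K, k != 0 /\ forall x, phi (P x) = k * psi x.
Proof.
apply: (@right_invariant_uniq (fun x => phi (P x)) (S q0)); [bl|by rewrite SK|].
exact: antipodeV_right_invariant.
Qed.

(** * Comparison of the functionals phi(x . ), phi( . x), psi(x . ) *)

Lemma psil_phil : exists h : A -> A, bounded_linear h /\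
  forall c x, psi (c ** x) = phi (h c ** x).
Proof.
exists (fun c => slicel psi (u2 (t3 (tens c q0)))); split=> [|c x]; first by bl.
by rewrite -(left_translates _ _ bpsi psi_t3) t3K slicerE// phi_q0 scale1r.
Qed.

Lemma phil_psil : exists h : A -> A, bounded_linear h /\
  forall c x, phi (c ** x) = psi (h c ** x).
Proof.
exists (fun c => slicer phi (u3 (t2 (tens r0 c)))); split=> [|c x]; first by bl.
by rewrite (left_translates _ _ bpsi psi_t3) t2K slicelE// psi_r0 scale1r.
Qed.

(** Both sides are  (psi (x) phi)((a (x) 1)Delta(x)(1 (x) b))  for u = a (x) b. The
antipode moves the factor a, or b, to the other side of x. *)
Lemma modular_identity (u : ctensor A A) x :
  psi (slicer (fun y => phi (P y)) (t3 (ctmap id S u)) ** x) =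
  phi (x ** slicel (fun y => psi (P y)) (t4 (ctmap S id u))).
Proof.
have bp1 : bounded_linear (fun y => phi (P y)) by bl.
have bp2 : bounded_linear (fun y => psi (P y)) by bl.
tens_ind u => a b; rewrite !ctmapE; try bl.
rewrite t3E t4E; transitivity (functens psi phi (R2 b (T2 Delta a x))).
  have E : T2 Delta a x = t2 (ctswap (tens x a)) by rewrite swE t2E.
  rewrite functensl// slicel_idl; try bl.
  rewrite E (slicel_antipodeV _ bpsi psi_t3) -{2}(SK b) -PM.
  rewrite -(slicel_idl (g := bmul (S b))); try bl.
  rewrite t4E L2_T4 (slice_fubini (om2 := fun y => phi (P y)))//.
  by rewrite slicer_idr; try bl.
have E : T1 Delta x b = t1 (ctswap (tens b x)) by rewrite swE t1E.
rewrite -L1_T1 functensr// slicer_idr; try bl.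
rewrite E (slicer_antipodeV _ bphi phi_t4) -{1}(SK a) -PM.
rewrite -(slicer_idr (f := bmul^~ (S a))); try bl.
rewrite t3E -L2_T4 -(slice_fubini (om1 := fun y => psi (P y)))//.
by rewrite slicel_idl; try bl.
Qed.

Lemma phir_psil : exists j : A -> A, bounded_linear j /\
  forall c x, phi (x ** c) = psi (j c ** x).
Proof.
exists (fun c => slicer (fun y => phi (P y))
  (t3 (ctmap id S (ctmap P id (u4 (tens (S r0) c)))))); split=> [|c x]; first by bl.
have bp2 : bounded_linear (fun y => psi (P y)) by bl.
rewrite modular_identity ctmap_comp; try bl.
rewrite (_ : (fun x => S (P x)) = id) ?ctmap_id; last by apply/funext => y; exact: PK.
by rewrite u4K slicelE// SK psi_r0 scale1r.
Qed.

Lemma psil_phir : exists j : A -> A, bounded_linear j /\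
  forall c x, psi (c ** x) = phi (x ** j c).
Proof.
exists (fun c => slicel (fun y => psi (P y))
  (t4 (ctmap S id (ctmap id P (u3 (tens c (S q0))))))); split=> [|c x]; first by bl.
have bp1 : bounded_linear (fun y => phi (P y)) by bl.
rewrite -modular_identity ctmap_comp; try bl.
rewrite (_ : (fun x => S (P x)) = id) ?ctmap_id; last by apply/funext => y; exact: PK.
by rewrite u3K slicerE// SK phi_q0 scale1r.
Qed.

(** Here  (1 (x) q)T2(a (x) x) = (a (x) q)Delta(x),  an element whose value under
psi (x) phi is computed by [left_translates]. *)
Lemma convolution (a q x : A) :
  functens psi (fun y => phi (q ** y)) (T2 Delta a x) =
  psi (slicer phi (u3 (tens a q)) ** x).
Proof.
have bq : bounded_linear (fun y => phi (q ** y)) by bl.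
rewrite (left_translates _ _ bpsi psi_t3) functensl// -(slicel_idl (g := bmul q))//; try bl.
rewrite -Delta_tens2 -{1}(u2K (tens a q)) -t2_R2//.
rewrite slice_fubini// phi_t2 -slice_fubini// slicel_idl//; bl.
Qed.

Lemma counit_convolution (a q : A) :
  epsilon (slicer phi (u3 (tens a q))) = phi (q ** P a).
Proof.
by rewrite -slice_fubini// (antipodeV_mull).
Qed.

End HopfMaps.

(** * The dual and the bidual *)

Section NormReproducing.
Context (R : realType) (K : naFieldType R) (A : naBanachAlgType K).
Context (om : A -> K^o) (bom : bounded_linear om) (rep : norm_reproducing om).

Lemma norm_reproducing_norming a r : (exists x : A, x != 0) -> r < nrm a ->
  exists x, x != 0 /\ r * nrm x < nrm (om (x ** a)).
Proof.
move=> [y y0]; rewrite rep => /sup_gt [|_ [x /= x0 <-] h].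
  by exists (nrm (om (y ** a)) / nrm y), y.
by exists x; split=> //; move: h; rewrite ltr_pdivlMr// nrm_gt0.
Qed.

Lemma norm_reproducing_faithful a : (forall x, om (x ** a) = 0) -> a = 0.
Proof.
move=> h; apply/eqP; apply: contraT => a0.
have [x [x0]] := norm_reproducing_norming (ex_intro _ a a0) (nrm_gt0 a0).
by rewrite mul0r h nrm0 ltxx.
Qed.

Lemma functional_one (E : naNormedType K) (f : E -> K^o) : bounded_linear f ->
  (exists a, f a <> 0) -> exists q, f q = 1.
Proof.
move=> bf [a /eqP fa]; exists ((f a)^-1 *: a).
by rewrite (is_linearZ (proj1 bf)); exact: mulVf.
Qed.

End NormReproducing.

Lemma bai_near (R : realType) (K : naFieldType R) (A : naBanachAlgType K) (x y : A) (d : R) :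
  has_bounded_approximate_identity A -> 0 < d ->
  exists e, nrm (e ** x - x) < d /\ nrm (y ** e - y) < d.
Proof.
move=> [I [le [e [[_ _ _ dir] _ he]]]] d0.
have [i hi] := he x d d0; have [j hj] := he y d d0; have [k [ik jk]] := dir i j.
by exists (e k); split; [case: (hi k ik)|case: (hj k jk)].
Qed.

Lemma bai_iso (R : realType) (K : naFieldType R) (A B : naBanachAlgType K)
    (f : A -> B) (g : B -> A) : bounded_linear f -> cancel g f ->
  (forall x y, f (x ** y) = f x ** f y) ->
  has_bounded_approximate_identity A -> has_bounded_approximate_identity B.
Proof.
move=> bf gK fM [I [le [e [dle [C hC] he]]]].
have [D [D0 hD]] := bounded_linear_pos bf.
exists I, le, (fun i => f (e i)); split=> //.
  exists (D * C) => i; apply: le_trans (hD _) _; by rewrite ler_pM2l.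
move=> x d d0; have [i hi] := he (g x) _ (divr_gt0 d0 D0).
exists i => j /hi [h1 h2]; rewrite -{1 2 3 4}(gK x) -!fM -!(is_linearB (proj1 bf)).
by split; apply: le_lt_trans (hD _) _; rewrite mulrC -ltr_pdivlMr.
Qed.

Section DualObject.
Context (R : realType) (K : naFieldType R) (A : naBanachAlgType K).
Context (Delta : A -> mult (ctensor A A)) (phi : A -> K^o).
Context (B : naBanachAlgType K) (DeltaB : B -> mult (ctensor B B)) (ev : B -> A -> K^o).
Context (bphi : bounded_linear phi) (phi1 : opnorm phi <= 1).
Context (D : dual_object Delta phi DeltaB ev).

Lemma functional_le x : nrm (phi x) <= nrm x.
Proof.
by rewrite (le_trans (opnorm_bound x bphi))// ler_piMl ?nrm_ge0.
Qed.

Lemma dual_repr w : exists a, ev w = (fun x => phi (x ** a)) /\ nrm w = nrm a.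
Proof.
have : (range ev (ev w))%classic by exists w.
rewrite (dual_range D) => -[a _ h]; exists a; split=> //; exact: (dual_norm D).
Qed.

Lemma dual_of a : exists w, ev w = (fun x => phi (x ** a)) /\ nrm w = nrm a.
Proof.
have : (range ev (fun x => phi (x ** a)))%classic by rewrite (dual_range D); exists a.
by move=> [w _ h]; exists w; split=> //; exact: (dual_norm D).
Qed.

Lemma dual_ev_le w x : nrm (ev w x) <= nrm w * nrm x.
Proof.
have [a [-> ->]] := dual_repr w.
by rewrite (le_trans (functional_le _))// mulrC nrm_bmul.
Qed.

Lemma dual_evl_bl w : bounded_linear (ev w).
Proof.
split; last by exists (nrm w) => x; exact: dual_ev_le.
have [a [-> _]] := dual_repr w => k x y.
by rewrite bmul_linl (proj1 bphi).
Qed.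

Lemma dual_evr_bl x : bounded_linear (fun w => ev w x).
Proof.
split; last by exists (nrm x) => w; rewrite mulrC dual_ev_le.
by move=> k w w'; rewrite (dual_lin D).
Qed.

Lemma ev2_tens (u : ctensor B B) x y :
  ev2 ev u (tens x y) = functens (fun w => ev w x) (fun w => ev w y) u.
Proof.
rewrite /ev2 /functens; congr (ctlift _ u); apply/funext => w1; apply/funext => w2.
by rewrite -[LHS]/(functens (ev w1) (ev w2) (tens x y)) functens_tens//; exact: dual_evl_bl.
Qed.

End DualObject.

Section Bidual.
Context (R : realType) (K : naFieldType R)
    (A : naBanachAlgType K) (Delta : A -> mult (ctensor A A))
    (phi psi : A -> K^o) (epsilon : A -> K)
    (Ah : naBanachAlgType K) (Deltah : Ah -> mult (ctensor Ah Ah)) (ev : Ah -> A -> K^o)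
    (phih : Ah -> K^o) (c : K)
    (Ahh : naBanachAlgType K) (Deltahh : Ahh -> mult (ctensor Ahh Ahh))
    (evh : Ahh -> Ah -> K^o)
    (A_mbh : multiplier_banach_hopf Delta)
    (epsilon_counit : is_counit Delta epsilon)
    (phi_left : left_invariant Delta phi)
    (psi_right : right_invariant Delta psi)
    (phi_le1 : opnorm phi <= 1)
    (phi_reproducing : norm_reproducing phi)
    (Ah_dual : dual_object Delta phi Deltah ev)
    (Ah_approx : has_bounded_approximate_identity Ah)
    (phih_def : is_dual_functional ev psi epsilon phih)
    (c_neq0 : c != 0)
    (phih_bounded : bounded_linear (fun w => c *: phih w))
    (phih_le1 : opnorm (fun w => c *: phih w) <= 1)
    (Ahh_dual : dual_object Deltah (fun w => c *: phih w) Deltahh evh).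
Context (q0 r0 : A) (phi_q0 : phi q0 = 1) (psi_r0 : psi r0 = 1).

Local Notation P := (antipodeV Delta phi q0).
Local Notation S := (antipode Delta phi q0).

Let bphi : bounded_linear phi. Proof. by case: phi_left. Qed.
Let bpsi : bounded_linear psi. Proof. by case: psi_right. Qed.
Let phi_faithful := norm_reproducing_faithful phi_reproducing.
Let bS : bounded_linear S := antipode_bl A_mbh phi_left q0.
Let bP : bounded_linear P := antipodeV_bl A_mbh phi_left q0.
Let SK : cancel S P := antipodeK A_mbh epsilon_counit phi_left phi_q0.
Let PM x y : P (x ** y) = P y ** P x := antipodeVM A_mbh epsilon_counit phi_left phi_q0 x y.
Let evl w : bounded_linear (ev w) := dual_evl_bl bphi phi_le1 Ah_dual w.
Let evr x : bounded_linear (fun w => ev w x) := dual_evr_bl bphi phi_le1 Ah_dual x.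
Let evhl w : bounded_linear (evh w) := dual_evl_bl phih_bounded phih_le1 Ahh_dual w.
Let evhr x : bounded_linear (fun w => evh w x) := dual_evr_bl phih_bounded phih_le1 Ahh_dual x.
Hint Resolve evl evr evhl evhr : bl.

Let phil_phir : exists h : A -> A, bounded_linear h /\
  forall q x, phi (q ** x) = phi (x ** h q).
Proof.
have [h [bh hE]] := phil_psil A_mbh phi_left psi_right psi_r0.
have [j [bj jE]] := psil_phir A_mbh epsilon_counit phi_left phi_q0 psi_right.
by exists (fun q => j (h q)); split=> [|q x]; [bl|rewrite hE jE].
Qed.

Let phir_phil : exists h : A -> A, bounded_linear h /\
  forall q x, phi (x ** q) = phi (h q ** x).
Proof.
have [h [bh hE]] := psil_phil A_mbh phi_left phi_q0 psi_right.
have [j [bj jE]] := phir_psil A_mbh epsilon_counit phi_left phi_q0 psi_right psi_r0.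
by exists (fun q => h (j q)); split=> [|q x]; [bl|rewrite jE hE].
Qed.

Let dual_of_left q : exists w, ev w = (fun x => phi (q ** x)).
Proof.
have [h [_ hE]] := phil_phir; have [w [wE _]] := dual_of Ah_dual (h q).
by exists w; rewrite wE; apply/funext => x; rewrite -hE.
Qed.

Lemma ev_separates x y : (forall w, ev w x = ev w y) -> x = y.
Proof.
move=> h; apply/eqP; rewrite -subr_eq0; apply/eqP; apply: phi_faithful => q.
have [w wE] := dual_of_left q; have := h w; rewrite wE => {}h.
by rewrite (is_linearB (proj1 (bmul_linear_l q))) (is_linearB (proj1 bphi)) h subrr.
Qed.

(** The product of the dual is defined with both factors in the form phi( . c). With
om(a . ) as first factor, a moves to the left of Delta(x), where the invariance of om
can be used. *)
Lemma dual_mul_T2 (om : A -> K^o) a w w0 x : bounded_linear om ->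
  ev w = (fun y => om (a ** y)) ->
  ev (w ** w0) x = functens om (ev w0) (T2 Delta a x).
Proof.
move=> bo wE; have [c1 [w1E _]] := dual_repr Ah_dual w.
have [c2 [w2E _]] := dual_repr Ah_dual w0.
have E y : phi (y ** c1) = om (a ** y).
  by rewrite -[LHS]/((fun y => phi (y ** c1)) y) -w1E wE.
rewrite (dual_mul Ah_dual w1E w2E) (Delta_tens1 A_mbh) functensl//.
rewrite (slicel_ctmap _ (@bounded_linear_id _ _ A)); try bl.
rewrite (funext E) -(slicel_ctmap (f := bmul a) (g := id)); try bl.
rewrite (L1_T1 A_mbh) slicel_idl; try bl.
by rewrite functensl ?w2E//; bl.
Qed.

(** The convolution of psi(a . ) with phi(P(x) . ) is some psi(d . ), for which
epsilon(d) = phi(P(x)P(a)) = phi(P(ax))  is a multiple of psi(ax). *)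
Lemma phih_mul : exists k : K, k != 0 /\ forall w w0 x,
  ev w0 = (fun y => phi (P x ** y)) -> phih (w ** w0) = k * ev w x.
Proof.
have [k [k0 hk]] := phi_antipodeV A_mbh epsilon_counit phi_left phi_q0 psi_right psi_r0
  phi_faithful.
have [j [bj jE]] := phir_psil A_mbh epsilon_counit phi_left phi_q0 psi_right psi_r0.
exists k; split=> // w w0 x w0E; have [b [wE _]] := dual_repr Ah_dual w.
have wE' : ev w = (fun y => psi (j b ** y)).
  by rewrite wE; apply/funext => y; rewrite jE.
have := @phih_def (w ** w0) (slicer phi (ctlift_inv (T3 Delta) (tens (j b) (P x)))).
rewrite (counit_convolution A_mbh epsilon_counit phi_left phi_q0) -PM hk wE' => -> //.
apply/funext => y; rewrite (dual_mul_T2 _ _ bpsi wE') w0E.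
exact: (convolution A_mbh phi_left psi_right).
Qed.

(** The formula [phih_mul] is read in both directions: every evaluation on A belongs to
the bidual, and every element of the bidual is an evaluation. The bounds come from
the bounded maps that compare the families of functionals. *)
Lemma Gamma_exists : exists C : R, forall x, exists v : Ahh,
  (forall w, evh v w = ev w x) /\ nrm v <= C * nrm x.
Proof.
have [k [k0 hk]] := phih_mul; have [h [bh hE]] := phil_phir.
have bhP : bounded_linear (fun x => (c * k)^-1 *: h (P x)).
  by apply: bounded_linear_scale; bl.
have [C [C0 hC]] := bounded_linear_pos bhP; exists C => x.
have [w0 [w0E w0n]] := dual_of Ah_dual (h (P x)).
have w0E' : ev w0 = (fun y => phi (P x ** y)).
  by rewrite w0E; apply/funext => y; rewrite -hE.
have [v [vE vn]] := dual_of Ahh_dual ((c * k)^-1 *: w0).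
exists v; split=> [w|]; last first.
  by apply: le_trans (hC x); rewrite vn !nrmZ w0n.
rewrite vE (is_linearZ (proj1 (bmul_linear_l w))).
rewrite (is_linearZ (proj1 phih_bounded)) (hk _ _ _ w0E').
rewrite -[LHS]/((c * k)^-1 * (c * (k * ev w x)) : K) (mulrA c) mulKf//.
by rewrite mulf_neq0.
Qed.

Lemma Gamma_onto : exists C : R, forall v : Ahh, exists x,
  (forall w, evh v w = ev w x) /\ nrm x <= C * nrm v.
Proof.
have [k [k0 hk]] := phih_mul; have [h [bh hE]] := phir_phil.
have bSh : bounded_linear (fun x => (c * k) *: S (h x)).
  by apply: bounded_linear_scale; bl.
have [C [C0 hC]] := bounded_linear_pos bSh; exists C => v.
have [w0 [vE vn]] := dual_repr Ahh_dual v.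
have [b [w0E w0n]] := dual_repr Ah_dual w0.
have w0E' : ev w0 = (fun y => phi (P (S (h b)) ** y)).
  by rewrite w0E; apply/funext => y; rewrite SK hE.
exists ((c * k) *: S (h b)); split=> [w|]; last by rewrite vn w0n; exact: hC.
rewrite vE (hk _ _ _ w0E') (is_linearZ (proj1 (evl w))).
exact: (mulrA c k).
Qed.

Section Isomorphism.
Variables (Gamma : A -> Ahh) (Gamma' : Ahh -> A).
Hypothesis GammaE : forall a w, evh (Gamma a) w = ev w a.
Hypotheses (bG : bounded_linear Gamma) (bG' : bounded_linear Gamma').
Hypotheses (GK : cancel Gamma Gamma') (G'K : cancel Gamma' Gamma).

Let Gamma'E v w : ev w (Gamma' v) = evh v w.
Proof. by rewrite -GammaE G'K. Qed.

Lemma functens_Gamma a b (Z : ctensor Ah Ah) :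
  functens (evh (Gamma a)) (evh (Gamma b)) Z = ev2 ev Z (tens a b).
Proof.
rewrite (ev2_tens bphi phi_le1 Ah_dual); congr functens; apply/funext => w; exact: GammaE.
Qed.

(** Let w2 be the element of the dual that represents Gamma(a2), and w' = w(a1 . ).
Replacing w2 by u w2 changes the value of Gamma(a1)Gamma(a2) at w into (w' u)(a2). As u
runs through an approximate identity, the former returns to its original value and the
latter tends to w'(a2) = w(a1 a2). *)
Lemma GammaM a1 a2 : Gamma (a1 ** a2) = Gamma a1 ** Gamma a2.
Proof.
apply: (dual_inj Ahh_dual); apply/funext => w; rewrite GammaE.
have [w1 [G1 _]] := dual_repr Ahh_dual (Gamma a1).
have [w2 [G2 _]] := dual_repr Ahh_dual (Gamma a2).
rewrite (dual_mul Ahh_dual G1 G2).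
set phihc := (fun w => c *: phih w) in G1 G2 *.
have bc : bounded_linear phihc := phih_bounded.
pose F v := functens phihc phihc (ml (Deltah w) (tens w1 v)).
have bF : bounded_linear F by rewrite /F; bl.
have [b [wE _]] := dual_repr Ah_dual w.
have [w' w'E] : exists w', ev w' = (fun y => ev w (a1 ** y)).
  have [h [_ hE]] := phir_phil; have [w' w'E] := dual_of_left (h b ** a1).
  by exists w'; rewrite w'E wE; apply/funext => y; rewrite -bmulA -hE.
have Fu u : F (u ** w2) = ev (w' ** u) a2.
  rewrite (dual_mul_T2 _ _ (evl w) w'E).
  have [la ev2E] := dual_comult1 Ah_dual w u; rewrite -ev2E -functens_Gamma.
  have -> : F (u ** w2) = functens phihc phihc (T1 Deltah w u ** tens w1 w2).
    rewrite /F; congr functens.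
    rewrite -[RHS]/(ml (to_mult (T1 Deltah w u)) _) (to_multK_ex la) /=.
    by rewrite ctmapE//; bl.
  rewrite mul_tens functensl// slicel_idl; try bl.
  rewrite (slicel_ctmap _ (@bounded_linear_id _ _ Ah)); try bl.
  by rewrite functensl// G1 G2; try bl.
have -> : ev w (a1 ** a2) = ev w' a2 by rewrite w'E.
rewrite -/(F w2); apply/eqP; rewrite -subr_eq0; apply/eqP; apply: nrm_small => d d0.
have [C1 [C10 hC1]] := bounded_linear_pos bF.
have [C2 [C20 hC2]] := bounded_linear_pos (evr a2).
have m0 : 0 < Num.min (d / C1) (d / C2) by rewrite lt_min !divr_gt0.
have [e [he1 he2]] := bai_near w2 w' Ah_approx m0.
have -> : ev w' a2 - F w2 = F (e ** w2 - w2) - ev (w' ** e - w') a2.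
  rewrite (is_linearB (proj1 bF)) (is_linearB (proj1 (evr a2))) Fu.
  by rewrite opprB [RHS]addrC addrA subrK.
rewrite (le_lt_trans (nrmB _ _))// gt_max; apply/andP; split.
  apply: le_lt_trans (hC1 _) _; rewrite mulrC -ltr_pdivlMr//.
  by apply: lt_le_trans he1 _; rewrite ge_min lexx.
apply: le_lt_trans (hC2 _) _; rewrite mulrC -ltr_pdivlMr//.
by apply: lt_le_trans he2 _; rewrite ge_min lexx orbT.
Qed.

(** The functionals phi(x . ) belong to the dual, and they are norming by the norm
reproducing property. *)
Lemma ev_tensor_inj (z : ctensor A A) :
  (forall w1 w2, functens (ev w1) (ev w2) z = 0) -> z = 0.
Proof.
move=> h.
have q00 : q0 != 0.
  apply/eqP => h0; move: phi_q0; rewrite h0 (is_linear0 (proj1 bphi)).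
  by move/esym/eqP; rewrite oner_eq0.
have bq x : bounded_linear (fun y => phi (x ** y)) by bl.
apply: (@slicer_inj R K A A {x : A | x != 0} (fun x y => phi (val x ** y))
  (fun x => nrm (val x))) => [|x|x|x y|y r ry|x].
- exact: complete_of_functional bphi phi_q0.
- exact: bq.
- by apply: nrm_gt0; exact: (valP x).
- by rewrite (le_trans (functional_le bphi phi_le1 _))// nrm_bmul.
- have [x [x0 hx]] := norm_reproducing_norming phi_reproducing (ex_intro _ q0 q00) ry.
  by exists (exist _ x x0).
- apply: ev_separates => w1; rewrite (is_linear0 (proj1 (evl w1))).
  have [w2 w2E] := dual_of_left (val x); have := h w1 w2.
  by rewrite functensr// w2E.
Qed.

(** The coproduct of the dual is defined by duality with the one of A, and the coproduct
of the bidual by duality with the one of the dual, so that both sides have the same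
values on functionals. *)
Lemma T1_Gamma a b : lies_in_alg (mT1 Deltahh (Gamma a) (Gamma b)) /\
  T1 Deltahh (Gamma a) (Gamma b) = ctmap Gamma Gamma (T1 Delta a b).
Proof.
have [la ev2E] := dual_comult1 Ahh_dual (Gamma a) (Gamma b); split=> //.
have GG' z : ctmap Gamma Gamma (ctmap Gamma' Gamma' z) = z.
  by rewrite ctmap_comp// (_ : (fun x => _) = id) ?ctmap_id//; apply/funext.
rewrite -[LHS]GG'; congr (ctmap _ _ _); apply/eqP; rewrite -subr_eq0; apply/eqP.
apply: ev_tensor_inj => w1 w2.
have bf : bounded_linear (functens (ev w1) (ev w2)) by bl.
rewrite (is_linearB (proj1 bf)); apply/eqP; rewrite subr_eq0; apply/eqP.
have [_ ev2E'] := dual_comult2 Ah_dual w1 w2.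
rewrite -ev2E' -functens_Gamma -ev2E (ev2_tens phih_bounded phih_le1 Ahh_dual).
move: (T1 Deltahh _ _) => u.
have b1 : bounded_linear (fun v => evh v w1) by exact: evhr.
have b2 : bounded_linear (fun v => evh v w2) by exact: evhr.
tens_ind u => v1 v2.
by rewrite ctmapE// !functens_tens// !Gamma'E.
Qed.

Let Gamma_ext := tensor_transport bG bG' GK G'K GammaM.

(** Products being dense, a multiplier of the tensor square is determined by its
products with the elements 1 (x) b, which are known from [T1_Gamma]. *)
Let Gamma_ext_Delta a : Deltahh (Gamma a) = Gamma_ext (Delta a).
Proof.
have hAhh := bai_iso bG G'K GammaM (mbh_approx A_mbh).
apply: (mult_extl (bai_ctensor hAhh hAhh)) => t.
tens_ind t => u v; move: v.
apply: (bai_ext hAhh); [bl|bl|move=> v1 v2].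
rewrite -(G'K v1); move: (Gamma' v1) => b.
have [la TE] := T1_Gamma a b.
have ht w x y : tens x (w ** y) = ml (mtens (mult1 Ahh) (to_mult w)) (tens x y).
  by rewrite /= ctmapE//; bl.
rewrite ht -!mlE -[_ ** _]/(mT1 Deltahh (Gamma a) (Gamma b)) -(to_multK_ex la).
rewrite -/(T1 Deltahh (Gamma a) (Gamma b)) TE.
have [[_ EM] EE] := tensor_transport_extends bG bG' GK G'K GammaM; rewrite -EE.
have [la1 _ _ _] := comult_T_in_alg (mbh_comult A_mbh) a b.
rewrite /T1 (to_multK_ex la1) EM -/Gamma_ext; congr (ml (_ ** _) _).
apply: mult_ext => z /=; rewrite !ctmap_comp; try bl; congr (ctmap _ _ z);
  apply/funext => x /=; by rewrite ?GammaM ?G'K.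
Qed.

Lemma Gamma_coproduct : exists Ext,
  extends_hom (fun z => to_mult (ctmap Gamma Gamma z)) Ext /\
  forall a, Deltahh (Gamma a) = Ext (Delta a).
Proof.
by exists Gamma_ext; split; [exact: tensor_transport_extends|exact: Gamma_ext_Delta].
Qed.

End Isomorphism.
End Bidual.

Theorem theorem4p4 (R : realType) (K : naFieldType R)
    (A : naBanachAlgType K) (Delta : A -> mult (ctensor A A))
    (phi psi : A -> K^o) (epsilon : A -> K)
    (Ah : naBanachAlgType K) (Deltah : Ah -> mult (ctensor Ah Ah)) (ev : Ah -> A -> K^o)
    (phih : Ah -> K^o) (c : K)
    (Ahh : naBanachAlgType K) (Deltahh : Ahh -> mult (ctensor Ahh Ahh))
    (evh : Ahh -> Ah -> K^o)
    (A_mbh : multiplier_banach_hopf Delta)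
    (epsilon_counit : is_counit Delta epsilon)
    (phi_left : left_invariant Delta phi)
    (psi_right : right_invariant Delta psi)
    (phi_le1 : opnorm phi <= 1)
    (phi_reproducing : norm_reproducing phi)
    (Ah_dual : dual_object Delta phi Deltah ev)
    (Ah_approx : has_bounded_approximate_identity Ah)
    (phih_def : is_dual_functional ev psi epsilon phih)
    (c_neq0 : c != 0)
    (phih_bounded : bounded_linear (fun w => c *: phih w))
    (phih_le1 : opnorm (fun w => c *: phih w) <= 1)
    (phih_reproducing : norm_reproducing (fun w => c *: phih w))
    (Ahh_dual : dual_object Deltah (fun w => c *: phih w) Deltahh evh) :
  exists (Gamma : A -> Ahh) (Gamma' : Ahh -> A)
         (Ext : mult (ctensor A A) -> mult (ctensor Ahh Ahh)),
    [/\ forall (a : A) (w : Ah), evh (Gamma a) w = ev w a,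
        [/\ bounded_linear Gamma, bounded_linear Gamma',
            cancel Gamma Gamma' & cancel Gamma' Gamma],
        forall a1 a2 : A, Gamma (a1 ** a2) = Gamma a1 ** Gamma a2,
        extends_hom (fun z => to_mult (ctmap Gamma Gamma z)) Ext &
        forall a : A, Deltahh (Gamma a) = Ext (Delta a)].
Proof.
have bphi : bounded_linear phi by case: phi_left.
have bpsi : bounded_linear psi by case: psi_right.
have [q0 phi_q0] : exists q, phi q = 1.
  by apply: functional_one => //; case: phi_left.
have [r0 psi_r0] : exists r, psi r = 1.
  by apply: functional_one => //; case: psi_right.
have evl w : bounded_linear (ev w) := dual_evl_bl bphi phi_le1 Ah_dual w.
have sep := ev_separates A_mbh epsilon_counit phi_left psi_right phi_reproducing Ah_dual
  phi_q0 psi_r0.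
have [C /boolp.choice[Gamma hG]] := Gamma_exists A_mbh epsilon_counit phi_left psi_right
  phi_reproducing Ah_dual phih_def c_neq0 phih_bounded Ahh_dual phi_q0 psi_r0.
have [C' /boolp.choice[Gamma' hG']] := Gamma_onto A_mbh epsilon_counit phi_left psi_right
  phi_le1 phi_reproducing Ah_dual phih_def Ahh_dual phi_q0 psi_r0.
have GE a w : evh (Gamma a) w = ev w a by case: (hG a).
have G'E v w : evh v w = ev w (Gamma' v) by case: (hG' v).
have GK : cancel Gamma Gamma' by move=> a; apply: sep => w; rewrite -G'E GE.
have G'K : cancel Gamma' Gamma.
  by move=> v; apply: (dual_inj Ahh_dual); apply/funext => w; rewrite GE -G'E.
have lG : is_linear Gamma.
  move=> k x y; apply: (dual_inj Ahh_dual); apply/funext => w.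
  by rewrite (dual_lin Ahh_dual) !GE (proj1 (evl w)).
have bG : bounded_linear Gamma by split=> //; exists C => x; case: (hG x).
have bG' : bounded_linear Gamma'.
  split; last by exists C' => v; case: (hG' v).
  by move=> k x y; apply: (can_inj GK); rewrite lG !G'K.
have GM := GammaM A_mbh epsilon_counit phi_left psi_right phi_le1 Ah_dual
  Ah_approx phih_bounded phih_le1 Ahh_dual phi_q0 psi_r0 GE.
have [Ext [ExtE ExtD]] := Gamma_coproduct A_mbh epsilon_counit phi_left psi_right phi_le1
  phi_reproducing Ah_dual Ah_approx phih_bounded phih_le1 Ahh_dual phi_q0 psi_r0 GE bG bG'
  GK G'K.
by exists Gamma, Gamma', Ext; split.
Qed.
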